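(* There is an absolute constant $A'>0$ such that for every Coxeter system $(W,S)$, every real $p$ with $2\le p<\infty$, every $n\in\mathbb{N}$ and every family $(a_s)_{s\in S}$ of matrices $a_s\in M_n(\mathbb{C})$ with only finitely many nonzero members, $$\left\|(a_s)_{s\in S}\right\|_{R\cap C}\le\left\|\sum_{s\in S}a_s\otimes\lambda(s)\right\|_{L^p(W)}\le 2A'\sqrt{p}\,\left\|(a_s)_{s\in S}\right\|_{R\cap C}.$$
   Context: A Coxeter system $(W,S)$ is a group $W$ with a (possibly infinite) generating set $S$ and presentation $W=\langle S\mid (s_1s_2)^{m(s_1,s_2)}=1 \text{ whenever } m(s_1,s_2)\neq\infty\rangle$, where $m\colon S\times S\to\{1,2,\dots,\infty\}$ is symmetric and $m(s_1,s_2)=1$ iff $s_1=s_2$. $\lambda$ is the left regular representation of $W$ on $\ell^2(W)$ and $\tau\left(\sum_g c_g\lambda(g)\right)=c_e$ is the von Neumann trace. For $A\in M_n(\mathbb{C})$, $\|A\|_{\mathcal{S}_p}=\left(\mathrm{tr}\,|A|^p\right)^{1/p}$ with $|A|=(A^*A)^{1/2}$ and $\mathrm{tr}$ the usual (unnormalised) trace. For a finite sum $x=\sum_g a_g\otimes\lambda(g)$ with $a_g\in M_n(\mathbb{C})$, $\|x\|_{L^p(W)}=\left((\mathrm{tr}\otimes\tau)\left((x^*x)^{p/2}\right)\right)^{1/p}$ is the noncommutative $L^p$-norm. The row–column norm is $$\left\|(a_s)_{s\in S}\right\|_{R\cap C}=\max\left\{\left\|\Big(\sum_{s\in S}a_sa_s^*\Big)^{1/2}\right\|_{\mathcal{S}_p},\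 \left\|\Big(\sum_{s\in S}a_s^*a_s\Big)^{1/2}\right\|_{\mathcal{S}_p}\right\}.$$ *)

(* Defs.v *)
From HB Require Import structures.
From mathcomp Require Import all_boot all_order all_algebra.
From mathcomp Require Import spectral complex.
From mathcomp Require Import all_classical all_reals all_analysis.
Set Implicit Arguments.
Unset Strict Implicit.
Unset Printing Implicit Defensive.
Import Order.TTheory GRing.Theory Num.Theory numFieldNormedType.Exports.
Local Open Scope classical_set_scope.
Local Open Scope ring_scope.
Local Open Scope complex_scope.

(* [None] encodes m(s, t) = oo; only the values of [m] on S * S matter. *)
Definition coxeter_matrix (W : Type) (S : set W) (m : W -> W -> option nat) :
    Prop :=
  [/\ forall s t, S s -> S t -> m s t = m t s,
      forall s t, S s -> S t -> (m s t = Some 1%N <-> s = t) &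
      forall s t, S s -> S t -> m s t <> Some 0%N].

Definition generates (W : groupType) (S : set W) : Prop :=
  forall H : set W,
    S `<=` H -> H 1%g -> (forall x y, H x -> H y -> H (x * y)%g) ->
    (forall x, H x -> H x^-1%g) -> H = setT.

Definition coxeter_relations (W : Type) (S : set W) (m : W -> W -> option nat)
    (G : groupType) (f : W -> G) : Prop :=
  forall s t k, S s -> S t -> m s t = Some k -> ((f s * f t) ^+ k = 1)%g.

(* The last two clauses are the universal property of the group presented by
   <S | (st)^m(s,t) = 1>; uniqueness of phi follows from [generates S]. Only the
   restriction of [f] to S is relevant. *)
Definition coxeter_system (W : groupType) (S : set W)
    (m : W -> W -> option nat) : Prop :=
  [/\ coxeter_matrix S m,
      generates S,
      coxeter_relations S m (id : W -> W) &
      forall (G : groupType) (f : W -> G), coxeter_relations S m f ->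
        exists phi : {multiplicative W -> G}, forall s, S s -> phi s = f s].

Section Schatten.
Variables (R : realType) (n : nat).
Implicit Type A : 'M[R[i]]_n.

Definition adjmx A : 'M[R[i]]_n := map_mx Num.conj A^T.

(* Functional calculus phi(A) of a Hermitian matrix, through the unitary
   diagonalisation of A, whose eigenvalues are real. *)
Definition mx_calculus (phi : R -> R) A : 'M[R[i]]_n :=
  invmx (spectralmx A)
  *m diag_mx (map_mx (fun z : R[i] => (phi (complex.Re z))%:C) (spectral_diag A))
  *m spectralmx A.

Definition mx_rpow (r : R) A := mx_calculus (fun t => t `^ r) A.

Definition mx_abs A := mx_rpow 2^-1 (adjmx A *m A).

Definition schatten (p : R) A : R :=
  complex.Re (\tr (mx_rpow p (mx_abs A))) `^ p^-1.

Definition RC_norm (I : choiceType) (S : set I) (p : R) (a : I -> 'M[R[i]]_n) :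
    R :=
  Num.max
    (schatten p (mx_rpow 2^-1 (\sum_(s \in S) a s *m adjmx (a s))))
    (schatten p (mx_rpow 2^-1 (\sum_(s \in S) adjmx (a s) *m a s))).

End Schatten.

(* The Hilbert space l^2(W) (x) C^n is represented by the functions
   f : W -> C^n such that [l2norm f < +oo]. Operators on it are represented by
   functions on all of W -> C^n, of which only the values on l^2 matter. *)
Section GroupOperators.
Variables (R : realType) (W : groupType) (n : nat).
Local Notation C := R[i].
Local Notation vect := (W -> 'cV[C]_n).
Local Notation oper := (vect -> vect).
Implicit Types (f : vect) (T B : oper).

Definition l2norm f : \bar R :=
  ((\esum_(w in [set: W]) (\sum_(i < n) complex.Re `|f w i ord0| ^+ 2)%:E)
     `^ 2^-1)%E.

Definition op_norm T : \bar R :=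
  ereal_sup [set l2norm (T f) | f in [set f | (l2norm f <= 1)%E]].

Definition bounded_operator T : Prop :=
  (forall (c : C) (f f1 : vect), (l2norm f < +oo)%E -> (l2norm f1 < +oo)%E ->
     T (c *: f + f1) = c *: T f + T f1)
  /\ (op_norm T < +oo)%E.

Definition poly_op (P : {poly R}) T : oper :=
  fun f => \sum_(k < size P) (P`_k)%:C *: iter k T f.

(* Continuous functional calculus of a positive bounded operator T (so that its
   spectrum lies in [0, ||T||]): phi(T) is the limit in operator norm of P_k(T)
   for polynomials P_k converging to phi uniformly on [0, ||T||]. *)
Definition is_calculus (phi : R -> R) T B : Prop :=
  bounded_operator B /\
  exists P : nat -> {poly R},
    {uniform [set` `[0, fine (op_norm T)]], (fun k => horner (P k)) @ \oo --> phi}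
    /\ (op_norm (poly_op (P k) T - B) @[k --> \oo] --> 0%E).

Definition op_rpow (r : R) T : oper :=
  xget (fun=> 0) (is_calculus (fun t => t `^ r) T).

(* (tr (x) tau)(B), where tau picks the coefficient of lambda(1): the (i, i)
   entry of that coefficient is the i-th coordinate at 1 of the image of the
   basis vector delta_1 (x) e_i. *)
Definition op_trace B : C :=
  \sum_(i < n) B (fun w => if w == 1%g then delta_mx i ord0 else 0) 1%g i ord0.

(* Finite sums \sum_g a_g (x) lambda(g) are represented by the finitely
   supported function g |-> a_g. *)
Local Notation elt := (W -> 'M[C]_n).

Definition tens (A : 'M[C]_n) (s : W) : elt := fun g => if g == s then A else 0.

(* (a (x) lambda(g))^* = a^* (x) lambda(g^-1) *)
Definition star (x : elt) : elt := fun g => adjmx (x g^-1%g).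

Definition lreg (x : elt) : oper :=
  fun f h => \sum_(g \in [set: W]) x g *m f (g^-1 * h)%g.

Definition Lp_norm (p : R) (x : elt) : R :=
  complex.Re (op_trace (op_rpow (p / 2) (lreg (star x) \o lreg x))) `^ p^-1.

End GroupOperators.

(* Main.v *)
Require Import Defs.
From HB Require Import structures.
From mathcomp Require Import all_boot all_order all_algebra.
From mathcomp Require Import spectral complex.
From mathcomp Require Import finmap.
From mathcomp Require Import all_classical all_reals all_analysis.
From mathcomp Require Import zify ring lra.
Set Implicit Arguments.
Unset Strict Implicit.
Unset Printing Implicit Defensive.
Import Order.TTheory GRing.Theory Num.Theory numFieldNormedType.Exports.
Local Open Scope classical_set_scope.
Local Open Scope ring_scope.

(** Write N(y) for the trace of the [p]-th power of the absolute value of [y]. Both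
estimates concern the algebra of finitely supported functions from [W] to
matrices, with its trace.

Lower bound. The coefficient of x^* x at 1 is the sum of the a_s^* a_s. Against a
spectral projection E of this matrix, placed at 1, the functional calculus of
x^* x is integration with respect to a measure whose barycentre is the
eigenvalue, and Jensen's inequality for the power [p / 2] ([calc_jensen]) gives
the column part. The row part is the same statement for x x^*, which has the same
moments as x^* x because the trace is a trace.

Upper bound. Replacing [x] by its selfadjoint dilation ([dilation],
[trpow_dilation]) one may assume that all terms are selfadjoint. Let T be a set
of generators, u the part of the sum over T and v the rest. A standard parabolic
subgroup W_T contains no generator outside T ([coxeter_parabolic], proved with
the reflection cocycle of [W]), so polynomials in u are orthogonal to v and
conversely. Klein's inequality ([klein]), that is, convexity of N, then yields
N(u) <= N(u - v), N(v) <= N(u - v), and so N(u + v) <= 2^p N(u - v)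
([trpow_add_le_sub]). Averaging over T replaces the sum by its randomly signed
version, for which the noncommutative Khintchine inequality holds with a constant
of order sqrt p. The proof of the latter ([khintchine]) uses exchangeable pairs:
the effect of flipping one sign is controlled by a mean value inequality for
t |t|^(p-2). Together these give the factor 2 sqrt (2 (p - 1)).

Convexity and mean value inequalities under the trace concern two elements that
do not commute. They are deduced from scalar inequalities by evaluating products
of Bernstein polynomials ([calc_two_var]), since the trace of a product of two
positive elements is nonnegative ([trc_mul_pos]). Positivity of polynomials of
an element is in turn read off from exact Bernstein expansions
([bern_on_decomposition]). In this way only polynomials in the elements of the
group algebra are ever used, and functions of them appear through traces
([calc]). The operator powers that define the norms are connected to these traces
by [op_trace_rpow], and the Schatten norms to eigenvalues by [psd_spectral]. *)

(** * Bernstein polynomials *)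

Section Bernstein.
Variable R : realType.
Implicit Types (P : {poly R}) (N k j : nat).

Definition bern N k : {poly R} := 'X^k * (1 - 'X) ^+ (N - k) *+ 'C(N, k).

(** Multiply ['X^j] by [((1 - 'X) + 'X) ^+ (N - j)] and expand: the expansion has
no error term, and positivity certificates can be read off from it. *)
Lemma bern_monomial N j : (j <= N)%N ->
  'X^j = \sum_(k < N.+1) ('C(k, j)%:R / 'C(N, j)%:R) *: bern N k.
Proof.
move=> jN.
have C0 : 'C(N, j)%:R != 0 :> R by rewrite pnatr_eq0 -lt0n bin_gt0.
have H k : (k < N.+1)%N -> ('C(k, j)%:R / 'C(N, j)%:R) *: bern N k =
   if (j <= k)%N then 'X^j * (('X^(k - j) * (1 - 'X) ^+ (N - j - (k - j))) *+ 'C(N - j, k - j))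
   else 0.
  move=> kN; case: ifP => jk; last first.
    by rewrite bin_small ?mul0r ?scale0r// ltnNge jk.
  have Ex : 'X^k = 'X^j * 'X^(k - j) :> {poly R} by rewrite -exprD subnKC.
  have En : (N - j - (k - j) = N - k)%N by lia.
  rewrite /bern Ex En -mulrA -[LHS]scalerMnr scalerMnl mulrnAr -[RHS]scaler_nat.
  congr (_ *: _); rewrite -mulr_natr.
  apply: (mulfI C0); rewrite mulrA [_ * (_ / _)]mulrC divfK// -!natrM.
  congr (_%:R).
  have h1 : ('C(N, k) * 'C(k, j) = 'C(N, j) * 'C(N - j, k - j))%N.
    have E : (0 < j`! * (k - j)`! * (N - k)`!)%N by rewrite !muln_gt0 !fact_gt0.
    apply/eqP; rewrite -(eqn_pmul2r E); apply/eqP.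
    have A1 : ('C(k, j) * (j`! * (k - j)`!) = k`!)%N by apply: bin_fact.
    have A2 : ('C(N, k) * (k`! * (N - k)`!) = N`!)%N by apply: bin_fact; rewrite -ltnS.
    have A3 : ('C(N, j) * (j`! * (N - j)`!) = N`!)%N by apply: bin_fact.
    have A4 : ('C(N - j, k - j) * ((k - j)`! * (N - k)`!) = (N - j)`!)%N.
      have -> : (N - k = (N - j) - (k - j))%N by rewrite subnBA// subnK.
      by apply: bin_fact; apply: leq_sub2r; rewrite -ltnS.
    transitivity (N`!)%N.
      rewrite -A2 -A1; ring.
    rewrite -A3 -A4; ring.
  by rewrite mulnC h1.
transitivity ('X^j * ((1 - 'X) + 'X) ^+ (N - j) : {poly R}).
  by rewrite subrK expr1n mulr1.
rewrite exprDn_comm; last exact: mulrC.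
rewrite (eq_bigr (fun k : 'I_N.+1 => if (j <= k)%N then
  'X^j * (('X^(k - j) * (1 - 'X) ^+ (N - j - (k - j))) *+ 'C(N - j, k - j)) else 0 : {poly R})); last first.
  by move=> k _; exact: H.
rewrite -(big_mkord xpredT (fun k => if (j <= k)%N then
  'X^j * (('X^(k - j) * (1 - 'X) ^+ (N - j - (k - j))) *+ 'C(N - j, k - j)) else 0 : {poly R})).
rewrite (big_cat_nat (n := j))//=; last exact: leqW.
rewrite [X in _ = X + _]big_nat [X in _ = X + _]big1 ?add0r; last first.
  by move=> k /andP[_ kj]; rewrite leqNgt kj.
rewrite -[in RHS](add0n j) big_addn subSn// big_mkord big_distrr/=.
apply: eq_bigr => k _; rewrite leq_addl addnK.
by rewrite add0n [X in _ * (X *+ _)]mulrC.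
Qed.

(** The ratio is a product of [j] factors [(k - i) / (N - i)], and each of them
differs from [k / N] by at most [i / N] as long as it is nonnegative. *)
Lemma bern_coef_approx N j k : (j <= N)%N -> (k <= N)%N -> (0 < N)%N ->
  `|'C(k, j)%:R / 'C(N, j)%:R - (k%:R / N%:R) ^+ j| <= (j ^ 2)%:R / N%:R :> R.
Proof.
move=> + kN N0; have N0' : 0 < N%:R :> R by rewrite ltr0n.
have kN1 : 0 <= (k%:R / N%:R : R) <= 1.
  by rewrite divr_ge0//= ler_pdivrMr// mul1r ler_nat.
elim: j => [|j IH] jN.
  by rewrite !bin0 expr0 divr1 subrr normr0 divr_ge0.
have := IH (ltnW jN); set c := _ / 'C(N, j)%:R => {}IH.
have CN : 0 < 'C(N, j)%:R :> R by rewrite ltr0n bin_gt0 ltnW.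
have c01 : 0 <= c <= 1.
  rewrite divr_ge0//= ler_pdivrMr// mul1r ler_nat.
  by apply: leq_bin2l.
have Nj : 0 < (N - j)%:R :> R by rewrite ltr0n subn_gt0.
have E : 'C(k, j.+1)%:R / 'C(N, j.+1)%:R = c * ((k - j)%:R / (N - j)%:R) :> R.
  have E1 : 'C(k, j.+1)%:R = 'C(k, j)%:R * (k - j)%:R / j.+1%:R :> R.
    by rewrite -natrM mulnC -mul_bin_left natrM mulrC mulKf// pnatr_eq0.
  have E2 : 'C(N, j.+1)%:R = 'C(N, j)%:R * (N - j)%:R / j.+1%:R :> R.
    by rewrite -natrM mulnC -mul_bin_left natrM mulrC mulKf// pnatr_eq0.
  rewrite E1 E2 /c; field.
  by rewrite gt_eqF// gt_eqF//= pnatr_eq0.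
rewrite E exprSr.
have D : `|(k - j)%:R / (N - j)%:R - k%:R / N%:R| * c <= (2 * j + 1)%:R / N%:R :> R.
  have [kj|jk] := ltnP k j.
    by rewrite /c bin_small// mul0r mulr0 divr_ge0.
  apply: (@le_trans _ _ (j%:R / N%:R)); last first.
    by rewrite ler_pM2r ?invr_gt0// ler_nat; lia.
  apply: (@le_trans _ _ `|(k - j)%:R / (N - j)%:R - k%:R / N%:R|).
    by rewrite ler_piMr//; case/andP: c01.
  rewrite distrC ger0_norm.
    rewrite lerBlDr natrB// natrB; last exact: ltnW.
    rewrite natrB in Nj; last exact: ltnW.
    rewrite -subr_ge0.
    have -> : j%:R / N%:R + (k%:R - j%:R) / (N%:R - j%:R) - k%:R / N%:R =
       j%:R * (k%:R - j%:R) / (N%:R * (N%:R - j%:R)) :> R.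
      by field; rewrite !gt_eqF.
    rewrite divr_ge0// mulr_ge0 ?(ltW N0') ?(ltW Nj)//.
    by rewrite subr_ge0 ler_nat.
  rewrite subr_ge0 natrB// natrB; last exact: ltnW.
  rewrite natrB in Nj; last exact: ltnW.
  rewrite ler_pdivrMr// mulrAC ler_pdivlMr// !(mulrBr, mulrBl).
  have : k%:R * j%:R <= N%:R * j%:R :> R by rewrite ler_wpM2r// ler_nat.
  lra.
have -> : c * ((k - j)%:R / (N - j)%:R) - (k%:R / N%:R) ^+ j * (k%:R / N%:R) =
   ((k - j)%:R / (N - j)%:R - k%:R / N%:R) * c + (c - (k%:R / N%:R) ^+ j) * (k%:R / N%:R) by ring.
apply: (le_trans (ler_normD _ _)).
have -> : (j.+1 ^ 2)%:R / N%:R = (2 * j + 1)%:R / N%:R + (j ^ 2)%:R / N%:R :> R.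
  by rewrite -mulrDl -natrD; congr (_%:R / _); ring.
apply: lerD.
  rewrite normrM (@ger0_norm _ c)//; by case/andP: c01.
rewrite normrM; apply: le_trans IH; rewrite ler_piMr//.
by rewrite ger0_norm; case/andP: kN1.
Qed.

End Bernstein.

(** * Scalar functions on an interval *)

Section Approximation.
Variable R : realType.
Implicit Types (N k : nat) (g : R -> R).

Lemma bern_ge0 N k (u : R) : 0 <= u <= 1 -> 0 <= (bern R N k).[u].
Proof.
move=> /andP[u0 u1]; rewrite /bern hornerMn hornerM hornerXn horner_exp hornerD hornerN hornerX hornerC.
by rewrite mulrn_wge0// mulr_ge0// exprn_ge0// subr_ge0.
Qed.

(** The variance of the binomial distribution, from its factorial moments: these
are given by [bern_monomial] for the exponents 0, 1 and 2. *)
Lemma bern_variance N (u : R) : (1 < N)%N ->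
  \sum_(k < N.+1) (bern R N k).[u] * (k%:R / N%:R - u) ^+ 2 = u * (1 - u) / N%:R.
Proof.
move=> N1; have N0 : N%:R != 0 :> R by rewrite pnatr_eq0; lia.
have N10 : N%:R - 1 != 0 :> R.
  by rewrite -(natrB _ (ltnW N1)) pnatr_eq0; lia.
have moment j : (j <= N)%N ->
    \sum_(k < N.+1) 'C(k, j)%:R * (bern R N k).[u] = 'C(N, j)%:R * u ^+ j.
  move=> jN; have C0 : 'C(N, j)%:R != 0 :> R by rewrite pnatr_eq0 -lt0n bin_gt0.
  rewrite -hornerXn (bern_monomial R jN) horner_sum big_distrr/=.
  by apply: eq_bigr => k _; rewrite hornerZ mulrA [_ * (_ / _)]mulrC divfK.
have M0 := moment 0 isT; have M1 := moment 1 (ltnW N1); have M2 := moment 2 N1.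
rewrite -[LHS]addr0 -[0](subrr 0).
transitivity (2 / N%:R ^+ 2 * (\sum_(k < N.+1) 'C(k, 2)%:R * (bern R N k).[u])
   + (1 / N%:R ^+ 2 - 2 * u / N%:R) * (\sum_(k < N.+1) 'C(k, 1)%:R * (bern R N k).[u])
   + u ^+ 2 * (\sum_(k < N.+1) 'C(k, 0)%:R * (bern R N k).[u])).
  rewrite subrr addr0 !big_distrr/= -!big_split/=; apply: eq_bigr => k _.
  have K2 : k%:R ^+ 2 = 2 * 'C(k, 2)%:R + k%:R :> R.
    rewrite -natrX -natrM -natrD; congr (_%:R).
    by rewrite (mul_bin_left k 1) bin1; nia.
  rewrite bin1 bin0; move: (k%:R) ('C(k, 2)%:R) (bern R N k).[u] K2 => x y z K2.
  transitivity (z * (x ^+ 2 / N%:R ^+ 2 - 2 * u * x / N%:R + u ^+ 2)); first by field.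
  by rewrite K2; field.
rewrite M0 M1 M2 bin0 bin1.
have C2 : 2 * 'C(N, 2)%:R = N%:R * (N%:R - 1) :> R.
  rewrite -(natrB _ (ltnW N1)) -!natrM; congr (_%:R).
  by rewrite (mul_bin_left N 1) bin1; nia.
rewrite [2 / _ * _]mulrA [2 / _ * _]mulrAC C2; field.
exact: N0.
Qed.

(** Uniform continuity on the interval from [m] to [M], in the form that a variance
estimate consumes directly: the modulus is quadratic up to an arbitrary error. *)
Definition tame (m M : R) g := forall e, 0 < e ->
  exists2 C, 0 <= C & forall s t, m <= s <= M -> m <= t <= M ->
    `|g s - g t| <= e + C * (s - t) ^+ 2.

Lemma tame_bounded (m M : R) g : tame m M g ->
  exists2 K, 0 <= K & forall t, m <= t <= M -> `|g t| <= K.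
Proof.
move=> /(_ _ ltr01)[C C0 Cg].
exists (`|g m| + (1 + C * (M - m) ^+ 2)); first by rewrite !addr_ge0// mulr_ge0// sqr_ge0.
move=> t tmM; have mm : m <= m <= M.
  by rewrite lexx; case/andP: tmM; exact: le_trans.
have -> : g t = g m + (g t - g m) by ring.
apply: (le_trans (ler_normD _ _)); rewrite lerD2l.
apply: (le_trans (Cg _ _ tmM mm)); rewrite lerD2l ler_wpM2l//.
by case/andP: tmM => ? ?; rewrite lerXn2r ?nnegrE ?subr_ge0//; lra.
Qed.

Lemma tame_cst m M (c : R) : tame m M (fun=> c).
Proof.
by move=> e e0; exists 0 => // s t _ _; rewrite subrr normr0 mul0r addr0 ltW.
Qed.

Lemma tame_mul m M g h : tame m M g -> tame m M h -> tame m M (fun t => g t * h t).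
Proof.
move=> tg th; have [K K0 Kg] := tame_bounded tg; have [L L0 Lh] := tame_bounded th.
move=> e e0; have KL : 0 < K + L + 1 by lra.
have e'0 : 0 < e / (K + L + 1) by rewrite divr_gt0.
have [C C0 Cg] := tg _ e'0; have [D D0 Dh] := th _ e'0.
exists (L * C + K * D); first by rewrite addr_ge0// mulr_ge0.
move=> s t sI tI.
have -> : g s * h s - g t * h t = (g s - g t) * h s + g t * (h s - h t) by ring.
apply: (le_trans (ler_normD _ _)); rewrite !normrM.
apply: (@le_trans _ _ ((e / (K + L + 1) + C * (s - t) ^+ 2) * L +
    K * (e / (K + L + 1) + D * (s - t) ^+ 2))).
  by apply: lerD; apply: ler_pM; rewrite ?normr_ge0 ?Cg ?Lh ?Kg ?Dh.
have -> : (e / (K + L + 1) + C * (s - t) ^+ 2) * L + K * (e / (K + L + 1) + D * (s - t) ^+ 2)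
  = e / (K + L + 1) * (K + L) + (L * C + K * D) * (s - t) ^+ 2 by ring.
rewrite lerD2r mulrAC ler_pdivrMr// ler_pM2l//; lra.
Qed.

Lemma tame_exp m M g k : tame m M g -> tame m M (fun t => g t ^+ k).
Proof.
move=> tg; elim: k => [|k IH]; first exact: tame_cst.
by under eq_fun do rewrite exprS; exact: tame_mul.
Qed.

Lemma tame_id m M : tame m M id.
Proof.
move=> e e0; exists e^-1; first by rewrite invr_ge0 ltW.
move=> s t _ _ /=; have [h|h] := lerP `|s - t| e.
  by apply: le_trans h _; rewrite lerDl mulr_ge0 ?sqr_ge0// invr_ge0 ltW.
apply: (@le_trans _ _ (e^-1 * (s - t) ^+ 2)); last by rewrite lerDr ltW.
rewrite -(real_normK (num_real (s - t))) expr2 mulrA -[leLHS]mul1r ler_wpM2r//.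
by rewrite mulrC ler_pdivlMr// mul1r ltW.
Qed.

Lemma powRD_le (r a b : R) : 0 <= r <= 1 -> 0 <= a -> 0 <= b ->
  (a + b) `^ r <= a `^ r + b `^ r.
Proof.
move=> /andP[r0 r1] a0 b0.
have [ab0|] := eqVneq (a + b) 0.
  have [-> ->] : a = 0 /\ b = 0 by split; lra.
  by rewrite addr0 lerDl powR_ge0.
move=> ab; have {}ab : 0 < a + b by rewrite lt_neqAle eq_sym ab addr_ge0.
have part x : 0 <= x -> x <= a + b -> x / (a + b) * (a + b) `^ r <= x `^ r.
  move=> x0 xab; have [->|xn0] := eqVneq x 0; first by rewrite !mul0r powR_ge0.
  have -> : x `^ r = (x / (a + b)) `^ r * (a + b) `^ r.
    by rewrite -powRM ?divr_ge0 ?divfK ?gt_eqF// ltW.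
  rewrite ler_wpM2r ?powR_ge0// ger1_powR//.
  by rewrite divr_gt0// ?lt_neqAle ?(eq_sym 0) ?xn0//= ler_pdivrMr// mul1r.
have -> : (a + b) `^ r = a / (a + b) * (a + b) `^ r + b / (a + b) * (a + b) `^ r.
  by rewrite -mulrDl -mulrDl divff ?mul1r// gt_eqF.
by apply: lerD; apply: part => //; lra.
Qed.

(** For exponents at most 1 the power function is subadditive, hence Hoelder
continuous. *)
Lemma tame_powR_le1 m M (r : R) : 0 <= r <= 1 -> tame m M (fun t => `|t| `^ r).
Proof.
move=> r01; have [r0 r1] := andP r01.
have [->|rn0] := eqVneq r 0.
  by under eq_fun do rewrite powRr0; exact: tame_cst.
have {}rn0 : 0 < r by rewrite lt_neqAle eq_sym rn0.
have sub s t : `|s| `^ r - `|t| `^ r <= `|s - t| `^ r.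
  rewrite lerBlDl; apply: (@le_trans _ _ ((`|t| + `|s - t|) `^ r)).
    apply: ge0_ler_powR => //; rewrite ?nnegrE//; last by rewrite -lerBlDl lerB_dist.
    by rewrite addr_ge0.
  exact: powRD_le.
move=> e e0; set d := e `^ r^-1.
have d0 : 0 < d by rewrite powR_gt0.
have dr : d `^ r = e by rewrite -powRrM mulVf ?gt_eqF// powRr1// ltW.
exists (e / d ^+ 2); first by rewrite divr_ge0// ?sqr_ge0// ltW.
move=> s t _ _; apply: (@le_trans _ _ (`|s - t| `^ r)).
  by rewrite ler_norml sub lerNl opprB distrC sub.
have [h|h] := lerP `|s - t| d.
  apply: (@le_trans _ _ e); last first.
    by rewrite lerDl mulr_ge0 ?sqr_ge0// divr_ge0 ?sqr_ge0// ltW.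
  by rewrite -dr; apply: ge0_ler_powR => //; rewrite nnegrE// ltW.
apply: (@le_trans _ _ (e / d ^+ 2 * (s - t) ^+ 2)); last by rewrite lerDr ltW.
set u := `|s - t| in h *.
have ud : 1 <= u / d by rewrite ler_pdivlMr// mul1r ltW.
have -> : u `^ r = (u / d) `^ r * e.
  rewrite -[in RHS]dr -powRM ?(ltW d0)//; first by rewrite divfK ?gt_eqF.
  by rewrite (le_trans ler01 ud).
have -> : e / d ^+ 2 * (s - t) ^+ 2 = (u / d) ^+ 2 * e.
  by rewrite -(real_normK (num_real (s - t))) -/u expr_div_n; ring.
rewrite ler_pM2r//; apply: (@le_trans _ _ (u / d)); first exact: ler1_powR.
by rewrite expr2 ler_peMr// (le_trans ler01).
Qed.

(** A large exponent is split into [k] equal ones that are at most 1. *)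
Lemma tame_powR m M (r : R) : 0 <= r -> tame m M (fun t => `|t| `^ r).
Proof.
move=> r0; set k := (Num.truncn r).+1.
have k0 : 0 < k%:R :> R by rewrite ltr0n.
have -> : (fun t : R => `|t| `^ r) = (fun t : R => (`|t| `^ (r / k%:R)) ^+ k).
  apply/funext => t; rewrite -powR_mulrn ?powR_ge0// -powRrM divfK ?gt_eqF//.
apply: (@tame_exp m M (fun t : R => `|t| `^ (r / k%:R)) k).
apply: tame_powR_le1; rewrite divr_ge0//= ler_pdivrMr// mul1r ltW//.
exact: truncnS_gt.
Qed.

(** The convex function [s `^ r] lies above its tangent at [t]. Most scalar
inequalities about powers come down to this one. *)
Lemma young_powR (r s t : R) : 1 <= r -> 0 <= s -> 0 <= t ->
  r * t `^ (r - 1) * s <= s `^ r + (r - 1) * t `^ r.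
Proof.
move=> r1 s0 t0; have [->|rn1] := eqVneq r 1.
  by rewrite subrr powRr0 mul0r addr0 powRr1// !mul1r.
have {}r1 : 1 < r by rewrite lt_neqAle eq_sym rn1.
have r0 : 0 < r by lra.
have r10 : 0 < r - 1 by lra.
have q0 : 0 < r / (r - 1) by rewrite divr_gt0.
have pq : r^-1 + (r / (r - 1))^-1 = 1 by field; rewrite !gt_eqF.
have := conjugate_powR s0 (powR_ge0 t (r - 1)) r0 q0 pq.
rewrite -powRrM [(r - 1) * _]mulrC divfK ?gt_eqF// => h.
have -> : r * t `^ (r - 1) * s = r * (s * t `^ (r - 1)) by ring.
apply: (le_trans (ler_wpM2l (ltW r0) h)).
rewrite le_eqVlt; apply/orP; left; apply/eqP; field; by rewrite !gt_eqF.
Qed.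

End Approximation.

(** * Bernstein approximation on an interval *)

Section Interval.
Variables (R : realType) (m M : R).
Hypothesis mM : m < M.
Implicit Types (N k : nat) (g : R -> R) (P : {poly R}).

Definition bern_on N k : {poly R} := bern R N k \Po ((M - m)^-1 *: ('X - m%:P)).
Definition node N k : R := m + (M - m) * (k%:R / N%:R).
Definition bern_poly N g : {poly R} := \sum_(k < N.+1) g (node N k) *: bern_on N k.

Let l0 : 0 < M - m. Proof. by rewrite subr_gt0. Qed.

Lemma node_in N k : (k <= N)%N -> m <= node N k <= M.
Proof.
move=> kN; rewrite /node; have [->|N0] := posnP N.
  by rewrite invr0 !mulr0 addr0 lexx ltW.
have N0' : 0 < N%:R :> R by rewrite ltr0n.
have h : k%:R / N%:R <= 1 :> R by rewrite ler_pdivrMr// mul1r ler_nat.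
rewrite lerDl mulr_ge0 ?divr_ge0 ?(ltW l0)//=.
by rewrite -lerBrDl ger_pMr.
Qed.

Lemma sum_bern_on N : \sum_(k < N.+1) bern_on N k = 1.
Proof.
have := bern_monomial R (leq0n N); rewrite expr0 => /(congr1 (comp_poly ((M - m)^-1 *: ('X - m%:P)))).
rewrite -polyC1 comp_polyC raddf_sum polyC1 => ->; apply: eq_bigr => k _.
by rewrite !bin0 divr1 scale1r.
Qed.

Lemma horner_bern_on N k t : (bern_on N k).[t] = (bern R N k).[(t - m) / (M - m)].
Proof. by rewrite horner_comp !hornerE mulrC. Qed.

Lemma bern_on_ge0 N k t : m <= t <= M -> 0 <= (bern_on N k).[t].
Proof.
move=> /andP[tm tM]; rewrite horner_bern_on bern_ge0// divr_ge0 ?subr_ge0 ?(ltW mM)//=.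
by rewrite ler_pdivrMr// mul1r lerB.
Qed.

(** Chebyshev's argument: as [g] is [tame], the error is at most [e / 2] plus a
multiple of the variance [bern_variance]. *)
Lemma weierstrass g : tame m M g -> forall e, 0 < e ->
  exists N0, forall N, (N0 <= N)%N -> forall t, m <= t <= M ->
    `|(bern_poly N g).[t] - g t| <= e.
Proof.
move=> tg e e0; have e20 : 0 < e / 2 by lra.
have [C C0 Cg] := tg _ e20.
set K := C * (M - m) ^+ 2 / (e / 2).
have K0 : 0 <= K by rewrite divr_ge0 ?(ltW e20)// mulr_ge0// sqr_ge0.
exists (Num.truncn K).+2 => N NN0 t tI.
have N1 : (1 < N)%N by apply: leq_trans NN0.
have N0 : 0 < N%:R :> R by rewrite ltr0n; apply: leq_trans N1.
have KN : K <= N%:R.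
  apply: (@le_trans _ _ (Num.truncn K).+1%:R); first by rewrite ltW// truncnS_gt.
  by rewrite ler_nat; apply: leq_trans NN0.
set u := (t - m) / (M - m).
have u01 : 0 <= u <= 1.
  case/andP: tI => tm tM; rewrite divr_ge0 ?subr_ge0 ?(ltW mM)//=.
  by rewrite ler_pdivrMr// mul1r lerB.
have tu : t = m + (M - m) * u by rewrite /u mulrCA divff ?gt_eqF// mulr1 addrC subrK.
have S1 : \sum_(k < N.+1) (bern R N k).[u] = 1.
  have := sum_bern_on N => /(congr1 (horner^~ t)); rewrite horner_sum hornerC => {1}<-.
  by apply: eq_bigr => k _; rewrite horner_bern_on.
have -> : (bern_poly N g).[t] - g t =
    \sum_(k < N.+1) (g (node N k) - g t) * (bern R N k).[u].
  rewrite horner_sum -[X in _ - X]mulr1 -S1 big_distrr/= -sumrB; apply: eq_bigr => k _.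
  by rewrite hornerZ horner_bern_on -/u -mulrBl.
apply: (le_trans (ler_norm_sum _ _ _)).
apply: (@le_trans _ _ (\sum_(k < N.+1) (e / 2 * (bern R N k).[u] +
    C * (M - m) ^+ 2 * ((bern R N k).[u] * (k%:R / N%:R - u) ^+ 2)))).
  apply: ler_sum => k _; rewrite normrM [X in _ * X]ger0_norm ?bern_ge0//.
  have -> : e / 2 * (bern R N k).[u] +
    C * (M - m) ^+ 2 * ((bern R N k).[u] * (k%:R / N%:R - u) ^+ 2) =
    (e / 2 + C * (node N k - t) ^+ 2) * (bern R N k).[u].
    by rewrite tu /node; ring.
  rewrite ler_wpM2r ?bern_ge0// Cg// node_in//.
  by rewrite -ltnS.
rewrite big_split/= -!big_distrr/= S1 bern_variance// mulr1.
have -> : e = e / 2 + e / 2 by field.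
rewrite lerD//; first by lra.
have uu : u * (1 - u) <= 1 by case/andP: u01 => ? ?; nra.
apply: (@le_trans _ _ (C * (M - m) ^+ 2 * (1 / N%:R))).
  by apply: ler_wpM2l; [rewrite mulr_ge0 ?sqr_ge0|rewrite ler_wpM2r// invr_ge0 ltW].
rewrite mul1r ler_pdivrMr//.
have -> : C * (M - m) ^+ 2 = (e / 2) * K by rewrite /K [RHS]mulrC divfK ?gt_eqF.
by rewrite ler_wpM2l ?(ltW e20).
Qed.

(** By [bern_monomial] and [bern_coef_approx] the Bernstein coefficients of [P] are
close to the values of [P] at the nodes, so that adding [e] makes them
nonnegative. This certificate carries positivity over to noncommutative algebras,
where nonnegative polynomials are not available as squares. *)
Lemma bern_on_decomposition P : (forall t, m <= t <= M -> 0 <= P.[t]) ->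
  forall e, 0 < e -> exists N (c : nat -> R), (forall k, (k <= N)%N -> 0 <= c k) /\
    P + e%:P = \sum_(k < N.+1) c k *: bern_on N k.
Proof.
move=> P0 e e0.
pose A : {poly R} := (M - m)^-1 *: ('X - m%:P).
pose B : {poly R} := (M - m) *: 'X + m%:P.
have BA : B \Po A = 'X.
  rewrite /B comp_polyD comp_polyZ comp_polyX comp_polyC /A scalerA divff ?gt_eqF//.
  by rewrite scale1r subrK.
pose Q := P \Po B.
have QA : Q \Po A = P by rewrite /Q -comp_polyA BA comp_polyXr.
pose K := \sum_(j < size Q) `|Q`_j| * (j ^ 2)%:R.
have K0 : 0 <= K by apply: sumr_ge0 => j _; rewrite mulr_ge0.
pose N := (size Q + (Num.truncn (K / e)).+1)%N.
have N0 : (0 < N)%N by rewrite /N addnS.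
have N0' : 0 < N%:R :> R by rewrite ltr0n.
have KN : K / N%:R <= e.
  rewrite ler_pdivrMr// mulrC -ler_pdivrMr//.
  apply: (@le_trans _ _ (Num.truncn (K / e)).+1%:R); first by rewrite ltW// truncnS_gt.
  by rewrite ler_nat leq_addl.
have jN (j : 'I_(size Q)) : (j <= N)%N by rewrite /N; have := ltn_ord j; lia.
pose c k := \sum_(j < size Q) Q`_j * ('C(k, j)%:R / 'C(N, j)%:R) + e.
exists N, c; split.
  move=> k kN.
  have Qk : 0 <= Q.[k%:R / N%:R].
    rewrite /Q horner_comp /B hornerD hornerZ hornerX hornerC [_ + m]addrC.
    exact: P0 (node_in kN).
  have : `|\sum_(j < size Q) Q`_j * ('C(k, j)%:R / 'C(N, j)%:R) - Q.[k%:R / N%:R]| <= K / N%:R.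
    rewrite horner_coef -sumrB; apply: (le_trans (ler_norm_sum _ _ _)).
    rewrite /K mulr_suml; apply: ler_sum => j _.
    rewrite -mulrBr normrM -mulrA ler_wpM2l//.
    exact: bern_coef_approx.
  rewrite ler_norml => /andP[h _]; rewrite /c; lra.
rewrite -[in LHS]QA -(comp_polyC e A) -comp_polyD.
transitivity ((\sum_(k < N.+1) c k *: bern R N k) \Po A); last first.
  by rewrite raddf_sum; apply: eq_bigr => k _; rewrite /= comp_polyZ.
congr (_ \Po _); rewrite /c.
under eq_bigr do rewrite scalerDl.
rewrite big_split/= -scaler_sumr.
have -> : \sum_(k < N.+1) bern R N k = 1.
  have := bern_monomial R (leq0n N); rewrite expr0 => ->.
  by apply: eq_bigr => k _; rewrite !bin0 divr1 scale1r.
rewrite alg_polyC; congr (_ + _).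
under eq_bigr do rewrite scaler_suml.
rewrite exchange_big/= -[LHS]coefK poly_def; apply: eq_bigr => j _.
rewrite (bern_monomial R (jN j)) scaler_sumr; apply: eq_bigr => k _.
by rewrite scalerA.
Qed.

End Interval.

(** * Algebras with a positive trace *)

(** An algebraic stand-in for a von Neumann algebra with a finite trace. The scalars
are real because functional calculus is applied to selfadjoint elements only. *)
Record tracial (R : realType) (A : algType R) := Tracial {
  adj : {linear A -> A};
  trc : {scalar A};
  adjM : forall x y, adj (x * y) = adj y * adj x;
  adjK : involutive adj;
  trcC : forall x y, trc (x * y) = trc (y * x);
  trc_adj : forall x, trc (adj x) = trc x;
  trc_ge0 : forall x, 0 <= trc (adj x * x) }.

Section Tracial.
Variables (R : realType) (A : algType R) (D : tracial A).
Local Notation st := (adj D).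
Local Notation phi := (trc D).
Implicit Types (a b x y z : A) (P Q : {poly R}).

Definition selfadj x := st x = x.

(** Left multiplication by [x] is positive for the inner product
[phi (st y * z)]; this tests positivity without a Hilbert space. *)
Definition pos x := forall y, 0 <= phi (st y * x * y).

Lemma adj1 : st 1 = 1.
Proof. by rewrite -[RHS](adjK D) -[in RHS](mul1r (st 1)) adjM adjK mul1r. Qed.

Lemma pos1 : pos 1.
Proof. by move=> y; rewrite mulr1 trc_ge0. Qed.

Lemma posD x y : pos x -> pos y -> pos (x + y).
Proof. by move=> px py w; rewrite mulrDr mulrDl raddfD addr_ge0 ?px ?py. Qed.

Lemma posZ c x : 0 <= c -> pos x -> pos (c *: x).
Proof. by move=> c0 px w; rewrite -scalerAr -scalerAl linearZ/= mulr_ge0. Qed.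

Lemma pos_sum I (r : seq I) (F : I -> A) : (forall i, pos (F i)) -> pos (\sum_(i <- r) F i).
Proof.
move=> pF; elim/big_rec: _ => [|i x _ px]; last exact: posD.
by rewrite -(scale0r 1); apply: posZ pos1.
Qed.

Lemma pos_conj x w : pos x -> pos (st w * x * w).
Proof. by move=> px y; have := px (w * y); rewrite adjM !mulrA. Qed.

Lemma pos_lim x : (forall e, 0 < e -> pos (x + e%:A)) -> pos x.
Proof.
move=> h y; apply/ler_addgt0Pr => e e0.
have c0 : 0 < 1 + phi (st y * y) by rewrite ltr_pwDl// trc_ge0.
have := h (e / (1 + phi (st y * y))) (divr_gt0 e0 c0) y.
rewrite mulrDr mulrDl raddfD/= -scalerAr mulr1 -scalerAl linearZ/= => h1.
apply: (le_trans h1); rewrite lerD2l mulrAC ler_pdivrMr// ler_pM2l//.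
by rewrite lerDr.
Qed.

Definition ev a := horner_alg a : {poly R} -> A.

Lemma evC a c : ev a c%:P = c%:A. Proof. by rewrite /ev horner_algC. Qed.
Lemma evX a : ev a 'X = a. Proof. by rewrite /ev horner_algX. Qed.
Lemma evM a P Q : ev a (P * Q) = ev a P * ev a Q. Proof. exact: rmorphM. Qed.
Lemma evD a P Q : ev a (P + Q) = ev a P + ev a Q. Proof. exact: rmorphD. Qed.
Lemma evB a P Q : ev a (P - Q) = ev a P - ev a Q. Proof. exact: rmorphB. Qed.
Lemma evZ a c P : ev a (c *: P) = c *: ev a P.
Proof. by rewrite -mul_polyC evM evC mulr_algl. Qed.
Lemma ev_sum a I (r : seq I) (F : I -> {poly R}) :
  ev a (\sum_(i <- r) F i) = \sum_(i <- r) ev a (F i).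
Proof. exact: raddf_sum. Qed.

Lemma ev_comp a P Q : ev a (P \Po Q) = ev (ev a Q) P.
Proof.
elim/poly_ind: P => [|P c IH]; first by rewrite comp_poly0 /ev !raddf0.
by rewrite comp_polyD comp_polyM comp_polyX comp_polyC !evD !evM IH !evC evX.
Qed.

Lemma ev_comm a P : ev a P * a = a * ev a P.
Proof. by rewrite -{2 3}[a]evX -!evM mulrC. Qed.

Lemma selfadj_ev a P : selfadj a -> selfadj (ev a P).
Proof.
move=> sa; elim/poly_ind: P => [|P c IH]; first by rewrite /selfadj /ev raddf0 linear0.
rewrite /selfadj evD evM evX evC linearD/= adjM IH sa linearZ/= adj1.
by rewrite ev_comm.
Qed.

(** Even powers are absorbed by conjugation. Of the four parities that remain, only
['X * (1 - 'X)] is not positive by hypothesis, and it equals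
['X ^+ 2 * (1 - 'X) + (1 - 'X) ^+ 2 * 'X]. *)
Lemma pos_ev_bern a k l : selfadj a -> pos a -> pos (1 - a) ->
  pos (ev a ('X^k * (1 - 'X) ^+ l)).
Proof.
move=> sa pa p1a.
have stepX P : pos (ev a P) -> pos (ev a ('X^2 * P)).
  have -> : 'X^2 * P = 'X * P * 'X by rewrite expr2 mulrAC.
  by move=> h; rewrite !evM -{1}(selfadj_ev 'X sa); exact: pos_conj.
have step1X P : pos (ev a P) -> pos (ev a ((1 - 'X) ^+ 2 * P)).
  have -> : (1 - 'X) ^+ 2 * P = (1 - 'X) * P * (1 - 'X) by rewrite expr2 mulrAC.
  by move=> h; rewrite !evM -{1}(selfadj_ev (1 - 'X) sa); exact: pos_conj.
have p1 : pos (ev a 1) by rewrite -polyC1 evC scale1r; exact: pos1.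
have pX : pos (ev a 'X) by rewrite evX.
have p1X : pos (ev a (1 - 'X)) by rewrite evB evX -polyC1 evC scale1r.
have pX1X : pos (ev a ('X * (1 - 'X))).
  have -> : 'X * (1 - 'X) = 'X^2 * (1 - 'X) + (1 - 'X) ^+ 2 * 'X :> {poly R} by ring.
  by rewrite evD; apply: posD; [exact: stepX | exact: step1X].
have red P n (Y : {poly R}) : (forall Q, pos (ev a Q) -> pos (ev a (Y ^+ 2 * Q))) ->
    pos (ev a P) -> pos (ev a (Y * P)) -> pos (ev a (Y ^+ n * P)).
  move=> sY pP pYP; rewrite -(odd_double_half n); elim: (n./2) => [|h IH].
    by rewrite addn0; case: (odd n) => /=; rewrite ?expr0 ?mul1r ?expr1.
  by rewrite doubleS !addnS -addn2 addnC exprD -mulrA; exact: sY.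
apply: (red _ k) => //.
  by rewrite -[_ ^+ l]mulr1; apply: (red _ l) => //; rewrite mulr1.
by rewrite mulrC; apply: (red _ l) => //; rewrite mulrC.
Qed.

Section Interval.
Variables (m M : R).
Hypothesis mM : m < M.

Definition between a := [/\ selfadj a, pos (a - m%:A) & pos (M%:A - a)].

(** Positivity on the spectrum implies positivity in the algebra, by
[bern_on_decomposition]. *)
Lemma pos_ev a P : between a -> (forall t, m <= t <= M -> 0 <= P.[t]) -> pos (ev a P).
Proof.
move=> [sa am aM] P0; apply: pos_lim => e e0.
have [N [c [c0 E]]] := bern_on_decomposition mM P0 e0.
rewrite -(evC a) -evD E ev_sum.
have l0 : 0 < M - m by rewrite subr_gt0.
apply: pos_sum => -[k kN]/=; rewrite evZ; apply: posZ; first exact: c0.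
rewrite ev_comp /bern evZ evB evX evC.
rewrite /ev raddfMn -scaler_nat -/(ev _ _); apply: posZ; first by [].
apply: pos_ev_bern.
- by rewrite /selfadj linearZ linearB/= linearZ/= adj1 sa.
- by apply: posZ; rewrite ?invr_ge0 ?(ltW l0).
- have -> : 1 - (M - m)^-1 *: (a - m%:A) = (M - m)^-1 *: (M%:A - a).
    apply: (scalerI (lt0r_neq0 l0)); rewrite scalerBr !scalerA divff ?gt_eqF//.
    by rewrite !scale1r scalerBl opprB addrA subrK.
  by apply: posZ; rewrite ?invr_ge0 ?(ltW l0).
Qed.

(** The arithmetic mean replaces the geometric mean of the Cauchy-Schwarz
inequality, so that no square root enters the error estimates. *)
Definition sqmean z := (phi 1 + phi (st z * z)) / 2.

Lemma phi1_ge0 : 0 <= phi 1.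
Proof. by have := trc_ge0 D 1; rewrite adj1 mulr1. Qed.

Lemma sqmean_ge0 z : 0 <= sqmean z.
Proof. by rewrite divr_ge0// addr_ge0 ?phi1_ge0 ?trc_ge0. Qed.

Lemma ev_sq_bound a P e : between a -> (forall t, m <= t <= M -> `|P.[t]| <= e) ->
  phi (ev a P * ev a P) <= e ^+ 2 * phi 1.
Proof.
move=> ba Pe; have sa : selfadj a by case: ba.
have := @pos_ev a ((e ^+ 2)%:P - P * P) ba _ 1.
rewrite evB evM evC adj1 mulr1 mul1r linearB/= linearZ/= subr_ge0; apply => t tI.
rewrite hornerD hornerN hornerM hornerC subr_ge0 -expr2 -(real_normK (num_real P.[t])).
by rewrite lerXn2r ?nnegrE// ?Pe// (le_trans _ (Pe _ tI)).
Qed.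

(** The Cauchy-Schwarz inequality for [ev a P] and [z]. It makes [phi (ev a P * z)]
continuous in [P] for the sup norm on the interval, which is what allows to
replace [P] by a continuous function. *)
Lemma ev_bound a P z e : between a -> 0 < e ->
  (forall t, m <= t <= M -> `|P.[t]| <= e) -> `|phi (ev a P * z)| <= e * sqmean z.
Proof.
move=> ba e0 Pe; have sa : selfadj a by case: ba.
have sq := ev_sq_bound ba Pe; have := selfadj_ev P sa; move: (ev a P) sq => h sq sh.
have sz : phi (st z * h) = phi (h * z) by rewrite -(trc_adj D (h * z)) adjM sh.
have key c : c ^+ 2 = e ^+ 2 -> 2 * c * phi (h * z) <= e * (2 * e * sqmean z).
  move=> ce; have := trc_ge0 D (h - c *: z).
  have -> : phi (st (h - c *: z) * (h - c *: z)) =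
      phi (h * h) - 2 * c * phi (h * z) + c ^+ 2 * phi (st z * z).
    rewrite linearB linearZ/= mulrBl !mulrBr !linearB/= sh -!scalerAl -!scalerAr.
    by rewrite !linearZ/= sz /GRing.scale/=; ring.
  rewrite ce /sqmean => h0.
  have -> : e * (2 * e * ((phi 1 + phi (st z * z)) / 2)) = e ^+ 2 * phi 1 + e ^+ 2 * phi (st z * z).
    by field.
  lra.
have k1 := key e erefl; have k2 := key (- e) (sqrrN e).
rewrite ler_norml; apply/andP; split.
  by rewrite -(ler_pM2l e0) -(ler_pM2l (ltr0n R 2)); lra.
by rewrite -(ler_pM2l e0) -(ler_pM2l (ltr0n R 2)); lra.
Qed.

End Interval.
End Tracial.

(** * Scalar functional calculus under the trace *)

Section RealSequences.
Variable R : realType.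

Lemma cauchy_has_limit (u : nat -> R) :
  (forall e, 0 < e -> exists N, forall i j, (N <= i)%N -> (N <= j)%N -> `|u i - u j| <= e) ->
  exists l, forall e, 0 < e -> exists N, forall i, (N <= i)%N -> `|u i - l| <= e.
Proof.
move=> h.
have /cvg_ex[l ul] : cvgn u.
  apply: cauchy_cvg; apply: cauchy_exP => e e0; have e20 : 0 < e / 2 by lra.
  have [N HN] := h _ e20; exists (u N); exists N => // i /= Ni.
  by rewrite /ball/=; apply: le_lt_trans (HN N i (leqnn N) Ni) _; lra.
exists l => e e0.
move/cvgrPdist_le : ul => /(_ _ e0)[N _ HN].
by exists N => i Ni; rewrite distrC; exact: HN.
Qed.

Lemma le_of_forall_eps (K x y : R) : 0 <= K ->
  (forall e, 0 < e -> x <= y + e * K) -> x <= y.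
Proof.
move=> K0 h; apply/ler_addgt0Pr => e e0; have K10 : 0 < K + 1 by lra.
apply: (le_trans (h _ (divr_gt0 e0 K10))); rewrite lerD2l mulrAC ler_pdivrMr//.
by rewrite ler_pM2l//; lra.
Qed.

Lemma eq_of_forall_eps (K x y : R) : 0 <= K ->
  (forall e, 0 < e -> `|x - y| <= e * K) -> x = y.
Proof.
move=> K0 h; apply/eqP; rewrite eq_le; apply/andP; split.
  by apply: (le_of_forall_eps K0) => e /h; rewrite ler_norml => /andP[_]; lra.
by apply: (le_of_forall_eps K0) => e /h; rewrite ler_norml => /andP[+ _]; lra.
Qed.

Lemma tame_ext m M (f g : R -> R) : (forall t, m <= t <= M -> f t = g t) ->
  tame m M f -> tame m M g.
Proof.
move=> fg tf e e0; have [C C0 Cf] := tf _ e0.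
by exists C => // s t sI tI; rewrite -!fg//; exact: Cf.
Qed.

Lemma tame_add m M (f g : R -> R) : tame m M f -> tame m M g -> tame m M (fun t => f t + g t).
Proof.
move=> tf tg e e0; have e20 : 0 < e / 2 by lra.
have [C C0 Cf] := tf _ e20; have [C' C'0 Cg] := tg _ e20.
exists (C + C') => [|s t sI tI]; first exact: addr_ge0.
have -> : f s + g s - (f t + g t) = (f s - f t) + (g s - g t) by ring.
apply: (le_trans (ler_normD _ _)).
have -> : e + (C + C') * (s - t) ^+ 2 =
  (e / 2 + C * (s - t) ^+ 2) + (e / 2 + C' * (s - t) ^+ 2) by field.
by apply: lerD; [exact: Cf | exact: Cg].
Qed.

Lemma tame_poly m M (P : {poly R}) : tame m M (horner P).
Proof.
elim/poly_ind: P => [|P c IH].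
  by apply: (@tame_ext _ _ (fun=> 0)) (tame_cst _ _ 0) => t _; rewrite horner0.
apply: (@tame_ext _ _ (fun t => P.[t] * t + c)).
  by move=> t _; rewrite !hornerE.
by apply: tame_add (tame_cst _ _ c); apply: tame_mul => //; exact: tame_id.
Qed.

Lemma tame_comp m M K (g P : R -> R) : tame (- K) K g ->
  (forall t, m <= t <= M -> `|P t| <= K) -> tame m M P -> tame m M (fun t => g (P t)).
Proof.
move=> tg PK tP e e0; have e20 : 0 < e / 2 by lra.
have [C C0 Cg] := tg _ e20.
pose d := e / 2 / (C * (2 * `|K|) + 1).
have CK : 0 <= C * (2 * `|K|) by rewrite !mulr_ge0.
have d0 : 0 < d by rewrite divr_gt0//; lra.
have [E E0 EP] := tP _ d0.
exists (C * (2 * `|K|) * E) => [|s t sI tI]; first by rewrite mulr_ge0.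
have Ps := PK _ sI; have Pt := PK _ tI.
have sK : - K <= P s <= K by rewrite -ler_norml.
have tK : - K <= P t <= K by rewrite -ler_norml.
apply: (le_trans (Cg _ _ sK tK)).
have K0 : 0 <= K by apply: le_trans Ps.
have h : (P s - P t) ^+ 2 <= 2 * `|K| * (d + E * (s - t) ^+ 2).
  rewrite -(real_normK (num_real (P s - P t))) expr2; apply: ler_pM => //; last exact: EP.
  by rewrite (ger0_norm K0) ler_norml; lra.
have : C * (P s - P t) ^+ 2 <= C * (2 * `|K| * (d + E * (s - t) ^+ 2)) by rewrite ler_wpM2l.
have -> : C * (2 * `|K| * (d + E * (s - t) ^+ 2)) =
   C * (2 * `|K|) * d + C * (2 * `|K|) * E * (s - t) ^+ 2 by ring.
have hd : d * (C * (2 * `|K|) + 1) = e / 2 by rewrite divfK// gt_eqF//; lra.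
have -> : C * (2 * `|K|) * d = d * (C * (2 * `|K|) + 1) - d by ring.
rewrite hd; clearbody d; lra.
Qed.

End RealSequences.

Section Calculus.
Variables (R : realType) (A : algType R) (D : tracial A) (m M : R).
Hypothesis mM : m < M.
Local Notation st := (adj D).
Local Notation phi := (trc D).
Local Notation between := (between D m M).
Local Notation sqmean := (sqmean D).
Implicit Types (a b x y z : A) (P Q : {poly R}) (g h : R -> R).

Definition near_on e P g := forall t, m <= t <= M -> `|P.[t] - g t| <= e.

Definition calc_spec a g z l := forall P e, 0 < e -> near_on e P g ->
  `|phi (ev a P * z) - l| <= e * sqmean z.

(** The number [phi (g(a) * z)], where [g(a)] would live in a completion of [A].
Polynomials near [g] determine it, and the completion is never constructed. *)
Definition calc a g z := xget 0 [set l | calc_spec a g z l]%classic.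

Lemma approximable g e : tame m M g -> 0 < e -> exists P, near_on e P g.
Proof.
by move=> tg e0; have [N h] := weierstrass mM tg e0; exists (bern_poly m M N g) => t; exact: h.
Qed.

Lemma calcP a g z : between a -> tame m M g -> calc_spec a g z (calc a g z).
Proof.
move=> ba tg.
suff [l hl] : exists l, calc_spec a g z l by exact: (@xgetPex _ 0 [set l | calc_spec a g z l]%classic (ex_intro _ l hl)).
have diff P Q e : 0 < e -> (forall t, m <= t <= M -> `|P.[t] - Q.[t]| <= e) ->
    `|phi (ev a P * z) - phi (ev a Q * z)| <= e * sqmean z.
  move=> e0 h; rewrite -linearB/= -mulrBl -evB. apply: (ev_bound mM _ ba) => // t tI.
  by rewrite hornerD hornerN h.
have s0 := sqmean_ge0 D z.
pose u N := phi (ev a (bern_poly m M N g) * z).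
have [|l hl] := @cauchy_has_limit _ u.
  move=> e e0; have e'0 : 0 < e / (2 * sqmean z + 1) by rewrite divr_gt0//; lra.
  have [N HN] := weierstrass mM tg e'0.
  exists N => i j Ni Nj; set d := e / _ in e'0 HN.
  apply: (@le_trans _ _ ((d + d) * sqmean z)).
    apply: diff; first by lra.
    move=> t tI; have := HN i Ni t tI; have := HN j Nj t tI.
    by rewrite !ler_norml => /andP[? ?] /andP[? ?]; apply/andP; split; lra.
  have -> : (d + d) * sqmean z = d * (2 * sqmean z) by ring.
  rewrite /d mulrAC ler_pdivrMr ?ler_wpM2l ?(ltW e0)//; lra.
exists l => P e e0 Pe.
apply: (@le_of_forall_eps _ (sqmean z + 1)); first by lra.
move=> d d0; have [N1 HN1] := hl _ d0; have [N2 HN2] := weierstrass mM tg d0.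
pose N := maxn N1 N2.
have h1 := HN1 N (leq_maxl _ _).
have h2 : `|phi (ev a P * z) - u N| <= (e + d) * sqmean z.
  apply: diff; first by lra.
  move=> t tI; have := HN2 N (leq_maxr _ _) t tI; have := Pe _ tI.
  by rewrite !ler_norml => /andP[? ?] /andP[? ?]; apply/andP; split; lra.
have -> : phi (ev a P * z) - l = (phi (ev a P * z) - u N) + (u N - l) by ring.
apply: (le_trans (ler_normD _ _)).
have -> : e * sqmean z + d * (sqmean z + 1) = (e + d) * sqmean z + d by ring.
exact: lerD.
Qed.

Lemma calc_eq a g z l K : between a -> tame m M g -> 0 <= K ->
  (forall e, 0 < e -> exists2 P, near_on e P g & `|phi (ev a P * z) - l| <= e * K) ->
  calc a g z = l.
Proof.
move=> ba tg K0 h; have s0 := sqmean_ge0 D z.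
apply: (@eq_of_forall_eps _ (sqmean z + K)); first exact: addr_ge0.
move=> e e0; have [P Pg hP] := h _ e0; have := calcP (z) ba tg e0 Pg.
move: hP; rewrite mulrDr !ler_norml => /andP[? ?] /andP[? ?]; apply/andP; split; lra.
Qed.

Lemma calc_poly a P z : between a -> calc a (horner P) z = phi (ev a P * z).
Proof.
move=> ba; apply: (@calc_eq _ _ _ _ 0) => //; first exact: tame_poly.
move=> e e0; exists P; last by rewrite subrr normr0 mulr0.
by move=> t _; rewrite subrr normr0 ltW.
Qed.

Lemma calc_ext a g h z : (forall t, m <= t <= M -> g t = h t) -> calc a g z = calc a h z.
Proof.
move=> gh; rewrite /calc; congr (xget 0 _); apply/seteqP.
by split => l /= hl P e e0 Pe; apply: hl => // t tI; [rewrite gh|rewrite -gh] => //; exact: Pe.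
Qed.

Lemma calcD a g h z : between a -> tame m M g -> tame m M h ->
  calc a (fun t => g t + h t) z = calc a g z + calc a h z.
Proof.
move=> ba tg th; apply: (@calc_eq _ _ _ _ (sqmean z)) => //.
- exact: tame_add.
- exact: sqmean_ge0.
move=> e e0; have e20 : 0 < e / 2 by lra.
have [P Pg] := approximable tg e20; have [Q Qh] := approximable th e20.
exists (P + Q).
  move=> t tI; have := Pg _ tI; have := Qh _ tI; rewrite hornerD !ler_norml.
  by move=> /andP[? ?] /andP[? ?]; apply/andP; split; lra.
have := calcP (z) ba tg e20 Pg; have := calcP (z) ba th e20 Qh.
rewrite evD mulrDl linearD/= !ler_norml.
by move=> /andP[? ?] /andP[? ?]; apply/andP; split; lra.
Qed.

Lemma calcZ a c g z : between a -> tame m M g ->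
  calc a (fun t => c * g t) z = c * calc a g z.
Proof.
move=> ba tg; have c0 : 0 < `|c| + 1 by rewrite ltr_pwDr.
apply: (@calc_eq _ _ _ _ (sqmean z)) => //.
- by apply: tame_mul => //; exact: tame_cst.
- exact: sqmean_ge0.
move=> e e0; have e'0 : 0 < e / (`|c| + 1) by rewrite divr_gt0.
have ce (x K : R) : `|x| <= e / (`|c| + 1) * K -> 0 <= K -> `|c * x| <= e * K.
  move=> hx K0; rewrite normrM; apply: (@le_trans _ _ ((`|c| + 1) * (e / (`|c| + 1) * K))).
    by apply: ler_pM => //; rewrite lerDl.
  by rewrite mulrA mulrCA divff ?mulr1// gt_eqF.
have [P Pg] := approximable tg e'0; exists (c *: P).
  move=> t tI; rewrite hornerZ -mulrBr -[e]mulr1; apply: ce => //; rewrite mulr1; exact: Pg.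
rewrite evZ -scalerAl linearZ/= -mulrBr; apply: ce; last exact: sqmean_ge0.
exact: calcP.
Qed.

Lemma calcDr a g y z : between a -> tame m M g ->
  calc a g (y + z) = calc a g y + calc a g z.
Proof.
move=> ba tg; apply: (@calc_eq _ _ _ _ (sqmean y + sqmean z)) => //.
  by rewrite addr_ge0// sqmean_ge0.
move=> e e0; have [P Pg] := approximable tg e0; exists P => //.
have := calcP (z) ba tg e0 Pg; have := calcP (y) ba tg e0 Pg.
rewrite !mulrDr linearD/= !ler_norml.
by move=> /andP[? ?] /andP[? ?]; apply/andP; split; lra.
Qed.

Lemma calcZr a g c z : between a -> tame m M g -> calc a g (c *: z) = c * calc a g z.
Proof.
move=> ba tg; apply: (@calc_eq _ _ _ _ (`|c| * sqmean z)) => //.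
  by rewrite mulr_ge0// sqmean_ge0.
move=> e e0; have [P Pg] := approximable tg e0; exists P => //.
rewrite -scalerAr linearZ/= -mulrBr normrM mulrCA ler_wpM2l//.
exact: calcP.
Qed.

Lemma calc_mul_id a g z : between a -> tame m M g ->
  calc a (fun t => t * g t) z = calc a g (a * z).
Proof.
move=> ba tg; pose K := `|m| + `|M| + 1.
have K0 : 0 < K by rewrite ltr_wpDl// addr_ge0.
apply: (@calc_eq _ _ _ _ (sqmean (a * z))) => //.
- by apply: tame_mul => //; exact: tame_id.
- exact: sqmean_ge0.
move=> e e0; pose d := Num.min e (e / K).
have d0 : 0 < d by rewrite lt_min e0 divr_gt0.
have [P Pg] := approximable tg d0; exists ('X * P).
  move=> t tI; rewrite hornerM hornerX -mulrBr normrM.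
  have tK : `|t| <= K.
    rewrite /K ler_norml; have := ler_norm M; have := ler_norm (- m).
    have := normr_ge0 m; have := normr_ge0 M.
    by rewrite normrN; case/andP: tI => ? ? ? ? ? ?; apply/andP; split; lra.
  apply: (@le_trans _ _ (K * (e / K))); last by rewrite mulrCA divff ?mulr1// gt_eqF.
  apply: ler_pM => //; apply: (le_trans (Pg _ tI)).
  by rewrite /d ge_min lexx orbT.
rewrite evM evX -ev_comm -mulrA.
apply: (le_trans (calcP _ ba tg d0 Pg)); rewrite ler_wpM2r ?sqmean_ge0//.
by rewrite /d ge_min lexx.
Qed.

(** By cyclicity this is [phi (st x * g(a) * x)], and [g(a)] is positive. *)
Lemma calc_ge0 a g x : between a -> tame m M g -> (forall t, m <= t <= M -> 0 <= g t) ->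
  0 <= calc a g (x * st x).
Proof.
move=> ba tg g0; pose K := phi (st x * x) + sqmean (x * st x).
apply: (@le_of_forall_eps _ K); first by rewrite addr_ge0 ?sqmean_ge0// trc_ge0.
move=> e e0; have [P Pg] := approximable tg e0.
have /(_ x) : pos D (ev a (P + e%:P)).
  apply: (pos_ev mM ba) => t tI; have := Pg _ tI; have := g0 _ tI.
  by rewrite hornerD hornerC ler_norml => ? /andP[? ?]; lra.
rewrite -mulrA trcC -mulrA evD evC mulrDl linearD/= mulr_algl linearZ/= => h.
have := calcP (x * st x) ba tg e0 Pg; rewrite ler_norml => /andP[? ?].
rewrite (trcC D x) in h; rewrite /K; lra.
Qed.

(** If [P] were a square [r * r] of a polynomial, then the trace would equal
[phi (ev a r * ev b Q * ev a r)], which is nonnegative; a polynomial [r] close to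
the square root of [P] is enough. *)
Lemma trc_mul_pos a b P Q : between a -> between b ->
  (forall t, m <= t <= M -> 0 <= P.[t]) -> (forall t, m <= t <= M -> 0 <= Q.[t]) ->
  0 <= phi (ev a P * ev b Q).
Proof.
move=> ba bb P0 Q0; have sa : selfadj D a by case: ba.
have [K K0 PK] := tame_bounded (tame_poly m M P).
pose s t := `|P.[t]| `^ 2^-1.
have ts : tame m M s.
  by apply: (tame_comp (tame_powR _ _ _) PK (tame_poly m M P)); rewrite invr_ge0.
have s2 t : m <= t <= M -> s t ^+ 2 = P.[t].
  by move=> tI; rewrite /s powR12_sqrt// sqr_sqrtr// ger0_norm// P0.
have [L L0 sL] := tame_bounded ts.
apply: (@le_of_forall_eps _ ((2 * L + 1) * sqmean (ev b Q))).
  by rewrite mulr_ge0 ?sqmean_ge0//; lra.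
move=> e e0; pose d := Num.min e 1.
have d0 : 0 < d by rewrite lt_min e0/=.
have de : d <= e by rewrite /d ge_min lexx.
have d1 : d <= 1 by rewrite /d ge_min lexx orbT.
have [r rs] := approximable ts d0.
have -> : ev a P = ev a (P - r * r) + ev a r * ev a r by rewrite -evM -evD subrK.
rewrite mulrDl linearD/=.
have h1 : `|phi (ev a (P - r * r) * ev b Q)| <= e * (2 * L + 1) * sqmean (ev b Q).
  apply: (ev_bound mM _ ba) => //; first by rewrite mulr_gt0//; lra.
  move=> t tI; rewrite hornerD hornerN hornerM -s2//.
  have -> : s t ^+ 2 - r.[t] * r.[t] = (s t - r.[t]) * ((r.[t] - s t) + 2 * s t) by ring.
  have h1 := rs _ tI; have h2 := sL _ tI.
  rewrite normrM distrC; apply: ler_pM => //; first exact: le_trans de.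
  apply: (le_trans (ler_normD _ _)); rewrite normrM (ger0_norm (ler0n R 2)); lra.
have h2 : 0 <= phi (ev a r * ev a r * ev b Q).
  have /(_ (ev a r)) : pos D (ev b Q) by exact: (pos_ev mM bb).
  by rewrite (selfadj_ev r sa) trcC mulrA.
by move: h1; rewrite -mulrA ler_norml => /andP[? _]; lra.
Qed.

End Calculus.

(** * Inequalities in two noncommuting variables *)

Section TwoVariables.
Variables (R : realType) (A : algType R) (D : tracial A) (m M : R).
Hypothesis mM : m < M.
Local Notation st := (adj D).
Local Notation phi := (trc D).
Local Notation between := (between D m M).
Local Notation sqmean := (sqmean D).
Local Notation calc := (calc D m M).
Implicit Types (a b x y z : A) (P Q : {poly R}) (g h : R -> R).

Lemma trc_bern_poly a b N g h :
  phi (ev a (bern_poly m M N g) * ev b (bern_poly m M N h)) =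
  \sum_(k < N.+1) \sum_(l < N.+1) g (node m M N k) * h (node m M N l) *
    phi (ev a (bern_on m M N k) * ev b (bern_on m M N l)).
Proof.
rewrite !ev_sum mulr_suml linear_sum/=; apply: eq_bigr => k _.
rewrite mulr_sumr linear_sum/=; apply: eq_bigr => l _.
by rewrite !evZ -scalerAl -scalerAr !linearZ/= mulrA.
Qed.

Lemma calc_bern_pair a b g Q e : between a -> between b -> tame m M g -> 0 < e ->
  exists N0, forall N, (N0 <= N)%N ->
  `|phi (ev a (bern_poly m M N g) * ev b (bern_poly m M N (horner Q)))
    - calc a g (ev b Q)| <= e.
Proof.
move=> ba bb tg e0; have [K K0 gK] := tame_bounded tg.
pose c1 := (phi 1 + (K + 1) ^+ 2 * phi 1) / 2; pose c2 := sqmean (ev b Q).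
have c10 : 0 <= c1.
  have p1 := phi1_ge0 D; rewrite /c1 divr_ge0// addr_ge0//.
  by apply: mulr_ge0 => //; exact: sqr_ge0.
have c20 : 0 <= c2 by exact: sqmean_ge0.
have c0 : 0 < c1 + c2 + 1 by lra.
pose d := Num.min 1 (e / (c1 + c2 + 1)).
have d0 : 0 < d by rewrite lt_min ltr01 divr_gt0.
have d1 : d <= 1 by rewrite ge_min lexx.
have de : d * (c1 + c2) <= e.
  apply: (@le_trans _ _ (e / (c1 + c2 + 1) * (c1 + c2 + 1))); last by rewrite divfK// gt_eqF.
  by apply: ler_pM; rewrite ?(ltW d0) ?ge_min ?lexx ?orbT//; lra.
have [N1 H1] := weierstrass mM tg d0.
have [N2 H2] := weierstrass mM (tame_poly m M Q) d0.
exists (maxn N1 N2) => N; rewrite geq_max => /andP[/H1 {}H1 /H2 {}H2].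
move: (bern_poly m M N g) (bern_poly m M N (horner Q)) H1 H2 => G T H1 H2.
have -> : phi (ev a G * ev b T) - calc a g (ev b Q) =
   phi (ev b (T - Q) * ev a G) + (phi (ev a G * ev b Q) - calc a g (ev b Q)).
  rewrite evB mulrBl linearB/= (trcC D (ev b T)) (trcC D (ev b Q)); ring.
apply: (le_trans (ler_normD _ _)); apply: le_trans de.
rewrite mulrDr; apply: lerD; last exact: calcP.
apply: (@le_trans _ _ (d * sqmean (ev a G))).
  by apply: (ev_bound mM _ bb) => // t tI; rewrite hornerD hornerN H2.
rewrite ler_wpM2l ?(ltW d0)// /c1 ler_pM2r ?invr_gt0// lerD2l.
have sa : selfadj D a by case: ba.
rewrite (selfadj_ev G sa); apply: (ev_sq_bound mM ba) => t tI.
have := H1 _ tI; have := gK _ tI; rewrite !ler_norml => /andP[? ?] /andP[? ?].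
by apply/andP; split; lra.
Qed.

(** Evaluating Bernstein polynomials of both variables turns the two-variable
functional into a sum over a grid with nonnegative weights, so that it inherits
scalar inequalities even when [a] and [b] do not commute. *)
Lemma calc_two_var n (g h : nat -> R -> R) a b : between a -> between b ->
  (forall j, tame m M (g j)) -> (forall j, tame m M (h j)) ->
  (forall s t, m <= s <= M -> m <= t <= M ->
     0 <= \sum_(j < n) (g j s * t ^+ j + h j t * s ^+ j)) ->
  0 <= \sum_(j < n) (calc a (g j) (b ^+ j) + calc b (h j) (a ^+ j)).
Proof.
move=> ba bb tg th F0.
have evXn x j : ev x 'X^j = x ^+ j by rewrite /ev rmorphXn/= horner_algX.
apply: (@le_of_forall_eps _ (n%:R * 2)); first by rewrite mulr_ge0.
move=> e e0.
have [N HN] : exists N, forall j : 'I_n,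
    `|phi (ev a (bern_poly m M N (g j)) * ev b (bern_poly m M N (horner 'X^j)))
       - calc a (g j) (b ^+ j)| <= e /\
    `|phi (ev b (bern_poly m M N (h j)) * ev a (bern_poly m M N (horner 'X^j)))
       - calc b (h j) (a ^+ j)| <= e.
  have Hg j : exists N0, forall N, (N0 <= N)%N ->
    `|phi (ev a (bern_poly m M N (g j)) * ev b (bern_poly m M N (horner 'X^j)))
       - calc a (g j) (b ^+ j)| <= e by rewrite -evXn; exact: calc_bern_pair.
  have Hh j : exists N0, forall N, (N0 <= N)%N ->
    `|phi (ev b (bern_poly m M N (h j)) * ev a (bern_poly m M N (horner 'X^j)))
       - calc b (h j) (a ^+ j)| <= e by rewrite -evXn; exact: calc_bern_pair.
  have [Ng HNg] := boolp.choice Hg; have [Nh HNh] := boolp.choice Hh.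
  exists (\max_(j < n) maxn (Ng j) (Nh j)) => j; split.
    by apply: HNg; apply: leq_trans (leq_bigmax j); exact: leq_maxl.
  by apply: HNh; apply: leq_trans (leq_bigmax j); exact: leq_maxr.
have S0 : 0 <= \sum_(j < n)
    (phi (ev a (bern_poly m M N (g j)) * ev b (bern_poly m M N (horner 'X^j))) +
     phi (ev b (bern_poly m M N (h j)) * ev a (bern_poly m M N (horner 'X^j)))).
  under eq_bigr => j _.
    rewrite [phi (ev b _ * _)]trcC !trc_bern_poly -big_split/=.
    under eq_bigr => k _.
      rewrite -big_split/=.
      under eq_bigr do rewrite -mulrDl !hornerXn [X in _ + X]mulrC.
      over.
    over.
  rewrite exchange_big/=; apply: sumr_ge0 => k _.
  rewrite exchange_big/=; apply: sumr_ge0 => l _.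
  rewrite -mulr_suml mulr_ge0//; first by apply: F0; apply: node_in => //; rewrite -ltnS.
  by apply: (trc_mul_pos mM ba bb) => t tI; exact: bern_on_ge0.
apply: (le_trans S0).
have -> : e * (n%:R * 2) = \sum_(j < n) (e + e).
  by rewrite sumr_const card_ord -mulr_natr; ring.
rewrite -big_split/=; apply: ler_sum => j _.
have [] := HN j; rewrite !ler_norml => /andP[? ?] /andP[? ?]; lra.
Qed.

Lemma calc_le a g h x : between a -> tame m M g -> tame m M h ->
  (forall t, m <= t <= M -> g t <= h t) -> calc a g (x * st x) <= calc a h (x * st x).
Proof.
move=> ba tg th gh; have tN : tame m M (fun t => -1 * g t).
  by apply: tame_mul => //; exact: tame_cst.
rewrite -subr_ge0 -[X in _ - X]mul1r -mulNr -calcZ// -calcD//.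
apply: calc_ge0 => //; first exact: tame_add.
by move=> t tI; rewrite mulN1r subr_ge0 gh.
Qed.

Lemma calc_cst a c z : between a -> calc a (fun=> c) z = c * phi z.
Proof.
move=> ba; rewrite -linearZ/= -mulr_algl -(evC a) -(calc_poly mM)//.
by apply: calc_ext => t _; rewrite hornerC.
Qed.

Lemma calc_sumr a g (J : finType) (F : J -> A) : between a -> tame m M g ->
  calc a g (\sum_j F j) = \sum_j calc a g (F j).
Proof.
move=> ba tg; elim/big_rec2: _ => [|j x y _ <-]; last by rewrite calcDr.
by rewrite -(scale0r 0) calcZr// mul0r.
Qed.

End TwoVariables.

(** * Scalar inequalities for powers *)

Section PowerScalars.
Variables (R : realType) (p : R).
Implicit Types s t : R.

Definition powabs t : R := `|t| `^ p.

(** Up to constant factors, [powabs1] and [powabs2] are the first two derivatives of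
[powabs]. *)
Definition powabs1 t : R := t * `|t| `^ (p - 2).
Definition powabs2 t : R := `|t| `^ (p - 2).

Lemma powabs1E t : t * powabs2 t = powabs1 t. Proof. by []. Qed.

Lemma powR_split t (p2 : 2 <= p) : `|t| `^ p = `|t| ^+ 2 * `|t| `^ (p - 2).
Proof.
have [->|t0] := eqVneq t 0; first by rewrite normr0 expr2 !mul0r powR0 ?gt_eqF//; lra.
by rewrite -powR_mulrn// -powRD ?normr_eq0 ?t0 ?implybT// addrC subrK.
Qed.

Lemma powabsE t (p2 : 2 <= p) : t * powabs1 t = powabs t.
Proof. by rewrite /powabs powR_split// /powabs1 mulrA -expr2 real_normK// num_real. Qed.

Lemma powabs2_ge0 t : 0 <= powabs2 t. Proof. exact: powR_ge0. Qed.

Lemma powabsZ c t : powabs (c * t) = `|c| `^ p * powabs t.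
Proof. by rewrite /powabs normrM powRM. Qed.

Lemma norm_powabs1 t (p2 : 2 <= p) : `|powabs1 t| = `|t| `^ (p - 1).
Proof.
rewrite /powabs1 normrM (ger0_norm (powR_ge0 _ _)).
have [->|t0] := eqVneq t 0; first by rewrite normr0 mul0r powR0 ?gt_eqF//; lra.
have -> : p - 1 = 1 + (p - 2) by ring.
by rewrite [RHS]powRD ?powRr1// normr_eq0 t0 implybT.
Qed.

Lemma powabs_convex s t (p2 : 2 <= p) : 0 <= powabs s + (p - 1) * powabs t - p * powabs1 t * s.
Proof.
have p1 : 1 <= p by lra.
have := young_powR p1 (normr_ge0 s) (normr_ge0 t); rewrite -norm_powabs1// -mulrA -normrM.
have := ler_norm (powabs1 t * s); rewrite /powabs -mulrA; nra.
Qed.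

Lemma powabs1_mean_value_le s t (p2 : 2 <= p) : `|t| <= `|s| ->
  (powabs1 s - powabs1 t) * (s - t) <= (p - 1) * (s - t) ^+ 2 * powabs2 s.
Proof.
move=> ts.
wlog s0 : s t ts / 0 <= s => [H|].
  have [/H|s0] := leP 0 s; first exact.
  have := H (- s) (- t); rewrite !normrN => /(_ ts).
  have -> : 0 <= - s by lra.
  move=> /(_ isT); rewrite /powabs1 /powabs2 !normrN.
  have -> : (- s - - t) ^+ 2 = (s - t) ^+ 2 by ring.
  have -> : (- s * `|s| `^ (p - 2) - - t * `|t| `^ (p - 2)) * (- s - - t) =
    (s * `|s| `^ (p - 2) - t * `|t| `^ (p - 2)) * (s - t) by ring.
  by [].
have st : 0 <= s - t by have := ler_norm t; rewrite (ger0_norm s0) in ts; lra.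
suff : powabs1 s - powabs1 t <= (p - 1) * (s - t) * powabs2 s.
  move=> h; rewrite expr2 mulrA [_ * powabs2 s]mulrAC; exact: ler_wpM2r.
have [t0|t0] := leP 0 t.
  have p1 : 1 <= p - 1 by lra.
  have := young_powR p1 t0 s0.
  have e u : 0 <= u -> powabs1 u = u `^ (p - 1).
    by move=> u0; have := norm_powabs1 u p2; rewrite !ger0_norm// mulr_ge0// powR_ge0.
  have -> : p - 1 - 1 = p - 2 by ring.
  have -> : s `^ (p - 2) = powabs2 s by rewrite /powabs2 ger0_norm.
  rewrite -!e// -(powabs1E s); move: (powabs2 s) (powabs1 t) => y z; lra.
have q2 : powabs2 t <= powabs2 s.
  by apply: ge0_ler_powR; rewrite ?nnegrE//; lra.
have := powabs2_ge0 s; have := powabs2_ge0 t.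
rewrite -!powabs1E; move: (powabs2 s) (powabs2 t) q2 => x y q2 y0 x0.
have h1 : (s - t) * x <= (p - 1) * ((s - t) * x).
  by rewrite ler_peMl ?mulr_ge0//; lra.
rewrite -mulrA; apply: le_trans h1; rewrite mulrBl lerD2l lerN2.
by rewrite ler_wnM2l// ltW.
Qed.

(** The mean value theorem for [powabs1], with the sum of the values of [powabs2] at
the two ends as a bound of its values in between. *)
Lemma powabs1_mean_value s t (p2 : 2 <= p) :
  (powabs1 s - powabs1 t) * (s - t) <= (p - 1) * (s - t) ^+ 2 * (powabs2 s + powabs2 t).
Proof.
have c0 : 0 <= (p - 1) * (s - t) ^+ 2 by rewrite mulr_ge0 ?sqr_ge0//; lra.
rewrite [X in _ <= X]mulrDr; have h1 := mulr_ge0 c0 (powabs2_ge0 s); have h2 := mulr_ge0 c0 (powabs2_ge0 t).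
have [ts|/ltW st] := leP `|t| `|s|.
  by apply: (le_trans (powabs1_mean_value_le p2 ts)); rewrite lerDl.
have := powabs1_mean_value_le p2 st.
have -> : (t - s) ^+ 2 = (s - t) ^+ 2 by ring.
have -> : (powabs1 t - powabs1 s) * (t - s) = (powabs1 s - powabs1 t) * (s - t) by ring.
by move=> h; apply: (le_trans h); rewrite lerDr.
Qed.

(** Young's inequality for the conjugate exponents [p / 2] and [p / (p - 2)]. *)
Lemma young_powabs2 c t (p2 : 2 <= p) : 0 <= c ->
  c * powabs2 t <= (1 - 2 / p) * powabs t + 2 / p * c `^ (p / 2).
Proof.
move=> c0; have p0 : 0 < p by lra.
have r1 : 1 <= p / 2 by rewrite ler_pdivlMr// mul1r.
have := young_powR r1 c0 (sqr_ge0 t).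
have sq r : (t ^+ 2) `^ r = `|t| `^ (2 * r).
  by rewrite -(real_normK (num_real t)) -powR_mulrn// -powRrM.
rewrite !sq; have -> : 2 * (p / 2 - 1) = p - 2 by field.
have -> : 2 * (p / 2) = p by field.
rewrite -/(powabs t) -/(powabs2 t) => h.
have -> : c * powabs2 t = 2 / p * (p / 2 * powabs2 t * c) by field; rewrite gt_eqF.
have -> : (1 - 2 / p) * powabs t + 2 / p * c `^ (p / 2) =
   2 / p * (c `^ (p / 2) + (p / 2 - 1) * powabs t) by field; rewrite gt_eqF.
by rewrite ler_wpM2l// divr_ge0// ltW.
Qed.

Lemma tame_powabs m M (p2 : 2 <= p) : tame m M powabs. Proof. by apply: tame_powR; lra. Qed.
Lemma tame_powabs2 m M (p2 : 2 <= p) : tame m M powabs2. Proof. by apply: tame_powR; lra. Qed.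
Lemma tame_powabs1 m M (p2 : 2 <= p) : tame m M powabs1.
Proof. by apply: tame_mul; [exact: tame_id | exact: tame_powabs2]. Qed.

End PowerScalars.

(** * Klein's inequality for traces of powers *)

Section PowerTrace.
Variables (R : realType) (A : algType R) (D : tracial A) (p M : R).
Local Notation st := (adj D).
Local Notation phi := (trc D).
Local Notation between := (between D (- M) M).
Local Notation calc := (calc D (- M) M).
Local Notation psi := (powabs p).
Local Notation psi1 := (powabs1 p).
Local Notation psi2 := (powabs2 p).
Implicit Types (a b u v x y z : A) (P Q : {poly R}).
Hypothesis M0 : 0 < M.
Hypothesis p2 : 2 <= p.

Definition trpow a := calc a psi 1.

Let mM : - M < M. Proof. by apply: lt_trans M0; rewrite oppr_lt0. Qed.
Let tpsi : tame (- M) M psi. Proof. exact: tame_powabs. Qed.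
Let tpsi1 : tame (- M) M psi1. Proof. exact: tame_powabs1. Qed.
Let tpsi2 : tame (- M) M psi2. Proof. exact: tame_powabs2. Qed.

Lemma calc_psi1_self a : between a -> calc a psi1 a = trpow a.
Proof.
move=> ba; rewrite -[X in calc a psi1 X]mulr1 -(calc_mul_id mM)//.
by apply: calc_ext => t _; exact: powabsE.
Qed.

Lemma calc_psi2_mul a z : between a -> calc a psi2 (a * z) = calc a psi1 z.
Proof. by move=> ba; rewrite -(calc_mul_id mM). Qed.

(** Klein's inequality: [trpow] lies above its tangents, because the scalar
inequality [powabs_convex] survives in two noncommuting variables. *)
Lemma klein a b : between a -> between b ->
  0 <= trpow a + (p - 1) * trpow b - p * calc b psi1 a.
Proof.
move=> ba bb.
pose g j : R -> R := if j == 0%N then psi else fun=> 0.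
pose h j : R -> R := if j == 0%N then (fun t => (p - 1) * psi t) else fun t => - p * psi1 t.
have := @calc_two_var _ _ D _ _ mM 2 g h a b ba bb.
rewrite !big_ord_recr/= !big_ord0 !add0r/= !expr1.
rewrite (calc_cst mM)// mul0r add0r !(calcZ mM)// -/(trpow a) -/(trpow b).
have -> : trpow a + (p - 1) * trpow b + - p * calc b psi1 a =
  trpow a + (p - 1) * trpow b - p * calc b psi1 a by ring.
apply.
- by move=> [|j]; rewrite /g/=//; exact: tame_cst.
- by move=> [|j]; rewrite /h/=; apply: tame_mul => //; exact: tame_cst.
- move=> s t _ _; rewrite !big_ord_recr/= big_ord0 add0r/= /g /h/=.
  have := powabs_convex s t p2; rewrite !expr0 !mulr1 !expr1 mul0r add0r.
  by rewrite -mulNr -!mulNr !mulrA.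
Qed.

Lemma calc_cycle a g z : between a -> tame (- M) M g -> calc a g (z * a) = calc a g (a * z).
Proof.
move=> ba tg; apply: (calc_eq mM (K := sqmean D (a * z))) => //; first exact: sqmean_ge0.
move=> e e0; have [P Pg] := approximable mM tg e0; exists P => //.
by rewrite mulrA trcC mulrA -ev_comm -mulrA; exact: calcP.
Qed.

Lemma calcBr a g y z : between a -> tame (- M) M g -> calc a g (y - z) = calc a g y - calc a g z.
Proof. by move=> ba tg; rewrite (calcDr mM)// -(scaleN1r z) (calcZr mM)// mulN1r. Qed.

(** The inequality [powabs1_mean_value] in two noncommuting variables. *)
Lemma calc_mean_value a b : between a -> between b ->
  calc a psi1 (a - b) - calc b psi1 (a - b) <=
  (p - 1) * (calc a psi2 ((a - b) * (a - b)) + calc b psi2 ((a - b) * (a - b))).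
Proof.
move=> ba bb.
pose g j : R -> R := match j with
  | 0%N => fun t => (p - 2) * psi t
  | 1%N => fun t => (1 - 2 * (p - 1)) * psi1 t
  | _ => fun t => (p - 1) * psi2 t end.
have tg j : tame (- M) M (g j).
  by case: j => [|[|j]]; apply: tame_mul => //; exact: tame_cst.
have F0 s t : - M <= s <= M -> - M <= t <= M ->
    0 <= \sum_(j < 3) (g j s * t ^+ j + g j t * s ^+ j).
  move=> _ _; rewrite !big_ord_recr/= big_ord0 add0r/= /g !expr0 !expr1.
  have := powabs1_mean_value s t p2; rewrite -!powabsE// -!powabs1E.
  rewrite -subr_ge0; congr (is_true (0 <= _)); ring.
have := calc_two_var mM ba bb tg tg F0.
rewrite !big_ord_recr/= big_ord0 add0r/= !expr0 !expr1 !(calcZ mM)//.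
have e x y : between x -> calc x psi2 ((x - y) * (x - y)) =
    trpow x - 2 * calc x psi1 y + calc x psi2 (y * y).
  move=> bx; rewrite mulrBl !mulrBr !calcBr// (calc_cycle y bx)// !calc_psi2_mul//.
  by rewrite calc_psi1_self//; ring.
have eb : (a - b) * (a - b) = (b - a) * (b - a) by rewrite -(opprB b a) mulrNN.
rewrite (e a b ba) eb (e b a bb) !calcBr// !calc_psi1_self// -!/(trpow _) !expr2.
move=> h; rewrite -subr_ge0; move: h; congr (is_true (0 <= _)); ring.
Qed.

Lemma trpowZ c a : between a -> between (c *: a) -> trpow (c *: a) = `|c| `^ p * trpow a.
Proof.
move=> ba bca; rewrite /trpow -(calcZ mM)//.
have tc : tame (- M) M (fun t => `|c| `^ p * psi t) by apply: tame_mul => //; exact: tame_cst.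
apply: (calc_eq mM (K := sqmean D 1)) => //; first exact: sqmean_ge0.
move=> e e0; pose L := (`|c| + 1) * M.
have L0 : - L < L by rewrite gtrN// mulr_gt0// ltr_wpDl.
have [P PL] := approximable L0 (tame_powabs _ _ p2) e0.
have ML : M <= L by rewrite /L mulrDl mul1r lerDr mulr_ge0// ltW.
exists P; first by move=> t /andP[? ?]; apply: PL; lra.
have -> : ev (c *: a) P = ev a (P \Po (c *: 'X)) by rewrite ev_comp evZ evX.
apply: calcP => // t /andP[t1 t2]; rewrite horner_comp hornerZ hornerX -powabsZ; apply: PL.
rewrite -ler_norml normrM; apply: (@le_trans _ _ (`|c| * M)).
  by apply: ler_wpM2l => //; rewrite ler_norml t1.
by rewrite /L mulrDl lerDl mul1r ltW.
Qed.

(** As [z] is orthogonal to the polynomials in [y], the element [y] is a conditional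
expectation of [y + z], and the tangent of [trpow] at [y] gives Jensen's
inequality. *)
Lemma trpow_orthogonal y z : between y -> between (y + z) ->
  (forall P, phi (ev y P * z) = 0) -> trpow y <= trpow (y + z).
Proof.
move=> yb bz o; have := klein bz yb; rewrite (calcDr mM)// calc_psi1_self//.
have -> : calc y psi1 z = 0.
  apply: (calc_eq mM (K := 0)) => // e e0.
  have [P Pg] := approximable mM tpsi1 e0; exists P => //.
  by rewrite o subrr normr0 mulr0.
move: (trpow y) (trpow _) => r s; lra.
Qed.

(** Convexity of [trpow] at the midpoint of [2 *: u] and [2 *: v], from the tangent
at [u + v]. *)
Lemma trpow_add u v : between u -> between v -> between (2 *: u) -> between (2 *: v) ->
  between (u + v) -> trpow (u + v) <= 2 `^ (p - 1) * (trpow u + trpow v).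
Proof.
move=> bu bv b2u b2v buv.
have := klein b2u buv; have := klein b2v buv; rewrite !(calcZr mM)// !trpowZ//.
have := calc_psi1_self buv; rewrite (calcDr mM)// (ger0_norm (ler0n R 2)) => <-.
have -> : 2 `^ p = 2 * 2 `^ (p - 1) :> R.
  by rewrite mulr_powRB1//; move: p2 => p2'; lra.
move: (calc _ _ u) (calc _ _ v) (trpow u) (trpow v) (2 `^ _) => x y r s w.
nra.
Qed.

End PowerTrace.

(** * Random signs and Jensen inequalities *)

Section Khintchine.
Variables (R : realType) (A : algType R) (D : tracial A) (p M : R).
Local Notation st := (adj D).
Local Notation phi := (trc D).
Local Notation between := (between D (- M) M).
Local Notation calc := (calc D (- M) M).
Local Notation trpow := (trpow D p M).
Local Notation psi := (powabs p).
Local Notation psi1 := (powabs1 p).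
Local Notation psi2 := (powabs2 p).
Implicit Types (a b u v x y z : A) (P Q : {poly R}).
Hypothesis M0 : 0 < M.

Let mM : - M < M. Proof. by apply: lt_trans M0; rewrite oppr_lt0. Qed.

(** Up to signs, [u] and [v] are conditional expectations of [u - v], so changing the
sign of [v] costs a factor [2 `^ p] only. *)
Lemma trpow_add_le_sub (p2 : 2 <= p) u v :
  between u -> between v -> between (2 *: u) -> between (2 *: v) ->
  between (u + v) -> between (u - v) -> between (v - u) ->
  (forall P, phi (ev u P * v) = 0) -> (forall P, phi (ev v P * u) = 0) ->
  trpow (u + v) <= 2 `^ p * trpow (u - v).
Proof.
move=> bu bv b2u b2v bD bB bB' ov ou.
apply: (le_trans (trpow_add M0 p2 bu bv b2u b2v bD)).
have -> : 2 `^ p = 2 `^ (p - 1) * 2 :> R by rewrite mulrC mulr_powRB1//; lra.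
rewrite -mulrA ler_wpM2l ?powR_ge0// mulr_natl mulr2n; apply: lerD.
  by apply: trpow_orthogonal => // P; rewrite mulrN linearN/= ov oppr0.
have -> : trpow (u - v) = trpow (v - u).
  rewrite -[v - u]opprB -(scaleN1r (u - v)) trpowZ ?normrN1 ?powR1 ?mul1r//.
  by rewrite scaleN1r opprB.
by apply: trpow_orthogonal => // P; rewrite mulrN linearN/= ou oppr0.
Qed.

Section Signs.
Variables (I : finType) (a : I -> A).
Implicit Types e : {ffun I -> bool}.

Definition signed_sum e := \sum_i (-1) ^+ (e i) *: a i.
Definition flip i e : {ffun I -> bool} := [ffun j => (j == i) (+) e j].

Lemma flipK i : involutive (flip i).
Proof. by move=> e; apply/ffunP => j; rewrite !ffunE addbA addbb. Qed.

Lemma signed_sum_flip i e :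
  signed_sum e - signed_sum (flip i e) = (2 * (-1) ^+ (e i)) *: a i.
Proof.
rewrite /signed_sum (bigD1 i)//= [X in _ - X](bigD1 i)//= opprD addrACA.
rewrite -sumrB big1 ?addr0; last first.
  by move=> j /negbTE ji; rewrite ffunE ji subrr.
by rewrite ffunE eqxx/= signrN scaleNr opprK -scalerDl -mulr2n mulr_natl.
Qed.

(** The exchangeable pairs argument: flipping one sign preserves the uniform
distribution of signs and changes the sum by a multiple of a single term. *)
Lemma khintchine_step (p2 : 2 <= p) : (forall e, between (signed_sum e)) ->
  \sum_e trpow (signed_sum e) <=
  2 * (p - 1) * \sum_e calc (signed_sum e) psi2 (\sum_i a i * a i).
Proof.
move=> bX.
have t1 : tame (- M) M psi1 by exact: tame_powabs1.
have t2 : tame (- M) M psi2 by exact: tame_powabs2.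
have -> : \sum_e trpow (signed_sum e) =
    \sum_i \sum_(e : {ffun I -> bool}) (-1) ^+ (e i) * calc (signed_sum e) psi1 (a i).
  rewrite exchange_big/=; apply: eq_bigr => e _.
  rewrite -(calc_psi1_self M0 p2)// {2}/signed_sum (calc_sumr mM)//.
  by apply: eq_bigr => i _; rewrite (calcZr mM).
under [X in _ * X]eq_bigr do rewrite (calc_sumr mM)//.
rewrite [X in _ <= _ * X]exchange_big mulr_sumr; apply: ler_sum => i _.
have sgn2 e : (-1) ^+ (e i) * (-1) ^+ (e i) = 1 :> R by rewrite -expr2 sqrr_sign.
set S := \sum_(e : {ffun I -> bool}) _.
have S4 : 4 * S = \sum_e (calc (signed_sum e) psi1 (signed_sum e - signed_sum (flip i e))
    - calc (signed_sum (flip i e)) psi1 (signed_sum e - signed_sum (flip i e))).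
  have SE : S = \sum_(e : {ffun I -> bool}) - ((-1) ^+ (e i) * calc (signed_sum (flip i e)) psi1 (a i)).
    rewrite /S (reindex_inj (inv_inj (flipK i))); apply: eq_bigr => e _.
    by rewrite {1}/flip ffunE eqxx signrN mulNr.
  have -> : 4 * S = 2 * (S + S) by ring.
  rewrite {2}SE /S -big_split/= mulr_sumr; apply: eq_bigr => e _.
  by rewrite signed_sum_flip !(calcZr mM)//; ring.
have le4 : 4 * S <= \sum_(e : {ffun I -> bool}) 4 * (p - 1) * (calc (signed_sum e) psi2 (a i * a i) +
    calc (signed_sum (flip i e)) psi2 (a i * a i)).
  rewrite S4; apply: ler_sum => e _; apply: (le_trans (calc_mean_value M0 p2 _ _)) => //.
  rewrite signed_sum_flip -scalerAl -scalerAr scalerA !(calcZr mM)//.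
  have -> : 2 * (-1) ^+ (e i) * (2 * (-1) ^+ (e i)) = 4 :> R.
    by rewrite mulrACA sgn2; ring.
  by rewrite -mulrDr mulrCA mulrA.
move: le4; rewrite -mulr_sumr big_split/=.
have <- : \sum_(e : {ffun I -> bool}) calc (signed_sum e) psi2 (a i * a i) =
    \sum_(e : {ffun I -> bool}) calc (signed_sum (flip i e)) psi2 (a i * a i).
  by rewrite (reindex_inj (inv_inj (flipK i))).
by move: (\sum_(e : {ffun I -> bool}) calc (signed_sum e) psi2 (a i * a i)) => T; lra.
Qed.

Variables (J : finType) (E : J -> A) (d : J -> R).

(** Noncommutative Khintchine inequality of order [sqrt p]; [d] and [E] give the
spectral decomposition of the square function. Young's inequality, applied in
front of each projection [E j], splits the right-hand side of [khintchine_step]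
into a multiple of the left-hand side and the moment of the square function. *)
Lemma khintchine (p2 : 2 <= p) : (forall e, between (signed_sum e)) ->
  (forall j, 0 <= d j) -> (forall j, E j = E j * st (E j)) -> \sum_j E j = 1 ->
  \sum_i a i * a i = \sum_j d j *: E j ->
  \sum_e trpow (signed_sum e) <=
  2 ^+ #|I| * ((2 * (p - 1)) `^ (p / 2) * \sum_j d j `^ (p / 2) * phi (E j)).
Proof.
move=> bX d0 EE E1 aE; have p0 : 0 < p by lra.
have t0 : tame (- M) M psi by exact: tame_powabs.
have t2 : tame (- M) M psi2 by exact: tame_powabs2.
set K := \sum_e trpow (signed_sum e); set c := 2 * (p - 1).
have c0 : 0 <= c by rewrite /c; lra.
set T := _ `^ _ * _.
have one e : c * calc (signed_sum e) psi2 (\sum_i a i * a i) <=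
    (1 - 2 / p) * trpow (signed_sum e) + 2 / p * T.
  have -> : trpow (signed_sum e) = calc (signed_sum e) psi (\sum_j E j) by rewrite E1.
  rewrite aE !(calc_sumr mM)// /T !mulr_sumr -big_split/=.
  apply: ler_sum => j _; rewrite (calcZr mM)// [c * (d j * _)]mulrA -(calcZ mM)//.
  have -> : 2 / p * (c `^ (p / 2) * (d j `^ (p / 2) * phi (E j))) =
     2 / p * (c * d j) `^ (p / 2) * phi (E j) by rewrite powRM//; ring.
  rewrite -(calc_cst mM _ _ (bX e)) -(calcZ mM)// -(calcD mM)//.
  - rewrite EE; apply: (calc_le mM) => //.
    + by apply: tame_mul => //; exact: tame_cst.
    + by apply: tame_add; [apply: tame_mul => //|]; exact: tame_cst.
    + by move=> t _; apply: young_powabs2 => //; rewrite mulr_ge0.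
  - by apply: tame_mul => //; exact: tame_cst.
  - exact: tame_cst.
have : K <= \sum_(e : {ffun I -> bool}) ((1 - 2 / p) * trpow (signed_sum e) + 2 / p * T).
  apply: (le_trans (khintchine_step p2 bX)); rewrite mulr_sumr; exact: ler_sum.
rewrite big_split/= -mulr_sumr -/K sumr_const card_ffun card_bool.
rewrite -[_ *+ (_ ^ _)]mulr_natl natrX => h.
have {}h : 2 / p * K <= 2 / p * (2 ^+ #|I| * T).
  by rewrite mulrCA; move: h; rewrite mulrBl mul1r; move: (_ * K) (_ * (_ * T)) => ? ?; lra.
by rewrite ler_pM2l ?divr_gt0// in h.
Qed.

End Signs.

(** For each projection [E j], integration against [g |-> calc a g (E j)] is a
positive functional of mass [phi (E j)] with barycentre [d j], and Jensen's
inequality holds for it. *)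
Lemma calc_jensen (J : finType) (E : J -> A) (d : J -> R) r a : 1 <= r ->
  between a -> (forall j, 0 <= d j) -> (forall j, E j = E j * st (E j)) ->
  \sum_j E j = 1 -> (forall j, phi (a * E j) = d j * phi (E j)) ->
  \sum_j d j `^ r * phi (E j) <= calc a (powabs r) 1.
Proof.
move=> r1 ba d0 EE E1 aE; have r0 : 0 <= r by lra.
have tr : tame (- M) M (powabs r) by exact: tame_powR.
rewrite -E1 (calc_sumr mM)//; apply: ler_sum => j _.
have -> : d j `^ r * phi (E j) = calc a (fun t => r * d j `^ (r - 1) * t + (1 - r) * d j `^ r) (E j).
  rewrite (calcD mM)//; last by exact: tame_cst.
  - rewrite (calcZ mM)//; last exact: tame_id.
    rewrite (calc_cst mM)// -[X in calc a X]/(fun t : R => t).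
    have -> : calc a id (E j) = phi (a * E j).
      rewrite -{2}(evX a) -(calc_poly mM)//; apply: calc_ext => t _.
      by rewrite hornerX.
    rewrite aE; have -> : d j `^ r = d j * d j `^ (r - 1).
      have [->|rn] := eqVneq r 1; first by rewrite subrr powRr0 powRr1// mulr1.
      by rewrite mulr_powRB1//; lra.
    ring.
  - by apply: tame_mul; [exact: tame_cst | exact: tame_id].
rewrite EE; apply: (calc_le mM) => //.
  by apply: tame_add; [apply: tame_mul; [exact: tame_cst|exact: tame_id] | exact: tame_cst].
move=> t _; have := young_powR r1 (normr_ge0 t) (d0 j).
have : r * d j `^ (r - 1) * t <= r * d j `^ (r - 1) * `|t|.
  by rewrite ler_wpM2l ?ler_norm// mulr_ge0// powR_ge0.
rewrite /powabs; lra.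
Qed.

End Khintchine.

(** * Complex matrices and finite sums *)

Section ComplexMatrices.
Variable R : realType.
Local Notation C := R[i].

Lemma nsqE (z : C) : complex.Re `|z| ^+ 2 = complex.Re z ^+ 2 + complex.Im z ^+ 2.
Proof. by rewrite normc_def /= sqr_sqrtr// addr_ge0 ?sqr_ge0. Qed.

Lemma Re_conjM (z : C) : complex.Re (Num.conj z * z) = complex.Re `|z| ^+ 2.
Proof.
rewrite nsqE; case: z => a b; have -> : Num.conj (a +i* b)%C = (a -i* b)%C by [].
by rewrite /=; ring.
Qed.

Lemma conj_real (r : R) : Num.conj (r%:C)%C = (r%:C)%C :> C.
Proof. by have := conjc_real r. Qed.

Lemma Re_conj (z : C) : complex.Re (Num.conj z) = complex.Re z.
Proof. by case: z. Qed.

Lemma ReD (z w : C) : complex.Re (z + w) = complex.Re z + complex.Re w.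
Proof. by case: z w => a b [c d]. Qed.

Lemma ReB (z w : C) : complex.Re (z - w) = complex.Re z - complex.Re w.
Proof. by case: z w => a b [c d]. Qed.

Lemma ImB (z w : C) : complex.Im (z - w) = complex.Im z - complex.Im w.
Proof. by case: z w => a b [c d]. Qed.

Lemma Re_realM (r : R) (z : C) : complex.Re ((r%:C)%C * z) = r * complex.Re z.
Proof. by case: z => a b /=; rewrite mul0r subr0. Qed.

Definition adj_mx m n (A : 'M[C]_(m, n)) : 'M[C]_(n, m) := map_mx Num.conj A^T.

Lemma adj_mxE n (A : 'M[C]_n) : adjmx A = adj_mx A. Proof. by []. Qed.

Lemma adj_mxK m n (A : 'M[C]_(m, n)) : adj_mx (adj_mx A) = A.
Proof. by apply/matrixP => i j; rewrite !mxE conjCK. Qed.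

Lemma adj_mxM m n k (A : 'M[C]_(m, n)) (B : 'M[C]_(n, k)) :
  adj_mx (A *m B) = adj_mx B *m adj_mx A.
Proof. by rewrite /adj_mx trmx_mul map_mxM. Qed.

Lemma adj_mxD m n (A B : 'M[C]_(m, n)) : adj_mx (A + B) = adj_mx A + adj_mx B.
Proof. by rewrite /adj_mx linearD/= map_mxD. Qed.

Lemma adj_mxN m n (A : 'M[C]_(m, n)) : adj_mx (- A) = - adj_mx A.
Proof. by rewrite /adj_mx linearN/= map_mxN. Qed.

Lemma adj_mx0 m n : adj_mx (0 : 'M[C]_(m, n)) = 0.
Proof. by rewrite /adj_mx linear0 map_mx0. Qed.

Lemma adj_mxZ m n (c : C) (A : 'M[C]_(m, n)) : adj_mx (c *: A) = Num.conj c *: adj_mx A.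
Proof. by rewrite /adj_mx linearZ/= map_mxZ. Qed.

Lemma tr_adj n (A : 'M[C]_n) : \tr (adj_mx A) = Num.conj (\tr A).
Proof. by rewrite /mxtrace rmorph_sum; apply: eq_bigr => i _; rewrite !mxE. Qed.

Definition fro m n (A : 'M[C]_(m, n)) : R := \sum_i \sum_j complex.Re `|A i j| ^+ 2.

Lemma Re_sum I (r : seq I) (P : pred I) (F : I -> C) :
  complex.Re (\sum_(i <- r | P i) F i) = \sum_(i <- r | P i) complex.Re (F i).
Proof. by elim/big_rec2: _ => [//|i y x _ <-]; case: (F i) x => a b [c d]. Qed.

Lemma Re_tr_gram m n (A : 'M[C]_(m, n)) : complex.Re (\tr (adj_mx A *m A)) = fro A.
Proof.
rewrite /fro exchange_big/= /mxtrace Re_sum; apply: eq_bigr => j _.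
by rewrite mxE Re_sum; apply: eq_bigr => i _; rewrite !mxE Re_conjM.
Qed.

Lemma fro_ge0 m n (A : 'M[C]_(m, n)) : 0 <= fro A.
Proof. by apply: sumr_ge0 => i _; apply: sumr_ge0 => j _; exact: sqr_ge0. Qed.

End ComplexMatrices.

Section FiniteSums.
Variable T : choiceType.
Implicit Types (V : zmodType).

Definition finsupp V (F : T -> V) := exists X : {fset T}, forall g, g \notin X -> F g = 0.

Lemma finsuppD V (F G : T -> V) : finsupp F -> finsupp G -> finsupp (fun g => F g + G g).
Proof.
move=> [X hX] [Y hY]; exists (X `|` Y)%fset => g; rewrite inE negb_or => /andP[gX gY].
by rewrite hX// hY// addr0.
Qed.

Lemma finsupp_comp V (V' : zmodType) (f : T -> V -> V') (F : T -> V) :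
  (forall g, f g 0 = 0) -> finsupp F -> finsupp (fun g => f g (F g)).
Proof. by move=> f0 [X hX]; exists X => g gX; rewrite hX. Qed.

Lemma finsupp_reindex V (F : T -> V) (h h' : T -> T) : cancel h h' ->
  finsupp F -> finsupp (F \o h).
Proof.
move=> hK [X hX]; exists [fset h' x | x in X]%fset => g gX /=; apply: hX.
by apply: contra gX => gX; apply/imfsetP; exists (h g).
Qed.

Lemma fsumE V (X : {fset T}) (F : T -> V) : (forall g, g \notin X -> F g = 0) ->
  \sum_(g \in [set: T]%classic) F g = \sum_(g <- X) F g.
Proof. exact: fsbigTE. Qed.

Lemma fsumD V (F G : T -> V) : finsupp F -> finsupp G ->
  \sum_(g \in [set: T]%classic) (F g + G g) =
  \sum_(g \in [set: T]%classic) F g + \sum_(g \in [set: T]%classic) G g.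
Proof.
move=> [X hX] [Y hY].
have hXY g : g \notin (X `|` Y)%fset -> F g = 0 /\ G g = 0.
  by rewrite inE negb_or => /andP[gX gY]; rewrite hX// hY.
rewrite (@fsumE _ (X `|` Y)%fset F) ?(@fsumE _ (X `|` Y)%fset G) ?(@fsumE _ (X `|` Y)%fset (fun g => F g + G g)).
- by rewrite big_split.
- by move=> g /hXY[-> ->]; rewrite addr0.
- by move=> g /hXY[].
- by move=> g /hXY[].
Qed.

Lemma fsum_raddf V (V' : zmodType) (f : {additive V -> V'}) (F : T -> V) : finsupp F ->
  f (\sum_(g \in [set: T]%classic) F g) = \sum_(g \in [set: T]%classic) f (F g).
Proof.
move=> [X hX]; rewrite (fsumE hX) raddf_sum (@fsumE _ X)// => g /hX ->.
by rewrite raddf0.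
Qed.

Lemma fsum_big V (I : Type) (r : seq I) (F : I -> T -> V) : (forall i, finsupp (F i)) ->
  \sum_(g \in [set: T]%classic) \sum_(i <- r) F i g =
  \sum_(i <- r) \sum_(g \in [set: T]%classic) F i g.
Proof.
move=> fF; have fsum s : finsupp (fun g => \sum_(i <- s) F i g).
  elim: s => [|i s IH]; first by exists fset0 => g _; rewrite big_nil.
  have [X hX] := finsuppD (fF i) IH; exists X => g /hX; by rewrite big_cons.
elim: r => [|i r IH]; first by rewrite big_nil fsbig1// => g _; rewrite big_nil.
rewrite big_cons -IH -fsumD//; apply: eq_fsbigr => g _; by rewrite big_cons.
Qed.

Lemma fsum_only V (x : T) (F : T -> V) : (forall g, g != x -> F g = 0) ->
  \sum_(g \in [set: T]%classic) F g = F x.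
Proof.
move=> h; rewrite (@fsumE _ [fset x]%fset) ?big_seq_fset1// => g.
by rewrite inE => /h.
Qed.

End FiniteSums.

(** * Convolution of matrix-valued functions *)

Section Convolution.
Variables (R : realType) (W : groupType).
Local Notation C := R[i].
Local Notation fsum F := (\sum_(g \in [set: W]%classic) F g).

Definition conv n m k (x : W -> 'M[C]_(n, m)) (f : W -> 'M[C]_(m, k)) : W -> 'M[C]_(n, k) :=
  fun h => \sum_(g \in [set: W]%classic) x g *m f (g^-1 * h)%g.

Lemma fsum_shift (V : zmodType) (F : W -> V) u :
  \sum_(g \in [set: W]%classic) F g = \sum_(g \in [set: W]%classic) F (u * g)%g.
Proof.
apply: (@reindex_fsbigT _ _ _ _ _ (fun g => u * g)%g).
by exists (fun g => u^-1 * g)%g => g; rewrite mulgA ?mulVg ?mulgV mul1g.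
Qed.

Lemma fsum_inv (V : zmodType) (F : W -> V) :
  \sum_(g \in [set: W]%classic) F g = \sum_(g \in [set: W]%classic) F g^-1%g.
Proof.
by apply: (@reindex_fsbigT _ _ _ _ _ (fun g => g^-1)%g); exists (fun g => g^-1)%g => g; rewrite invgK.
Qed.

Lemma finsupp_mull n m k (x : W -> 'M[C]_(n, m)) (y : W -> 'M[C]_(m, k)) :
  finsupp x -> finsupp (fun g => x g *m y g).
Proof. by move=> [X hX]; exists X => g /hX ->; rewrite mul0mx. Qed.

Lemma finsupp_mulr n m k (x : W -> 'M[C]_(n, m)) (y : W -> 'M[C]_(m, k)) :
  finsupp y -> finsupp (fun g => x g *m y g).
Proof. by move=> [X hX]; exists X => g /hX ->; rewrite mulmx0. Qed.

Lemma convE n m k (x : W -> 'M[C]_(n, m)) (f : W -> 'M[C]_(m, k)) (X : {fset W}) h :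
  (forall g, g \notin X -> x g = 0) -> conv x f h = \sum_(g <- X) x g *m f (g^-1 * h)%g.
Proof. by move=> hX; apply: fsumE => g /hX ->; rewrite mul0mx. Qed.

Lemma finsupp_conv n m k (x : W -> 'M[C]_(n, m)) (f : W -> 'M[C]_(m, k)) :
  finsupp x -> finsupp f -> finsupp (conv x f).
Proof.
move=> [X hX] [Y hY]; exists [fset (g * k)%g | g in X, k in Y]%fset => h hh.
rewrite (convE _ _ hX) big_seq big1// => g gX.
rewrite hY ?mulmx0//; apply: contra hh => gh; apply/imfset2P.
by exists g => //; exists (g^-1 * h)%g => //; rewrite mulgA mulgV mul1g.
Qed.

Lemma convA n m k l (x : W -> 'M[C]_(n, m)) (y : W -> 'M[C]_(m, k)) (f : W -> 'M[C]_(k, l)) :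
  finsupp x -> finsupp y -> conv x (conv y f) = conv (conv x y) f.
Proof.
move=> [X hX] fy; apply/funext => h; rewrite (convE _ _ hX).
rewrite [RHS](_ : _ = \sum_(u \in [set: W]%classic)
    \sum_(g <- X) x g *m y (g^-1 * u)%g *m f (u^-1 * h)%g); last first.
  by apply: eq_fsbigr => u _; rewrite (convE _ _ hX) mulmx_suml.
rewrite fsum_big; last first.
  move=> g; apply: finsupp_mull; apply: finsupp_mulr.
  by apply: (finsupp_reindex (h' := fun u => (g * u)%g)) fy => u; rewrite mulgA mulgV mul1g.
apply: eq_bigr => g _; rewrite /conv (fsum_raddf (mulmx (x g))); last exact: finsupp_mull.
rewrite [RHS](fsum_shift _ g); apply: eq_fsbigr => v _.
by rewrite /= mulKg mulmxA invgM !mulgA.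
Qed.

Lemma convDl n m k (x y : W -> 'M[C]_(n, m)) (f : W -> 'M[C]_(m, k)) : finsupp x -> finsupp y ->
  conv (fun g => x g + y g) f = (fun h => conv x f h + conv y f h).
Proof.
move=> fx fy; apply/funext => h; rewrite /conv -fsumD; try exact: finsupp_mull.
by apply: eq_fsbigr => g _; rewrite mulmxDl.
Qed.

Lemma convDr n m k (x : W -> 'M[C]_(n, m)) (f f' : W -> 'M[C]_(m, k)) : finsupp x ->
  conv x (fun g => f g + f' g) = (fun h => conv x f h + conv x f' h).
Proof.
move=> fx; apply/funext => h; rewrite /conv -fsumD; try exact: finsupp_mull.
by apply: eq_fsbigr => g _; rewrite mulmxDr.
Qed.

Lemma convZl n m k c (x : W -> 'M[C]_(n, m)) (f : W -> 'M[C]_(m, k)) : finsupp x ->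
  conv (fun g => c *: x g) f = (fun h => c *: conv x f h).
Proof.
move=> fx; apply/funext => h; rewrite /conv (fsum_raddf ( *:%R c)); last exact: finsupp_mull.
by apply: eq_fsbigr => g _; rewrite /= scalemxAl.
Qed.

Lemma convZr n m k c (x : W -> 'M[C]_(n, m)) (f : W -> 'M[C]_(m, k)) : finsupp x ->
  conv x (fun g => c *: f g) = (fun h => c *: conv x f h).
Proof.
move=> fx; apply/funext => h; rewrite /conv (fsum_raddf ( *:%R c)); last exact: finsupp_mull.
by apply: eq_fsbigr => g _; rewrite /= scalemxAr.
Qed.

Definition tens_mx n m (B : 'M[C]_(n, m)) (s : W) : W -> 'M[C]_(n, m) :=
  fun g => if g == s then B else 0.

Lemma finsupp_tens n m (B : 'M[C]_(n, m)) s : finsupp (tens_mx B s).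
Proof. by exists [fset s]%fset => g; rewrite inE /tens_mx => /negbTE ->. Qed.

Lemma conv_tensl n m k (B : 'M[C]_(n, m)) s (f : W -> 'M[C]_(m, k)) h :
  conv (tens_mx B s) f h = B *m f (s^-1 * h)%g.
Proof.
rewrite /conv (fsum_only (x := s)) /tens_mx ?eqxx// => g /negbTE ->.
by rewrite mul0mx.
Qed.

Lemma conv_tensr n m k (x : W -> 'M[C]_(n, m)) (B : 'M[C]_(m, k)) s h :
  conv x (tens_mx B s) h = x (h * s^-1)%g *m B.
Proof.
rewrite /conv (fsum_only (x := (h * s^-1)%g)) /tens_mx.
  by rewrite invgM invgK -mulgA mulVg mulg1 eqxx.
move=> g gh; rewrite ifN ?mulmx0//; apply: contra gh => /eqP <-.
by rewrite invgM invgK mulgA mulgV mul1g.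
Qed.

Definition star_mx n m (x : W -> 'M[C]_(n, m)) : W -> 'M[C]_(m, n) :=
  fun g => adj_mx (x g^-1%g).

Lemma finsupp_star n m (x : W -> 'M[C]_(n, m)) : finsupp x -> finsupp (star_mx x).
Proof.
move=> fx; have := finsupp_reindex (h := fun g => g^-1%g) (@invgK W) fx.
by move=> [X hX]; exists X => g /hX /= xg; rewrite /star_mx xg adj_mx0.
Qed.

Lemma star_mxK n m (x : W -> 'M[C]_(n, m)) : star_mx (star_mx x) = x.
Proof. by apply/funext => g; rewrite /star_mx invgK adj_mxK. Qed.

Lemma adj_mx_additive n m : additive (@adj_mx R n m).
Proof. by move=> A B; rewrite adj_mxD adj_mxN. Qed.

HB.instance Definition _ n m :=
  GRing.isAdditive.Build 'M[C]_(n, m) 'M[C]_(m, n) (@adj_mx R n m) (@adj_mx_additive n m).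

Lemma star_conv n m k (x : W -> 'M[C]_(n, m)) (y : W -> 'M[C]_(m, k)) :
  finsupp x -> star_mx (conv x y) = conv (star_mx y) (star_mx x).
Proof.
move=> fx; apply/funext => g; rewrite /star_mx /conv fsum_raddf; last exact: finsupp_mull.
rewrite [RHS](fsum_shift _ g); apply: eq_fsbigr => v _ /=.
by rewrite adj_mxM (invgM _ g) invgK mulKg invgM.
Qed.

End Convolution.

(** * The group algebra with matrix coefficients *)

Section GroupAlgebra.
Variables (R : realType) (W : groupType) (n : nat).
Local Notation C := R[i].

(** Finite sums of matrices tensored with group elements. The matrix size [n.+1]
makes the algebra nontrivial, as [algType] demands. *)
Record galg := Galg { gval :> W -> 'M[C]_n.+1; gvalP : finsupp gval }.
Implicit Types x y z : galg.

Lemma galgP x y : gval x =1 gval y -> x = y.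
Proof.
case: x y => [x fx] [y fy] /= /funext xy; rewrite xy in fx *.
by congr Galg; exact: Prop_irrelevance.
Qed.

HB.instance Definition _ := gen_eqMixin galg.
HB.instance Definition _ := gen_choiceMixin galg.

Definition galg0 := @Galg (fun=> 0) (ex_intro _ fset0 (fun g _ => erefl)).
Definition galg_add x y := Galg (finsuppD (gvalP x) (gvalP y)).
Definition galg_opp x :=
  Galg (finsupp_comp (f := fun _ => -%R) (fun=> oppr0 _) (gvalP x)).
Definition galg_scale (r : R) x :=
  Galg (finsupp_comp (f := fun _ A => (r%:C)%C *: A) (fun=> scaler0 _ _) (gvalP x)).
Definition galg_tens B s := Galg (finsupp_tens (B : 'M[C]_n.+1) (s : W)).
Definition galg_mul x y := Galg (finsupp_conv (gvalP x) (gvalP y)).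

Fact galg_addA : associative galg_add.
Proof. by move=> x y z; apply: galgP => g /=; rewrite addrA. Qed.
Fact galg_addC : commutative galg_add.
Proof. by move=> x y; apply: galgP => g /=; rewrite addrC. Qed.
Fact galg_add0 : left_id galg0 galg_add.
Proof. by move=> x; apply: galgP => g /=; rewrite add0r. Qed.
Fact galg_addN : left_inverse galg0 galg_opp galg_add.
Proof. by move=> x; apply: galgP => g /=; rewrite addNr. Qed.
HB.instance Definition _ :=
  GRing.isZmodule.Build galg galg_addA galg_addC galg_add0 galg_addN.

Fact galg_mulA : associative galg_mul.
Proof.
move=> x y z; apply: galgP => g /=; rewrite convA //; exact: gvalP.
Qed.
Fact galg_mul1 : left_id (galg_tens 1%:M 1) galg_mul.
Proof. by move=> x; apply: galgP => g /=; rewrite conv_tensl mul1mx invg1 mul1g. Qed.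
Fact galg_mulr1 : right_id (galg_tens 1%:M 1) galg_mul.
Proof. by move=> x; apply: galgP => g /=; rewrite conv_tensr mulmx1 invg1 mulg1. Qed.
Fact galg_mulDl : left_distributive galg_mul galg_add.
Proof.
move=> x y z; apply: galgP => g /=; rewrite convDl //; exact: gvalP.
Qed.
Fact galg_mulDr : right_distributive galg_mul galg_add.
Proof.
move=> x y z; apply: galgP => g /=; rewrite convDr //; exact: gvalP.
Qed.
Fact galg_1neq0 : galg_tens 1%:M 1 != 0 :> galg.
Proof.
apply/eqP => /(congr1 (fun x => gval x 1%g)) /= /matrixP /(_ ord0 ord0).
by rewrite /tens_mx eqxx !mxE eqxx => /eqP; rewrite oner_eq0.
Qed.
HB.instance Definition _ := GRing.Zmodule_isNzRing.Build galg
  galg_mulA galg_mul1 galg_mulr1 galg_mulDl galg_mulDr galg_1neq0.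

Fact galg_scaleA r s x : galg_scale r (galg_scale s x) = galg_scale (r * s) x.
Proof. by apply: galgP => g /=; rewrite scalerA -rmorphM. Qed.
Fact galg_scale1 : left_id 1 galg_scale.
Proof. by move=> x; apply: galgP => g /=; rewrite rmorph1 scale1r. Qed.
Fact galg_scaleDr : right_distributive galg_scale +%R.
Proof. by move=> r x y; apply: galgP => g /=; rewrite scalerDr. Qed.
Fact galg_scaleDl x : {morph galg_scale^~ x : r s / r + s}.
Proof. by move=> r s; apply: galgP => g /=; rewrite rmorphD scalerDl. Qed.
HB.instance Definition _ := GRing.Zmodule_isLmodule.Build R galg
  galg_scaleA galg_scale1 galg_scaleDr galg_scaleDl.
Fact galg_scaleAl (r : R) x y : r *: (x * y) = (r *: x) * y.
Proof. by apply: galgP => g /=; rewrite convZl //; exact: gvalP. Qed.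
Fact galg_scaleAr (r : R) x y : r *: (x * y) = x * (r *: y).
Proof. by apply: galgP => g /=; rewrite convZr //; exact: gvalP. Qed.
HB.instance Definition _ := GRing.Lmodule_isLalgebra.Build R galg galg_scaleAl.
HB.instance Definition _ := GRing.Lalgebra_isAlgebra.Build R galg galg_scaleAr.

Lemma gvalM x y : gval (x * y) = conv x y. Proof. by []. Qed.
Lemma gvalD x y g : gval (x + y) g = gval x g + gval y g. Proof. by []. Qed.
Lemma gvalZ (r : R) x g : gval (r *: x) g = (r%:C)%C *: gval x g. Proof. by []. Qed.
Lemma gval1 : gval 1 = tens_mx 1%:M 1%g. Proof. by []. Qed.
Lemma gval_sum I (r : seq I) (P : pred I) (F : I -> galg) g :
  gval (\sum_(i <- r | P i) F i) g = \sum_(i <- r | P i) gval (F i) g.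
Proof. by elim/big_rec2: _ => [//|i y x _ <-]. Qed.

Definition galg_star x := Galg (finsupp_star (gvalP x)).

Fact galg_star_linear : linear galg_star.
Proof.
move=> r x y; apply: galgP => g /=.
by rewrite /star_mx /= adj_mxD adj_mxZ conj_real.
Qed.
HB.instance Definition _ := GRing.isLinear.Build R galg galg _ galg_star galg_star_linear.

Definition galg_tr x : R := complex.Re (\tr (x 1%g)).

Fact galg_tr_scalar : scalar galg_tr.
Proof.
move=> r x y; rewrite /galg_tr /= linearD linearZ/=.
by rewrite ReD Re_realM.
Qed.
HB.instance Definition _ := GRing.isLinear.Build R galg R _ galg_tr galg_tr_scalar.

Lemma galg_tr_starM x y :
  galg_tr (galg_star x * y) = complex.Re (\sum_(g \in [set: W]%classic) \tr (adj_mx (x g) *m y g)).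
Proof.
rewrite /galg_tr /= /conv (fsum_raddf mxtrace); last first.
  by apply: finsupp_mull; exact: finsupp_star (gvalP x).
rewrite [in LHS]fsum_inv; apply: (congr1 (@complex.Re R)); apply: eq_fsbigr => g _.
by rewrite /star_mx /= invgK mulg1.
Qed.

Lemma galg_tr_gram (X : {fset W}) x : (forall g, g \notin X -> x g = 0) ->
  galg_tr (galg_star x * x) = \sum_(g <- X) fro (x g).
Proof.
move=> hX; rewrite galg_tr_starM (@fsumE _ _ X); last by move=> g /hX ->; rewrite mulmx0 linear0.
by rewrite Re_sum; apply: eq_bigr => g _; rewrite Re_tr_gram.
Qed.

Fact galg_starM x y : galg_star (x * y) = galg_star y * galg_star x.
Proof. by apply: galgP => g /=; rewrite star_conv//; exact: gvalP. Qed.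
Fact galg_starK : involutive galg_star.
Proof. by move=> x; apply: galgP => g /=; rewrite star_mxK. Qed.
Fact galg_trC x y : galg_tr (x * y) = galg_tr (y * x).
Proof.
rewrite /galg_tr /= /conv !(fsum_raddf mxtrace); try by apply: finsupp_mull; exact: gvalP.
rewrite fsum_inv; congr (complex.Re _); apply: eq_fsbigr => g _ /=.
by rewrite !mulg1 invgK mxtrace_mulC.
Qed.
Fact galg_tr_star x : galg_tr (galg_star x) = galg_tr x.
Proof. by rewrite /galg_tr /= /star_mx invg1 tr_adj Re_conj. Qed.
Fact galg_tr_ge0 x : 0 <= galg_tr (galg_star x * x).
Proof.
have [X hX] := gvalP x; rewrite (galg_tr_gram hX).
by apply: sumr_ge0 => g _; exact: fro_ge0.
Qed.

Definition galg_tracial : tracial galg :=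
  @Tracial R galg galg_star galg_tr galg_starM galg_starK galg_trC galg_tr_star galg_tr_ge0.

End GroupAlgebra.

(** * Boundedness of multiplication operators *)

Section Bounded.
Variables (R : realType) (A : algType R) (D : tracial A).
Local Notation st := (adj D).
Local Notation phi := (trc D).
Implicit Types x y z : A.

Definition sqnorm x := phi (st x * x).

Lemma sqnorm_ge0 x : 0 <= sqnorm x. Proof. exact: trc_ge0. Qed.

Lemma pos_gram x : pos D (st x * x).
Proof. by have := pos_conj x (pos1 D); rewrite mulr1. Qed.

Lemma sqnormD x y : sqnorm (x + y) = sqnorm x + 2 * phi (st x * y) + sqnorm y.
Proof.
rewrite /sqnorm linearD/= mulrDl !mulrDr !linearD/=.
have -> : phi (st y * x) = phi (st x * y) by rewrite -trc_adj adjM adjK.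
ring.
Qed.

Lemma sqnormZ c x : sqnorm (c *: x) = c ^+ 2 * sqnorm x.
Proof. by rewrite /sqnorm linearZ/= -scalerAl -scalerAr !linearZ/= mulrA expr2. Qed.

Lemma sqnormD_le x y : sqnorm (x + y) <= 2 * sqnorm x + 2 * sqnorm y.
Proof.
have := sqnorm_ge0 (x - y); rewrite !sqnormD -scaleN1r sqnormZ -scalerAr linearZ/=; lra.
Qed.

Definition bounded x := exists c, forall y, sqnorm (x * y) <= c * sqnorm y.

Lemma boundedD x y : bounded x -> bounded y -> bounded (x + y).
Proof.
move=> [c hc] [d hd]; exists (2 * c + 2 * d) => z; rewrite mulrDl.
apply: (le_trans (sqnormD_le _ _)); have := hc z; have := hd z; lra.
Qed.

Lemma bounded_sum I (r : seq I) (F : I -> A) : (forall i, bounded (F i)) ->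
  bounded (\sum_(i <- r) F i).
Proof.
move=> bF; elim: r => [|i r IH]; last by rewrite big_cons; exact: boundedD.
by exists 0 => y; rewrite big_nil !mul0r /sqnorm linear0 mul0r linear0.
Qed.

(** Up to the factor [c], [x] is a partial isometry with initial projection [y]. *)
Lemma bounded_projection c x y : st x * x = c *: (st y * y) -> 0 <= c ->
  st y = y -> y * y = y -> bounded x.
Proof.
move=> xy c0 sy yy; exists c => z.
have -> : sqnorm (x * z) = c * phi (st z * (y * y) * z).
  rewrite /sqnorm adjM mulrA -(mulrA _ (st x)) xy sy.
  by rewrite -scalerAr -scalerAl linearZ.
rewrite ler_wpM2l// yy -subr_ge0.
have -> : sqnorm z - phi (st z * y * z) = phi (st z * (1 - y) * z).
  by rewrite mulrBr mulr1 mulrBl linearB.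
have -> : 1 - y = st (1 - y) * (1 - y).
  by rewrite linearB/= adj1 sy mulrBl mul1r mulrBr mulr1 yy subrr subr0.
exact: pos_gram.
Qed.

(** The value of the bound comes from the inequality
[2 * phi (st y * x * y) <= sqnorm y + sqnorm (x * y)]. *)
Lemma bounded_between x : selfadj D x -> bounded x ->
  exists2 K, 0 <= K & forall M, K <= M -> between D (- M) M x.
Proof.
move=> sx [c hc]; exists ((1 + `|c|) / 2); first by rewrite divr_ge0// addr_ge0.
move=> M hM.
have main e : e * e = 1 -> pos D (M%:A - e *: x).
  move=> e1 y; have := sqnorm_ge0 (y - e *: (x * y)).
  rewrite sqnormD -scaleNr sqnormZ -scalerAr linearZ/= sqrrN expr2 e1 mul1r.
  have := hc y; have := sqnorm_ge0 y.
  have -> : phi (st y * (M%:A - e *: x) * y) = M * sqnorm y - e * phi (st y * (x * y)).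
    rewrite mulrBr mulrBl linearB/= -!scalerAr mulr1 -!scalerAl !linearZ/=.
    by rewrite -(mulrA (st y)).
  move: (phi (st y * (x * y))) (sqnorm y) (sqnorm (x * y)) => a b d b0 hd h.
  have h1 : c * b <= `|c| * b by rewrite ler_wpM2r// ler_norm.
  have h2 : (1 + `|c|) * b <= 2 * M * b by rewrite ler_wpM2r//; lra.
  lra.
split => //.
  have := main (-1); rewrite mulrNN mulr1 => /(_ erefl).
  by rewrite scaleN1r opprK scaleNr opprK addrC.
by have := main 1 (mulr1 _); rewrite scale1r.
Qed.

End Bounded.

Section GroupAlgebraBounded.
Variables (R : realType) (W : groupType) (n : nat).
Local Notation C := R[i].
Local Notation D := (@galg_tracial R W n).

Lemma galg_decomposition (x : galg R W n) (X : {fset W}) :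
  (forall g, g \notin X -> x g = 0) ->
  x = \sum_(g <- X) \sum_i \sum_j galg_tens (x g i j *: delta_mx i j) g.
Proof.
move=> hX; apply: galgP => h; rewrite gval_sum.
transitivity (\sum_(g <- X) if g == h then x h else 0).
  have [hXh|hXh] := boolP (h \in X).
    by rewrite -big_mkcond -big_filter filter_pred1_uniq ?fset_uniq// big_seq1.
  rewrite (hX _ hXh) big1_seq// => g _; by case: ifP.
apply: eq_bigr => g _; rewrite gval_sum.
under eq_bigr do rewrite gval_sum.
case: (altP (g =P h)) => [->|gh].
  rewrite {1}(matrix_sum_delta (x h)); apply: eq_bigr => i _; apply: eq_bigr => j _.
  by rewrite /= /tens_mx eqxx.
rewrite big1// => i _; rewrite big1// => j _.
by rewrite /= /tens_mx eq_sym (negbTE gh).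
Qed.

(** The algebra is spanned by matrix units placed at single group elements, and
these are multiples of partial isometries. *)
Lemma galg_bounded (x : galg R W n) : bounded D x.
Proof.
have [X hX] := gvalP x; rewrite (galg_decomposition hX).
apply: bounded_sum => g; apply: bounded_sum => i; apply: bounded_sum => j.
set c := x g i j.
pose P : galg R W n := galg_tens (delta_mx j j) 1%g.
apply: (@bounded_projection _ _ _ (complex.Re `|c| ^+ 2) _ P).
- apply: galgP => h; rewrite gvalM gvalZ gvalM !conv_tensr /=.
  rewrite /star_mx /tens_mx !invgM !invgK ?invg1 mul1g.
  have -> : (g * h^-1 == g)%g = (h == 1%g) by rewrite -{2}[g]mulg1 (inj_eq (mulgI g)) invg_eq1.
  rewrite invg_eq1; case: ifP => _; last by rewrite adj_mx0 !mul0mx scaler0.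
  have adjd k : adj_mx (delta_mx k j : 'M[C]_n.+1) = delta_mx j k.
    by apply/matrixP => u v; rewrite !mxE andbC rmorph_nat.
  rewrite adj_mxZ !adjd -scalemxAl -scalemxAr !mul_delta_mx scalerA; congr (_ *: _).
  rewrite -Re_conjM; case: c => a b.
  by apply/eqP; rewrite eq_complex /=; apply/andP; split; apply/eqP; ring.
- exact: sqr_ge0.
- apply: galgP => h; rewrite /= /star_mx /tens_mx invg_eq1.
  case: ifP => _; last exact: adj_mx0.
  by apply/matrixP => k l; rewrite !mxE andbC rmorph_nat.
- apply: galgP => h; rewrite gvalM conv_tensl invg1 mul1g /= /tens_mx.
  by case: ifP => _; rewrite ?mulmx0// mul_delta_mx.
Qed.

End GroupAlgebraBounded.

(** * Square-summable vectors and operator norms *)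

Section L2.
Variables (R : realType) (W : groupType) (n : nat).
Local Notation C := R[i].
Local Notation vect := (W -> 'cV[C]_n).
Implicit Types (f : vect) (X : {fset W}) (c K : R).

Definition colnorm f w : R := \sum_(i < n) complex.Re `|f w i ord0| ^+ 2.
Definition sumnorm f X : R := \sum_(w <- X) colnorm f w.

Lemma colnorm_ge0 f w : 0 <= colnorm f w.
Proof. by apply: sumr_ge0 => i _; exact: sqr_ge0. Qed.

Lemma sumnorm_ge0 f X : 0 <= sumnorm f X.
Proof. by apply: sumr_ge0 => w _; exact: colnorm_ge0. Qed.

(** Sums over finite sets of group elements replace the extended-real norms. *)
Lemma l2norm_leP c f : 0 <= c ->
  (l2norm f <= c%:E)%E <-> forall X, sumnorm f X <= c ^+ 2.
Proof.
move=> c0; rewrite /l2norm.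
have e0 : (0 <= \esum_(w in [set: W]%classic) (\sum_(i < n) complex.Re `|f w i ord0| ^+ 2)%:E)%E.
  by apply: esum_ge0 => w _; rewrite lee_fin; exact: colnorm_ge0.
have step1 : ((\esum_(w in [set: W]%classic) (\sum_(i < n) complex.Re `|f w i ord0| ^+ 2)%:E) `^ 2^-1 <= c%:E)%E
    <-> (\esum_(w in [set: W]%classic) (\sum_(i < n) complex.Re `|f w i ord0| ^+ 2)%:E <= (c ^+ 2)%:E)%E.
  move: e0; case: (esum _ _) => [r||] //; last first.
    by move=> _; rewrite poweRyr// !leye_eq.
  rewrite poweR_EFin !lee_fin => r0; rewrite powR12_sqrt//; split=> h.
    by rewrite -(sqr_sqrtr r0) lerXn2r ?nnegrE ?sqrtr_ge0.
  by rewrite -[leRHS](ger0_norm c0) -sqrtr_sqr ler_wsqrtr.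
split.
  move/step1 => h X; rewrite -lee_fin; apply: le_trans h.
  apply: esum_ge; exists [set` X]%classic; first by split=> //.
  by rewrite -fsbig_seq ?fset_uniq// sumEFin.
move=> h; apply/step1; rewrite /esum ge_ereal_sup// => _ [X [fX _] <-].
by rewrite fsbig_finite// sumEFin lee_fin; exact: h.
Qed.

Lemma op_norm_leP c (T : vect -> vect) : 0 <= c ->
  (op_norm T <= c%:E)%E <->
  forall f, (forall X, sumnorm f X <= 1) -> forall X, sumnorm (T f) X <= c ^+ 2.
Proof.
move=> c0; rewrite /op_norm; split.
  move=> h f f1; apply/(l2norm_leP _ c0); apply: le_trans h; apply: ereal_sup_ubound.
  exists f => //=; apply/(l2norm_leP _ ler01) => X; rewrite expr1n; exact: f1.
move=> h; rewrite ge_ereal_sup// => _ [f /= f1 <-]; apply/l2norm_leP => // X; apply: h => Y.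
by move/(l2norm_leP _ ler01) : f1 => /(_ Y); rewrite expr1n.
Qed.

Lemma op_norm_ge0 (T : vect -> vect) : (0 <= op_norm T)%E.
Proof.
apply: le_trans (ereal_sup_ubound _); last first.
  by exists 0 => //=; apply/(l2norm_leP _ ler01) => X; rewrite /sumnorm big1 ?expr1n// => w _;
     rewrite /colnorm big1// => i _; rewrite mxE normr0 expr0n.
exact: poweR_ge0.
Qed.

Lemma l2norm_lty f : (l2norm f < +oo)%E ->
  exists2 K, 0 <= K & forall X, sumnorm f X <= K.
Proof.
move=> h; have f0 : (0 <= l2norm f)%E by exact: poweR_ge0.
have fE : l2norm f = (fine (l2norm f))%:E by rewrite fineK// ge0_fin_numE.
have c0 : 0 <= fine (l2norm f) by rewrite fine_ge0.
exists (fine (l2norm f) ^+ 2); first exact: sqr_ge0.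
by apply/(l2norm_leP _ c0); rewrite -fE.
Qed.

Lemma sumnormZ (r : R) f X : sumnorm ((r%:C)%C *: f) X = r ^+ 2 * sumnorm f X.
Proof.
rewrite /sumnorm mulr_sumr; apply: eq_bigr => w _; rewrite /colnorm mulr_sumr.
apply: eq_bigr => i _; rewrite !mxE !nsqE; case: (f w i ord0) => a b /=; ring.
Qed.

Lemma op_norm_sumnorm c (T : vect -> vect) f K : 0 <= c -> 0 <= K ->
  (forall (r : R) f, T ((r%:C)%C *: f) = (r%:C)%C *: T f) ->
  (op_norm T <= c%:E)%E -> (forall X, sumnorm f X <= K) ->
  forall X, sumnorm (T f) X <= c ^+ 2 * K.
Proof.
move=> c0 K0 TZ /(op_norm_leP _ c0) Tc fK X.
(* [f] is rescaled by the square root of [K + d], since [K] may vanish. *)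
apply/ler_addgt0Pr => e e0; pose d := e / (c ^+ 2 + 1).
have c10 : 0 < c ^+ 2 + 1 by rewrite ltr_wpDl ?sqr_ge0.
have d0 : 0 < d by rewrite divr_gt0.
have Kd : 0 < K + d by rewrite ltr_wpDl.
have s0 : 0 < Num.sqrt (K + d) by rewrite sqrtr_gt0.
have s2 : Num.sqrt (K + d) ^+ 2 = K + d by rewrite sqr_sqrtr// ltW.
have := Tc (((Num.sqrt (K + d))^-1%:C)%C *: f).
rewrite TZ => /(_ _ X); rewrite sumnormZ exprVn s2 => h.
have {}h : (K + d)^-1 * sumnorm (T f) X <= c ^+ 2.
  apply: h => Y; rewrite sumnormZ exprVn s2 mulrC ler_pdivrMr// mul1r.
  by apply: le_trans (fK Y) _; rewrite lerDl ltW.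
rewrite mulrC ler_pdivrMr// in h; apply: (le_trans h).
rewrite mulrDr lerD2l /d mulrA ler_pdivrMr// mulrC ler_pM2l// lerDl//.
Qed.

End L2.

(** * Convolution operators on square-summable vectors *)

Section ConvolutionOperators.
Variables (R : realType) (W : groupType) (n : nat).
Local Notation C := R[i].
Local Notation D := (@galg_tracial R W n).
Local Notation galg := (galg R W n).
Local Notation vect := (W -> 'cV[C]_n.+1).
Implicit Types (f : vect) (X : {fset W}) (b y : galg).

Lemma fro_first_col (v : 'cV[C]_n.+1) :
  fro (v *m (delta_mx ord0 ord0 : 'M[C]_(1, n.+1))) = \sum_i complex.Re `|v i ord0| ^+ 2.
Proof.
apply: eq_bigr => i _; rewrite (bigD1 ord0)//= big1 ?addr0.
  by rewrite mxE big_ord1 mxE !eqxx mulr1.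
move=> j j0; rewrite mxE big_ord1 mxE (negbTE j0) andbF mulr0n mulr0 Normc.normc0.
by rewrite /= expr0n.
Qed.

Lemma big_fset_ge0_le (T : choiceType) (F : T -> R) (X Y : {fset T}) :
  (forall w, 0 <= F w) -> (X `<=` Y)%fset -> \sum_(w <- X) F w <= \sum_(w <- Y) F w.
Proof.
move=> F0 XY; rewrite (big_fsetID _ (mem X) Y)/=.
have -> : [fset x in Y | x \in X]%fset = X.
  apply/fsetP => w; rewrite !inE /=; case wX : (w \in X); rewrite ?andbF// andbT.
  exact: (fsubsetP XY).
by rewrite lerDl sumr_ge0.
Qed.

Lemma sqnorm_fro y X : (forall g, g \notin X -> y g = 0) ->
  sqnorm D y = \sum_(g <- X) fro (y g).
Proof. exact: galg_tr_gram. Qed.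

Lemma sqnorm_ge_sum y X : \sum_(g <- X) fro (y g) <= sqnorm D y.
Proof.
have [Y hY] := gvalP y.
have hXY g : g \notin (X `|` Y)%fset -> y g = 0.
  by rewrite inE negb_or => /andP[_]; exact: hY.
rewrite (sqnorm_fro hXY); apply: big_fset_ge0_le; last exact: fsubsetUl.
by move=> w; exact: fro_ge0.
Qed.

(** The norm of a convolution operator is already attained on finitely supported
vectors: a finite part of [conv b f] only depends on a finite part of [f]. Such a
part of [f] is the first column of an element of the algebra. *)
Lemma conv_sumnorm b c f K : (forall y, sqnorm D (b * y) <= c ^+ 2 * sqnorm D y) ->
  (forall X, sumnorm f X <= K) -> forall X, sumnorm (conv b f) X <= c ^+ 2 * K.
Proof.
move=> hb fK X; have [S hS] := gvalP b.
pose Y := [fset (g^-1 * h)%g | g in S, h in X]%fset.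
pose f' h : 'M[C]_n.+1 := if h \in Y then f h *m delta_mx ord0 ord0 else 0.
have ff' : finsupp f' by exists Y => g; rewrite /f' => /negbTE ->.
pose y := Galg ff'.
have c20 : 0 <= c ^+ 2 by exact: sqr_ge0.
apply: (@le_trans _ _ (\sum_(h <- X) fro ((b * y) h))).
  rewrite /sumnorm !big_seq le_eqVlt; apply/orP; left; apply/eqP.
  apply: eq_bigr => h hX; rewrite /colnorm -fro_first_col; congr fro.
  rewrite gvalM !(convE _ _ hS) mulmx_suml !big_seq; apply: eq_bigr => g gS.
  rewrite /= /f' ifT ?mulmxA//; apply/imfset2P.
  by exists g => //; exists h.
apply: (le_trans (sqnorm_ge_sum _ _)); apply: (le_trans (hb y)).
rewrite ler_wpM2l// (@sqnorm_fro _ Y); last first.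
  by move=> g; rewrite /= /f' => /negbTE ->.
apply: le_trans (fK Y); rewrite /sumnorm big_seq [leRHS]big_seq.
apply: ler_sum => h hY; rewrite /= /f' hY /colnorm fro_first_col.
exact: lexx.
Qed.

Lemma conv_real_linear b (r : R) f : conv b ((r%:C)%C *: f) = (r%:C)%C *: conv b f.
Proof. by have := convZr (r%:C)%C f (gvalP b). Qed.

(** Conversely to [conv_sumnorm], the columns of an element of the algebra are
square-summable vectors. *)
Lemma op_norm_conv b c : 0 <= c -> (op_norm (conv b : vect -> vect) <= c%:E)%E <->
  forall y, sqnorm D (b * y) <= c ^+ 2 * sqnorm D y.
Proof.
move=> c0; split; last first.
  move=> h; apply/op_norm_leP => // f f1 X.
  by have := conv_sumnorm h f1 X; rewrite mulr1.
move=> h y; have [Y hY] := gvalP y.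
have colE z X j : \sum_(g <- X) colnorm (fun w => col j (gval z w)) g =
   \sum_(g <- X) \sum_i complex.Re `|gval z g i j| ^+ 2.
  by apply: eq_bigr => g _; apply: eq_bigr => i _; rewrite mxE.
have froE z X : \sum_(g <- X) fro (gval z g) =
    \sum_j sumnorm (fun w => col j (gval z w)) X.
  rewrite /sumnorm; under [RHS]eq_bigr do rewrite colE.
  rewrite [RHS]exchange_big/=; apply: eq_bigr => g _; exact: exchange_big.
have [Z hZ] := gvalP (b * y).
rewrite (sqnorm_fro hZ) (sqnorm_fro hY) !froE mulr_sumr.
apply: ler_sum => j _.
have cj : (fun w => col j ((b * y) w)) = conv b (fun w => col j (y w)).
  apply/funext => w; rewrite gvalM /conv.
  rewrite (fsum_raddf (col j)); last by apply: finsupp_mull; exact: gvalP.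
  by apply: eq_fsbigr => g _; rewrite /= !matrix.colE mulmxA.
rewrite cj; apply: (op_norm_sumnorm c0 _ _ h); first exact: sumnorm_ge0.
  by move=> r f; exact: conv_real_linear.
move=> X; apply: (@le_trans _ _ (sumnorm (fun w => col j (y w)) (X `|` Y)%fset)).
  by apply: big_fset_ge0_le; [exact: colnorm_ge0 | exact: fsubsetUl].
rewrite /sumnorm le_eqVlt; apply/orP; left; apply/eqP/esym.
apply: big_fset_incl; first exact: fsubsetUr.
move=> w _ /hY yw; rewrite /colnorm big1// => i _.
by rewrite yw !mxE normr0 expr0n.
Qed.

End ConvolutionOperators.

(** * Polynomials in convolution operators *)

Section CalculusBounds.
Variables (R : realType) (A : algType R) (D : tracial A).
Local Notation st := (adj D).
Local Notation phi := (trc D).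
Implicit Types (a x y z : A) (P : {poly R}).

Lemma between_widen m M m' M' a : m' <= m -> M <= M' -> between D m M a -> between D m' M' a.
Proof.
move=> mm' MM' [sa am aM]; split => //.
  have -> : a - m'%:A = (a - m%:A) + (m - m')%:A by rewrite scalerBl addrA subrK.
  by apply: posD am _; apply: posZ (pos1 D); rewrite subr_ge0.
have -> : M'%:A - a = (M%:A - a) + (M' - M)%:A.
  by rewrite scalerBl [RHS]addrC addrA subrK.
by apply: posD aM _; apply: posZ (pos1 D); rewrite subr_ge0.
Qed.

Lemma ev_sqnorm m M a P e y : m < M -> between D m M a ->
  (forall t, m <= t <= M -> `|P.[t]| <= e) -> sqnorm D (ev a P * y) <= e ^+ 2 * sqnorm D y.
Proof.
move=> mM ba Pe; have sa : selfadj D a by case: ba.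
have := @pos_ev _ _ D _ _ mM a ((e ^+ 2)%:P - P * P) ba _ y.
rewrite evB evM evC mulrBr mulrBl linearB/= -scalerAr mulr1 -scalerAl linearZ/=.
rewrite /sqnorm adjM (selfadj_ev P sa) !mulrA subr_ge0; apply => t tI.
rewrite hornerD hornerN hornerM hornerC subr_ge0 -expr2 -(real_normK (num_real P.[t])).
by rewrite lerXn2r ?nnegrE ?Pe// (le_trans _ (Pe _ tI)).
Qed.

(** A selfadjoint element lies below its norm: expand the square of
[M *: y - a * y] for [M] slightly above [c]. *)
Lemma pos_sub_of_sqnorm a c : selfadj D a -> 0 <= c ->
  (forall y, sqnorm D (a * y) <= c ^+ 2 * sqnorm D y) -> pos D (c%:A - a).
Proof.
move=> sa c0 h; apply: pos_lim => e e0 y; set M := c + e.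
have M0 : 0 < M by rewrite /M; lra.
have -> : c%:A - a + e%:A = M%:A - a by rewrite scalerDl addrAC.
have hM : sqnorm D (a * y) <= M ^+ 2 * sqnorm D y.
  apply: (le_trans (h y)); rewrite ler_wpM2r ?sqnorm_ge0// lerXn2r ?nnegrE ?(ltW M0)//.
  by rewrite /M lerDl ltW.
have := sqnorm_ge0 D (M *: y - a * y).
have -> : sqnorm D (M *: y - a * y) =
    M ^+ 2 * sqnorm D y - 2 * M * phi (st y * (a * y)) + sqnorm D (a * y).
  rewrite sqnormD -(scaleN1r (a * y)) !sqnormZ linearZ/= -scalerAr.
  by rewrite -(scalerAl M (st y)) !linearZ/= [X in _ = _ + X + _]/GRing.scale/=; ring.
have -> : phi (st y * (M%:A - a) * y) = M * sqnorm D y - phi (st y * (a * y)).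
  rewrite mulrBr mulrBl linearB/= -scalerAr mulr1 -scalerAl linearZ/=.
  by rewrite -(mulrA (st y)).
move: (phi (st y * (a * y))) (sqnorm D y) (sqnorm D (a * y)) hM => p q s hM h1.
rewrite -(ler_pM2l M0) mulr0; nra.
Qed.

(** The interval may be reduced to a point, so the scalar bound is first
extended slightly to the right by continuity. *)
Lemma ev_bound_closed m M a P z e : m <= M -> between D m M a -> 0 < e ->
  (forall t, m <= t <= M -> `|P.[t]| <= e) -> `|phi (ev a P * z)| <= e * sqmean D z.
Proof.
move=> mM ba e0 Pe; have s0 := sqmean_ge0 D z.
apply: (@le_of_forall_eps _ (2 * sqmean D z)); first by rewrite mulr_ge0.
move=> h h0; have [K K0 PK] := tame_poly M (M + 1) P h0.
pose d := h / (K + h + 1).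
have Kh : 0 < K + h + 1 by lra.
have d0 : 0 < d by rewrite divr_gt0.
have d1 : d <= 1 by rewrite ler_pdivrMr// mul1r; lra.
have Kd : K * d <= h.
  by rewrite mulrA ler_pdivrMr// mulrC ler_pM2l//; lra.
have mMd : m < M + d by lra.
have bd : between D m (M + d) a by apply: between_widen ba => //; lra.
have -> : e * sqmean D z + h * (2 * sqmean D z) = (e + 2 * h) * sqmean D z by ring.
apply: (ev_bound mMd _ bd); first by lra.
move=> t /andP[mt tMd]; have [tM|Mt] := leP t M.
  by apply: (le_trans (Pe t _)); rewrite ?mt//; lra.
have h1 : `|P.[M]| <= e by apply: Pe; rewrite mM lexx.
have h2 : `|P.[t] - P.[M]| <= h + K * (t - M) ^+ 2 by apply: PK; apply/andP; split; lra.
have h3 : K * (t - M) ^+ 2 <= K * d.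
  rewrite ler_wpM2l// expr2; apply: (@le_trans _ _ (d * 1)); last by rewrite mulr1.
  by apply: ler_pM; lra.
have -> : P.[t] = (P.[t] - P.[M]) + P.[M] by ring.
by apply: (le_trans (ler_normD _ _)); lra.
Qed.

End CalculusBounds.

Section Operators.
Variables (R : realType) (W : groupType) (n : nat).
Local Notation C := R[i].
Local Notation D := (@galg_tracial R W n).
Local Notation galg := (galg R W n).
Local Notation vect := (W -> 'cV[C]_n.+1).
Implicit Types (f : vect) (X : {fset W}) (a b y : galg) (P : {poly R}).

Lemma uniform_cvgP (P : nat -> {poly R}) (g : R -> R) m M :
  {uniform [set` `[m, M]], (fun k => horner (P k)) @ \oo --> g} <->
  forall e, 0 < e -> exists N, forall k, (N <= k)%N -> near_on m M e (P k) g.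
Proof.
split.
  move=> h e e0.
  have : nbhs (g : {uniform` [set` `[m, M]] -> R})
     [set h' : R -> R | forall t, m <= t <= M -> `|h' t - g t| <= e]%classic.
    apply/uniform_nbhs; exists [set xy : R * R | `|xy.1 - xy.2| < e]%classic; split.
      exact: entourage_ball (PosNum e0).
    move=> h' /= hh t tI; rewrite distrC ltW//; apply: hh.
    by rewrite /= in_itv.
  by move/h => [N _ HN]; exists N => k Nk; exact: HN.
move=> h Q /uniform_nbhs[E [entE EQ]].
have [e /= e0 eE] : exists2 e, 0 < e & forall x y : R, `|x - y| < e -> E (x, y).
  have := entE; rewrite -entourage_ballE => -[e /= e0 he]; exists e => // x y xy; exact: he.
have e20 : 0 < e / 2 by lra.
have [N HN] := h _ e20; exists N => // k Nk; apply: EQ => t /=; rewrite in_itv/= => tI.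
apply: eE; rewrite distrC; apply: le_lt_trans (HN k Nk t tI) _; lra.
Qed.

Lemma conv_iter a k f : iter k (conv a) f = conv (a ^+ k) f.
Proof.
elim: k => [|k IH] /=.
  by apply/funext => w; rewrite conv_tensl mul1mx invg1 mul1g.
by rewrite IH exprS gvalM convA//; exact: gvalP.
Qed.

Lemma poly_op_conv P a : poly_op P (conv a : vect -> vect) = conv (ev a P).
Proof.
apply/funext => f; rewrite /poly_op -[in RHS](coefK P) poly_def ev_sum.
have : forall k : nat, ev a 'X^k = a ^+ k by move=> k; rewrite /ev rmorphXn/= horner_algX.
move: (size P) => m evX; elim: m => [|m IH].
  rewrite !big_ord0; apply/funext => w; rewrite /conv fsbig1// => g _.
  by rewrite mul0mx.
rewrite !big_ord_recr/= IH evZ evX conv_iter.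
rewrite [RHS](convDl _ (gvalP _) (gvalP _)); apply/funext => w /=.
by congr (_ + _); rewrite -[RHS]/(conv _ _ _) [in RHS](convZl _ _ (gvalP (a ^+ m))).
Qed.

End Operators.

(** * Norm limits of convolution operators *)

Section Existence.
Variables (R : realType) (W : groupType) (n : nat).
Local Notation C := R[i].
Local Notation D := (@galg_tracial R W n).
Local Notation galg := (galg R W n).
Local Notation vect := (W -> 'cV[C]_n.+1).
Implicit Types (f : vect) (X : {fset W}) (a b y : galg) (P : {poly R}).

Lemma op_norm_conv_fin a : exists2 c, 0 <= c & op_norm (conv a : vect -> vect) = c%:E.
Proof.
have [c hc] := galg_bounded a; pose d := Num.sqrt `|c|.
have d0 : 0 <= d by exact: sqrtr_ge0.
have h : (op_norm (conv a : vect -> vect) <= d%:E)%E.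
  apply/op_norm_conv => // y; rewrite sqr_sqrtr//; apply: (le_trans (hc y)).
  by rewrite ler_wpM2r ?sqnorm_ge0// ler_norm.
have h0 := op_norm_ge0 (conv a : vect -> vect).
exists (fine (op_norm (conv a : vect -> vect))); first by rewrite fine_ge0.
by rewrite fineK// ge0_fin_numE//; apply: le_lt_trans h (ltry _).
Qed.

(** The interval on which powers of operators are defined does contain the
spectrum. *)
Lemma between_op_norm a c : selfadj D a -> pos D a -> 0 <= c ->
  op_norm (conv a : vect -> vect) = c%:E -> between D 0 c a.
Proof.
move=> sa pa c0 ac; split => //; first by rewrite scale0r subr0.
by apply: pos_sub_of_sqnorm => //; apply/op_norm_conv => //; rewrite ac.
Qed.

Lemma convB a b f : conv a f - conv b f = conv (a - b) f.
Proof.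
rewrite [RHS](convDl _ (gvalP a) (gvalP (- b))).
have -> : gval (- b) = (fun g => -1 *: b g) by apply/funext => g; rewrite scaleN1r.
by rewrite (convZl _ _ (gvalP b)); apply/funext => w /=; rewrite scaleN1r.
Qed.

Lemma sumnorm_entry f w i : (complex.Re (f w i ord0)) ^+ 2 + (complex.Im (f w i ord0)) ^+ 2
  <= sumnorm f [fset w]%fset.
Proof.
rewrite /sumnorm big_seq_fset1 /colnorm (bigD1 i)//= -nsqE lerDl.
by apply: sumr_ge0 => j _; exact: sqr_ge0.
Qed.

Section Limit.
Variables (a : galg) (P : nat -> {poly R}) (m M : R).
Hypothesis mM : m < M.
Hypothesis ba : between D m M a.
Hypothesis Pcauchy : forall e, 0 < e -> exists N, forall k l, (N <= k)%N -> (N <= l)%N ->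
  forall t, m <= t <= M -> `|(P k - P l).[t]| <= e.
Local Notation S k := (conv (ev a (P k)) : vect -> vect).

Lemma sumnorm_diff e : 0 < e -> exists N, forall k l, (N <= k)%N -> (N <= l)%N ->
  forall f K, (forall X, sumnorm f X <= K) -> forall X, sumnorm (S k f - S l f) X <= e ^+ 2 * K.
Proof.
move=> /Pcauchy[N HN]; exists N => k l Nk Nl f K fK X.
rewrite convB -evB; apply: conv_sumnorm => // y.
by apply: (ev_sqnorm y mM ba) => t tI; exact: HN.
Qed.

(** The limit is taken entry by entry; [limit_op_sumnorm] then shows that it is also
a limit in operator norm. *)
Definition limit_op : vect -> vect := fun f w => \col_i
  Complex (lim (complex.Re (S k f w i ord0) @[k --> \oo]))
          (lim (complex.Im (S k f w i ord0) @[k --> \oo])).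

Lemma limit_op_cvg f K w i : (forall X, sumnorm f X <= K) ->
  complex.Re (S k f w i ord0) @[k --> \oo] --> complex.Re (limit_op f w i ord0) /\
  complex.Im (S k f w i ord0) @[k --> \oo] --> complex.Im (limit_op f w i ord0).
Proof.
move=> fK; rewrite mxE /=.
have K0 : 0 <= K by apply: le_trans (fK fset0); exact: sumnorm_ge0.
have s0 : 0 < Num.sqrt K + 1 by rewrite ltr_wpDl// sqrtr_ge0.
have main e : 0 < e -> exists N, forall k l, (N <= k)%N -> (N <= l)%N ->
    `|complex.Re (S k f w i ord0) - complex.Re (S l f w i ord0)| <= e /\
    `|complex.Im (S k f w i ord0) - complex.Im (S l f w i ord0)| <= e.
  move=> e0; have e'0 : 0 < e / (Num.sqrt K + 1) by rewrite divr_gt0.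
  have [N HN] := sumnorm_diff e'0; exists N => k l Nk Nl.
  have h := HN k l Nk Nl f K fK [fset w]%fset.
  have := le_trans (sumnorm_entry _ _ i) h; rewrite !mxE => {}h.
  have ee : (e / (Num.sqrt K + 1)) ^+ 2 * K <= e ^+ 2.
    rewrite -{2}(sqr_sqrtr K0) -exprMn lerXn2r ?nnegrE ?mulr_ge0 ?sqrtr_ge0 ?(ltW e0) ?(ltW e'0)//.
    by rewrite mulrAC ler_pdivrMr// ler_wpM2l ?(ltW e0)// lerDl.
  have {}h := le_trans h ee.
  move: h; rewrite ReB ImB => h.
  have sq (u v : R) : u ^+ 2 + v ^+ 2 <= e ^+ 2 -> `|u| <= e.
    move=> huv; rewrite -(ler_pXn2r (n := 2))// ?nnegrE ?(ltW e0)//.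
    by rewrite real_normK ?num_real//; have := sqr_ge0 v; lra.
  by split; [apply: sq h | apply: sq; rewrite addrC; exact: h].
split.
  apply: cauchy_cvg; apply: cauchy_exP => e e0; have e20 : 0 < e / 2 by lra.
  have [N HN] := main _ e20; exists (complex.Re (S N f w i ord0)); exists N => // k /= Nk.
  by rewrite /ball/=; apply: le_lt_trans (HN N k (leqnn N) Nk).1 _; lra.
apply: cauchy_cvg; apply: cauchy_exP => e e0; have e20 : 0 < e / 2 by lra.
have [N HN] := main _ e20; exists (complex.Im (S N f w i ord0)); exists N => // k /= Nk.
by rewrite /ball/=; apply: le_lt_trans (HN N k (leqnn N) Nk).2 _; lra.
Qed.

(** Finite partial sums of squared entries pass to the limit. *)
Lemma limit_op_sumnorm (T : vect -> vect) f K L X : (forall X, sumnorm f X <= K) ->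
  (\forall k \near \oo, sumnorm (T f - S k f) X <= L) -> sumnorm (T f - limit_op f) X <= L.
Proof.
move=> fK; apply: cvgr_to_le.
rewrite /sumnorm; apply: cvg_big => [|w _]; first exact: add_continuous.
apply: cvg_big => [|i _]; first exact: add_continuous.
rewrite nsqE; under eq_fun do rewrite nsqE.
have [cR cI] := limit_op_cvg w i fK.
have subE (u v : vect) : (u - v) w i ord0 = u w i ord0 - v w i ord0 by rewrite !mxE.
rewrite subE ReB ImB; under eq_fun do rewrite subE ReB ImB.
apply: cvgD; rewrite expr2; under eq_fun do rewrite expr2.
  by apply: cvgM; apply: cvgB => //; exact: cvg_cst.
by apply: cvgM; apply: cvgB => //; exact: cvg_cst.
Qed.

End Limit.
End Existence.

(** * Traces of powers of convolution operators *)

Section PowerTraceFormula.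
Variables (R : realType) (W : groupType) (n : nat).
Local Notation C := R[i].
Local Notation D := (@galg_tracial R W n).
Local Notation galg := (galg R W n).
Local Notation vect := (W -> 'cV[C]_n.+1).
Implicit Types (f : vect) (X : {fset W}) (a b y : galg) (P : {poly R}).

Lemma ereal_cvg0P (u : nat -> \bar R) : (forall k, (0 <= u k)%E) ->
  (u @ \oo --> 0%E) <-> forall e, 0 < e -> exists N, forall k, (N <= k)%N -> (u k <= e%:E)%E.
Proof.
move=> u0; split.
  move=> /fine_cvgP[[N1 _ fin] /cvgrPdist_le h] e e0.
  have [N2 _ H2] := h _ e0; exists (maxn N1 N2) => k; rewrite geq_max => /andP[k1 k2].
  rewrite -(@fineK _ (u k)); last exact: fin.
  have := H2 k k2; rewrite sub0r normrN lee_fin; apply: le_trans; exact: ler_norm.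
move=> h; apply/fine_cvgP; split.
  have [N HN] := h _ ltr01; exists N => // k /= /HN hk.
  by rewrite ge0_fin_numE//; apply: le_lt_trans hk (ltry _).
apply/cvgrPdist_le => e e0; have [N HN] := h _ e0; exists N => // k /= Nk.
have fk : u k \is a fin_num by rewrite ge0_fin_numE//; apply: le_lt_trans (HN k Nk) (ltry _).
by rewrite sub0r normrN ger0_norm ?fine_ge0// -lee_fin fineK// HN.
Qed.

Lemma sumnormN f X : sumnorm (0 - f) X = sumnorm f X.
Proof.
apply: eq_bigr => w _; apply: eq_bigr => i _; rewrite !nsqE.
have -> : (0 - f) w i ord0 = - f w i ord0 by rewrite !mxE sub0r.
by case: (f w i ord0) => x y /=; ring.
Qed.

Lemma limit_op_linear a (P : nat -> {poly R}) m M (c : C) f f1 K K1 : m < M ->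
  between D m M a ->
  (forall e, 0 < e -> exists N, forall k l, (N <= k)%N -> (N <= l)%N ->
    forall t, m <= t <= M -> `|(P k - P l).[t]| <= e) ->
  (forall X, sumnorm f X <= K) -> (forall X, sumnorm f1 X <= K1) ->
  limit_op a P (c *: f + f1) = c *: limit_op a P f + limit_op a P f1.
Proof.
move=> mM ba Pc fK fK1; apply/funext => w; apply/matrixP => i j; rewrite (ord1 j).
have -> : (c *: limit_op a P f + limit_op a P f1) w i ord0 =
  c * limit_op a P f w i ord0 + limit_op a P f1 w i ord0 by rewrite !mxE.
have [cR cI] := limit_op_cvg mM ba Pc w i fK.
have [cR1 cI1] := limit_op_cvg mM ba Pc w i fK1.
have lin k : conv (ev a (P k)) (c *: f + f1) w i ord0 =
    c * conv (ev a (P k)) f w i ord0 + conv (ev a (P k)) f1 w i ord0.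
  have -> : c *: f + f1 = (fun g => (fun h => c *: f h) g + f1 g) by [].
  by rewrite (convDr _ _ (gvalP _)) (convZr _ _ (gvalP _)) !mxE.
rewrite mxE; apply/eqP; rewrite eq_complex /=.
have ReE (z z' : C) : complex.Re (c * z + z') =
    complex.Re c * complex.Re z - complex.Im c * complex.Im z + complex.Re z'.
  by case: (c) z z' => ? ? [? ?] [].
have ImE (z z' : C) : complex.Im (c * z + z') =
    complex.Re c * complex.Im z + complex.Im c * complex.Re z + complex.Im z'.
  by case: (c) z z' => ? ? [? ?] [] ? ? /=; ring.
apply/andP; split; apply/eqP; apply: cvg_lim => //.
  under eq_fun do rewrite lin ReE.
  rewrite ReE; apply: cvgD => //; apply: cvgB; apply: cvgM => //; exact: cvg_cst.
under eq_fun do rewrite lin ImE.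
rewrite ImE; apply: cvgD => //; apply: cvgD; apply: cvgM => //; exact: cvg_cst.
Qed.

(** The Bernstein polynomials of [t `^ r] form a Cauchy sequence in operator norm.
They are taken on an interval of length [c + 1], which is positive even when the
norm [c] of the operator vanishes. *)
Lemma calculus_exists a r : selfadj D a -> pos D a -> 0 <= r ->
  exists B : vect -> vect, is_calculus (fun t => t `^ r) (conv a) B.
Proof.
move=> sa pa r0; have [c c0 ac] := op_norm_conv_fin a.
have bc := between_op_norm sa pa c0 ac.
pose M := c + 1; have M0 : 0 < M by rewrite /M; lra.
have ba : between D 0 M a by apply: between_widen bc => //; rewrite /M; lra.
pose g t := t `^ r : R.
have tg : tame 0 M g.
  apply: tame_ext (tame_powR 0 M r0) => t /andP[t0 _]; by rewrite ger0_norm.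
pose P k := bern_poly 0 M k g.
have Pg e : 0 < e -> exists N, forall k, (N <= k)%N -> near_on 0 M e (P k) g.
  by move=> e0; have [N h] := weierstrass M0 tg e0; exists N.
have Pc e : 0 < e -> exists N, forall k l, (N <= k)%N -> (N <= l)%N ->
    forall t, 0 <= t <= M -> `|(P k - P l).[t]| <= e.
  move=> e0; have e20 : 0 < e / 2 by lra.
  have [N HN] := Pg _ e20; exists N => k l Nk Nl t tI.
  have := HN k Nk t tI; have := HN l Nl t tI; rewrite hornerD hornerN !ler_norml.
  by move=> /andP[? ?] /andP[? ?]; apply/andP; split; lra.
pose B : vect -> vect := limit_op a P.
exists B; split; first split.
- move=> z f f1 /l2norm_lty[K K0 fK] /l2norm_lty[K1 K10 fK1].
  exact: (limit_op_linear z M0 ba Pc fK fK1).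
- have [K K0 gK] := tame_bounded tg.
  have L0 : 0 <= K + 1 by lra.
  suff h : (op_norm B <= (K + 1)%:E)%E by apply: le_lt_trans h (ltry _).
  apply/op_norm_leP => // f f1 X; rewrite -sumnormN.
  apply: (@limit_op_sumnorm _ _ _ a P 0 M M0 ba Pc (fun=> 0) f _ _ _ f1).
  have [N HN] := Pg _ ltr01; exists N => // k /= Nk; rewrite sumnormN -[leRHS]mulr1.
  apply: conv_sumnorm f1 X => y; apply: (ev_sqnorm y M0 ba) => t tI.
  have := HN k Nk t tI; have := gK _ tI; rewrite !ler_norml.
  by move=> /andP[? ?] /andP[? ?]; apply/andP; split; lra.
exists P; split.
  rewrite ac /=; apply/uniform_cvgP => e /Pg[N HN]; exists N => k Nk t /andP[t0 tc].
  by apply: HN => //; rewrite t0 /M; lra.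
apply/ereal_cvg0P => [k|e e0]; first exact: op_norm_ge0.
have [N HN] := sumnorm_diff M0 ba Pc e0; exists N => k Nk; rewrite poly_op_conv.
apply/op_norm_leP => [|f f1 X]; first exact: ltW.
apply: (@limit_op_sumnorm _ _ _ a P 0 M M0 ba Pc (conv (ev a (P k))) f _ _ _ f1).
by exists N => // l /= Nl; have := HN k l Nk Nl f _ f1 X; rewrite mulr1.
Qed.

Definition basis_vect (i : 'I_n.+1) : vect := tens_mx (delta_mx i ord0) 1%g.

Lemma sumnorm_basis i X : sumnorm (basis_vect i) X <= 1.
Proof.
apply: (@le_trans _ _ (\sum_(w <- X) (w == 1%g)%:R)).
  apply: ler_sum => w _; rewrite /colnorm; under eq_bigr do rewrite nsqE.
  rewrite /basis_vect /tens_mx; case: (w == 1%g); last first.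
    by rewrite big1// => j _; rewrite mxE /= expr0n addr0.
  rewrite (bigD1 i)//= big1 => [|j /negbTE ji]; rewrite mxE ?eqxx ?ji/=.
    by rewrite expr0n expr1n !addr0.
  by rewrite expr0n addr0.
have [X1|X1] := boolP (1%g \in X).
  rewrite (big_fsetD1 1%g)//= eqxx big_seq big1 ?addr0// => w.
  by rewrite !inE => /andP[/negbTE ->].
rewrite big_seq big1 ?ler01// => w wX; case: eqP => // w1.
by rewrite w1 (negbTE X1) in wX.
Qed.

Lemma op_traceE (T : vect -> vect) :
  complex.Re (op_trace T) = \sum_i complex.Re (T (basis_vect i) 1%g i ord0).
Proof. exact: Re_sum. Qed.

Lemma op_trace_conv b : complex.Re (op_trace (conv b : vect -> vect)) = galg_tr b.
Proof.
rewrite op_traceE /galg_tr /mxtrace Re_sum; apply: eq_bigr => i _.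
rewrite conv_tensr invg1 mulg1 -matrix.colE mxE.
by [].
Qed.

Lemma op_trace_close (T T' : vect -> vect) e : 0 <= e -> (op_norm (T - T')%R <= e%:E)%E ->
  `|complex.Re (op_trace T) - complex.Re (op_trace T')| <= n.+1%:R * e.
Proof.
move=> e0 /(op_norm_leP _ e0) h; rewrite !op_traceE -sumrB.
apply: (le_trans (ler_norm_sum _ _ _)).
have -> : n.+1%:R * e = \sum_(i < n.+1) e by rewrite sumr_const card_ord mulr_natl.
apply: ler_sum => i _; have := h _ (sumnorm_basis i) [fset 1%g]%fset.
move=> /(le_trans (sumnorm_entry _ _ i)).
have -> : (T - T') (basis_vect i) 1%g i ord0 =
  T (basis_vect i) 1%g i ord0 - T' (basis_vect i) 1%g i ord0 by rewrite !mxE.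
move: (T _ _ _ _) (T' _ _ _ _) => [x y] [x' y'] /= hh.
rewrite -(ler_pXn2r (n := 2))// ?nnegrE//.
by rewrite real_normK ?num_real//; have := sqr_ge0 (y - y'); lra.
Qed.

(** The power defined through operator-norm limits of polynomials has the trace
that the algebraic functional calculus predicts: the trace is continuous for the
operator norm, and two polynomials near the same function on the spectrum have
nearby traces. *)
Lemma op_trace_rpow a r M : selfadj D a -> pos D a -> 0 <= r -> 0 < M ->
  between D (- M) M a ->
  complex.Re (op_trace (op_rpow r (conv a : vect -> vect))) = calc D (- M) M a (powabs r) 1.
Proof.
move=> sa pa r0 M0 ba; have mM : - M < M by rewrite gtrN.
have [c c0 ac] := op_norm_conv_fin a.
have bc := between_op_norm sa pa c0 ac.
have := calculus_exists sa pa r0 => /(@xgetPex _ (fun=> 0)).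
rewrite -/(op_rpow r (conv a : vect -> vect)); set B := op_rpow _ _ => -[_ [P [Pu PB]]].
rewrite ac /= in Pu; move/uniform_cvgP : Pu => Pu.
move/ereal_cvg0P : PB => /(_ (fun k => op_norm_ge0 _)) PB.
have tr : tame (- M) M (powabs r) by exact: tame_powR.
(* The spectrum lies in both intervals, hence in their intersection. *)
have bM : between D 0 (Num.min c M) a.
  have [_ pa0 pc] := bc; have [_ _ pM] := ba.
  have pmin : pos D ((Num.min c M)%:A - a) by have [cM|Mc] := leP c M; [exact: pc|exact: pM].
  exact: (And3 sa pa0 pmin).
have s0 := sqmean_ge0 D 1.
apply: (@eq_of_forall_eps _ (n.+1%:R + 3 * sqmean D 1)).
  by rewrite addr_ge0// mulr_ge0.
move=> e e0; have [N1 H1] := Pu _ e0; have [N2 H2] := PB _ e0.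
pose k := maxn N1 N2.
have h1 := H1 k (leq_maxl _ _); have := H2 k (leq_maxr _ _).
rewrite poly_op_conv => /(op_trace_close (ltW e0)); rewrite op_trace_conv => h2.
have [Q hQ] := approximable mM tr e0.
have h3 := calcP mM 1 ba tr e0 hQ.
have h4 : `|trc D (ev a (P k - Q) * 1)| <= 2 * e * sqmean D 1.
  apply: (ev_bound_closed _ _ bM); first by rewrite le_min c0 ltW.
    by rewrite mulr_gt0.
  move=> t /andP[t0]; rewrite le_min => /andP[tc tM].
  have := h1 t _; rewrite t0 tc => /(_ isT); have := hQ t _; rewrite tM.
  have -> : - M <= t by lra.
  move=> /(_ isT); rewrite /powabs (ger0_norm t0) hornerD hornerN !ler_norml.
  by move=> /andP[? ?] /andP[? ?]; apply/andP; split; lra.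
rewrite evB mulrBl !mulr1 linearB/= in h4; rewrite mulr1 in h3.
have {}h2 : `|trc D (ev a (P k)) - complex.Re (op_trace B)| <= n.+1%:R * e := h2.
move: h2 h3 h4; rewrite mulrDr !ler_norml => /andP[? ?] /andP[? ?] /andP[? ?].
by apply/andP; split; lra.
Qed.

End PowerTraceFormula.

(** * Spectral projections and Schatten norms *)

Section Spectral.
Variables (R : realType) (n : nat).
Local Notation C := R[i].
Local Open Scope complex_scope.
Implicit Types (A H K U E : 'M[C]_n) (d : 'I_n -> R) (phi : R -> R).

Definition real_diag d : 'M[C]_n := diag_mx (\row_i (d i)%:C).

Lemma real_diagM d d' : real_diag d *m real_diag d' = real_diag (fun i => d i * d' i).
Proof.
rewrite /real_diag mulmx_diag; congr diag_mx; apply/rowP => i.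
by rewrite !mxE -rmorphM.
Qed.

Lemma adj_real_diag d : adj_mx (real_diag d) = real_diag d.
Proof.
rewrite /adj_mx /real_diag tr_diag_mx map_diag_mx; congr diag_mx; apply/rowP => i.
by rewrite !mxE; exact: conj_real.
Qed.

Lemma trace_real_diag d : complex.Re (\tr (real_diag d)) = \sum_i d i.
Proof. by rewrite mxtrace_diag Re_sum; apply: eq_bigr => i _; rewrite mxE. Qed.

Lemma invmx_unitary_adj U : U \is unitarymx -> invmx U = adj_mx U.
Proof. by move=> Uu; rewrite invmx_unitary. Qed.

Lemma hermsymmx_adj A : adj_mx A = A -> A \is hermsymmx.
Proof. by move=> hA; apply/is_hermitianmxP; rewrite expr0 scale1r -[LHS]hA. Qed.

Lemma spectral_decomposition A : adj_mx A = A ->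
  A = invmx (spectralmx A) *m
      real_diag (fun i => complex.Re (spectral_diag A ord0 i)) *m spectralmx A.
Proof.
move=> /hermsymmx_adj hA; have /orthomx_spectralP {1}-> := hermitian_normalmx hA.
apply: (congr1 (fun B => invmx (spectralmx A) *m B *m spectralmx A)).
apply: (congr1 diag_mx); apply/rowP => i; rewrite mxE.
have /mxOverP /(_ ord0 i) := hermitian_spectral_diag_real hA.
by move/RRe_real.
Qed.

(** The functional calculus does not depend on the diagonalisation: a change of
basis between two of them only relates equal eigenvalues. *)
Lemma diagonalisation_unique phi V U k d : V \in unitmx -> U \in unitmx ->
  invmx V *m real_diag k *m V = invmx U *m real_diag d *m U ->
  invmx V *m real_diag (phi \o k) *m V = invmx U *m real_diag (phi \o d) *m U.
Proof.
move=> Vu Uu VU.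
have commphi (Q : 'M[C]_n) : real_diag k *m Q = Q *m real_diag d ->
    real_diag (phi \o k) *m Q = Q *m real_diag (phi \o d).
  move=> comm; apply/matrixP => i j; move/matrixP : comm => /(_ i j).
  rewrite /real_diag !mul_diag_mx !mul_mx_diag !mxE /=.
  have [->|Q0] := eqVneq (Q i j) 0; first by rewrite !mulr0 !mul0r.
  by rewrite [RHS]mulrC => /(mulIf Q0) /complexI ->; rewrite mulrC.
pose Q := V *m invmx U.
have comm : real_diag k *m Q = Q *m real_diag d.
  rewrite /Q; move/(congr1 (fun B => V *m B *m invmx U)) : VU.
  by rewrite !mulmxA mulmxV// mul1mx mulmxK.
have {comm} := commphi _ comm; rewrite /Q.
move: (real_diag (phi \o k)) (real_diag (phi \o d)) => K' D' KD.
transitivity (invmx V *m (K' *m (V *m invmx U)) *m U).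
  by rewrite !mulmxA -[RHS]mulmxA (mulVmx Uu) mulmx1.
by rewrite KD !mulmxA (mulVmx Vu) mul1mx.
Qed.

Lemma mx_calculusE phi A U d : adj_mx A = A -> U \in unitmx ->
  A = invmx U *m real_diag d *m U ->
  mx_calculus phi A = invmx U *m real_diag (phi \o d) *m U.
Proof.
move=> hA Uu AE; rewrite /mx_calculus.
have -> : diag_mx (map_mx (fun z : C => (phi (complex.Re z))%:C) (spectral_diag A)) =
    real_diag (phi \o (fun i => complex.Re (spectral_diag A ord0 i))).
  by congr diag_mx; apply/rowP => i; rewrite !mxE.
apply: diagonalisation_unique => //; first exact: spectral_unit.
by rewrite -AE -spectral_decomposition.
Qed.

Definition psd H := adj_mx H = H /\
  forall B : 'M[C]_n, 0 <= complex.Re (\tr (adj_mx B *m H *m B)).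

(** Taking the absolute value of a positive square root, and its [p]-th power, only
acts on the eigenvalues. *)
Lemma schatten_sqrt H U h p : adj_mx H = H -> U \in unitmx -> invmx U = adj_mx U ->
  H = invmx U *m real_diag h *m U -> (forall i, 0 <= h i) ->
  schatten p (mx_rpow 2^-1 H) = (\sum_i h i `^ (p / 2)) `^ p^-1.
Proof.
move=> hH Uunit UV HE h0.
pose s i := h i `^ 2^-1.
have KE : mx_rpow 2^-1 H = invmx U *m real_diag s *m U := mx_calculusE _ hH Uunit HE.
move KH : (mx_rpow 2^-1 H) KE => K KE.
have Ksa : adj_mx K = K.
  rewrite KE UV !adj_mxM adj_mxK adj_real_diag mulmxA; exact: erefl.
have KK : adjmx K *m K = H.
  transitivity (adj_mx U *m (real_diag s *m (U *m adj_mx U) *m real_diag s) *m U).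
    rewrite adj_mxE Ksa KE UV !mulmxA; exact: erefl.
  have ss : (fun i => s i * s i) = h.
    by apply/funext => i; rewrite /s powR12_sqrt// -expr2 sqr_sqrtr.
  rewrite -UV (mulmxV Uunit) mulmx1 real_diagM ss -HE; exact: erefl.
rewrite /schatten /mx_abs KK KH /mx_rpow (mx_calculusE _ Ksa Uunit KE).
rewrite mxtrace_mulC mulmxA (mulmxV Uunit) mul1mx trace_real_diag; congr (_ `^ _).
by apply: eq_bigr => i _; rewrite /= /s -powRrM mulrC.
Qed.

(** The eigenvalues are listed with multiplicity, so the projections [E i] have rank
one and all Schatten norms of the square root of [H] are read off from [h]. *)
Lemma psd_spectral H : psd H -> exists (h : 'I_n -> R) (E : 'I_n -> 'M[C]_n),
  [/\ (forall i, 0 <= h i) /\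
      (forall p, schatten p (mx_rpow 2^-1 H) = (\sum_i h i `^ (p / 2)) `^ p^-1),
      forall i, adj_mx (E i) = E i /\ E i *m E i = E i,
      forall i, complex.Re (\tr (E i)) = 1 /\ H *m E i = (h i)%:C *: E i,
      \sum_i E i = 1%:M & H = \sum_i (h i)%:C *: E i].
Proof.
move=> [hH H0].
have [U [h [Uunit UV HE]]] : exists U (h : 'I_n -> R),
    [/\ U \in unitmx, invmx U = adj_mx U & H = invmx U *m real_diag h *m U].
  exists (spectralmx H), (fun i => complex.Re (spectral_diag H ord0 i)); split.
  - exact: spectral_unit.
  - exact: invmx_unitary_adj (spectral_unitarymx H).
  - exact: spectral_decomposition.
have UaU : U *m adj_mx U = 1%:M by rewrite -UV (mulmxV Uunit).
have aUU : adj_mx U *m U = 1%:M by rewrite -UV (mulVmx Uunit).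
pose E i : 'M[C]_n := adj_mx U *m delta_mx i i *m U.
have adjd i : adj_mx (delta_mx i i : 'M[C]_n) = delta_mx i i.
  by apply/matrixP => u v; rewrite !mxE andbC rmorph_nat.
have Esa i : adj_mx (E i) = E i.
  rewrite /E !adj_mxM adj_mxK adjd mulmxA; exact: erefl.
have EE i : E i *m E i = E i.
  transitivity (adj_mx U *m delta_mx i i *m (U *m adj_mx U) *m delta_mx i i *m U).
    rewrite /E !mulmxA; exact: erefl.
  rewrite UaU mulmx1 -(mulmxA (adj_mx U)) mul_delta_mx; exact: erefl.
have trE i : complex.Re (\tr (E i)) = 1.
  rewrite /E mxtrace_mulC mulmxA UaU mul1mx /mxtrace (bigD1 i)//= big1.
    by rewrite mxE eqxx addr0.
  by move=> j /negbTE ji; rewrite mxE ji.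
have HEi i : H *m E i = (h i)%:C *: E i.
  transitivity (adj_mx U *m (real_diag h *m (U *m adj_mx U) *m delta_mx i i) *m U).
    rewrite HE UV /E !mulmxA; exact: erefl.
  rewrite UaU mulmx1.
  have -> : real_diag h *m delta_mx i i = (h i)%:C *: delta_mx i i.
    apply/matrixP => u v; rewrite mul_diag_mx !mxE.
    by case: (altP (u =P i)) => [->//|_]; rewrite !mulr0.
  by rewrite -scalemxAr -scalemxAl.
have E1 : \sum_i E i = 1%:M.
  by rewrite /E -mulmx_suml -mulmx_sumr -mx1_sum_delta mulmx1.
have h0 i : 0 <= h i.
  have := H0 (E i); rewrite Esa -mulmxA HEi -scalemxAr EE linearZ/= Re_realM trE mulr1.
  exact.
have HsE : H = \sum_i (h i)%:C *: E i.
  by rewrite -[LHS]mulmx1 -E1 mulmx_sumr; apply: eq_bigr => i _; exact: HEi.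
have sch p := schatten_sqrt p hH Uunit UV HE h0.
exists h, E; split; [split; [exact: h0 | exact: sch] | move=> i | move=> i | exact: E1 | exact: HsE].
  by split; [exact: Esa | exact: EE].
by split; [exact: trE | exact: HEi].
Qed.

End Spectral.

(** * Standard parabolic subgroups of Coxeter groups *)

Section ReflectionCocycle.
Variable W : groupType.
Implicit Types (x y s t : W) (l : seq W).

(** The semidirect product of [W] with the group of functions [W -> bool], on
which it acts by conjugation of the argument. The homomorphism from [W] to it that
sends each generator [s] to [refl_lift s] counts, modulo 2 and independently of
the word chosen for an element of [W], how often each reflection occurs along the
word. *)
Record cocycle := Cocycle { cfun : W -> bool; cpt : W }.
HB.instance Definition _ := gen_eqMixin cocycle.
HB.instance Definition _ := gen_choiceMixin cocycle.

Definition cmul (a b : cocycle) :=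
  Cocycle (fun x => cfun a x (+) cfun b ((cpt a)^-1 * x * cpt a)%g) (cpt a * cpt b)%g.
Definition cone := Cocycle (fun=> false) 1%g.
Definition cinv (a : cocycle) :=
  Cocycle (fun x => cfun a (cpt a * x * (cpt a)^-1)%g) (cpt a)^-1%g.

Lemma cocycleP a b : cfun a =1 cfun b -> cpt a = cpt b -> a = b.
Proof. by case: a b => f x [g y] /= /funext -> ->. Qed.

Fact cmulA : associative cmul.
Proof.
move=> a b c; apply: cocycleP => [x|] /=; last by rewrite mulgA.
by rewrite addbA invgM !mulgA.
Qed.
Fact cmul1 : left_id cone cmul.
Proof. by move=> a; apply: cocycleP => [x|] /=; rewrite ?invg1 ?mul1g ?mulg1. Qed.
Fact cmul1r : right_id cone cmul.
Proof. by move=> a; apply: cocycleP => [x|] /=; rewrite ?addbF ?mulg1. Qed.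
Fact cmulVl : left_inverse cone cinv cmul.
Proof. by move=> a; apply: cocycleP => [x|] /=; rewrite ?invgK ?addbb ?mulVg. Qed.
Fact cmulVr : right_inverse cone cinv cmul.
Proof.
move=> a; apply: cocycleP => [x|] /=; last by rewrite mulgV.
by rewrite !mulgA mulgV mul1g -mulgA mulgV mulg1 addbb.
Qed.
HB.instance Definition _ := isGroup.Build cocycle cmulA cmul1 cmul1r cmulVl cmulVr.

Definition refl_lift s : cocycle := Cocycle (fun x => x == s) s.

(** All the reflections of the dihedral group generated by [s] and [t] are listed
by the successive conjugates, and each of them twice once [(s * t) ^+ k] is 1. *)
Lemma refl_liftM_exp s t k : (s * s = 1)%g -> (t * t = 1)%g ->
  ((refl_lift s * refl_lift t) ^+ k)%g =
  Cocycle (fun x => odd (count (fun j => x == ((s * t) ^+ j * s)%g) (iota 0 k.*2)))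
    ((s * t) ^+ k)%g :> cocycle.
Proof.
move=> ss tt; have sV : (s^-1 = s)%g by apply: (@mulgI _ s); rewrite mulgV ss.
have tV : (t^-1 = t)%g by apply: (@mulgI _ t); rewrite mulgV tt.
have comm : (s * (s * t)^-1 = s * t * s)%g by rewrite invgM sV tV mulgA.
elim: k => [|k IH]; first exact: cocycleP.
rewrite expgS IH; apply: cocycleP => [x|] /=; last by rewrite expgS.
rewrite expg0 mul1g oddD oddb; rewrite oddD oddb -addbA; congr (_ (+) (_ (+) _)).
  rewrite expg1 sV; apply/eqP/eqP => [<-|->].
    by rewrite !mulgA ss mul1g -mulgA ss mulg1.
  by rewrite -!mulgA ss mulg1 mulgA ss mul1g.
congr odd; have -> : iota 2 k.*2 = [seq (2 + j)%N | j <- iota 0 k.*2] by rewrite -iotaDl.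
rewrite count_map; apply: eq_count => j /=.
rewrite add2n !expgSr.
have -> : ((s * t) ^+ j * (s * t) * (s * t) * s = (s * t) * ((s * t) ^+ j * s) * (s * t)^-1)%g.
  by rewrite -!mulgA comm !mulgA -expgS expgSr !mulgA.
move: (s * t)%g => u; move: (u ^+ j * s)%g => r.
apply/eqP/eqP => [<-|->]; first by rewrite !mulgA mulgV mul1g mulgK.
by rewrite !mulgA mulVg mul1g -mulgA mulVg mulg1.
Qed.

Fixpoint wprod l : W := if l is s :: l' then (s * wprod l')%g else 1%g.
Fixpoint reflections l : seq W :=
  if l is s :: l' then s :: [seq (s * r * s^-1)%g | r <- reflections l'] else [::].

Lemma size_reflections l : size (reflections l) = size l.
Proof. by elim: l => //= s l IH; rewrite size_map IH. Qed.

Section Deletion.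
Variable T : W -> Prop.
Hypothesis Tinv : forall t, T t -> (t * t = 1)%g.
Definition word_in l := forall t, t \in l -> T t.

Lemma word_in_cons t l : word_in (t :: l) <-> T t /\ word_in l.
Proof.
split; first by move=> h; split=> [|x xl]; apply: h; rewrite inE ?eqxx ?xl ?orbT.
by move=> [Tt Tl] x; rewrite inE => /orP[/eqP ->|/Tl].
Qed.

(** Multiplication by a reflection of the word cancels the letter from which the
reflection stems. *)
Lemma exchange l r : word_in l -> r \in reflections l ->
  exists l', [/\ word_in l', (size l' < size l)%N & wprod l' = (r * wprod l)%g].
Proof.
elim: l r => // a l IH r /word_in_cons[Ta Tl]; rewrite /= inE => /orP[/eqP ->|].
  by exists l; split; rewrite ?ltnS// mulgA Tinv// mul1g.
move=> /mapP[r0 r0l ->]; have [l' [Tl' sl' El']] := IH r0 Tl r0l.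
exists (a :: l'); split => /=; [exact/word_in_cons| by rewrite ltnS|].
by rewrite El' -!mulgA mulKg.
Qed.

(** If the reflection of a letter occurs again further on, the letters of both
occurrences cancel. *)
Lemma deletion l : word_in l -> ~~ uniq (reflections l) ->
  exists l', [/\ word_in l', (size l' < size l)%N & wprod l' = wprod l].
Proof.
elim: l => // a l IH /word_in_cons[Ta Tl] /=; rewrite negb_and => /orP[|]; last first.
  rewrite map_inj_uniq => [/(IH Tl)[l' [Tl' sl' El']]|].
    by exists (a :: l'); split; [exact/word_in_cons| rewrite /= ltnS| rewrite /= El'].
  by move=> x y /mulIg /mulgI.
rewrite negbK => /mapP[r rl ar].
have ra : r = a by apply: (@mulgI _ a); apply: (@mulIg _ a^-1%g); rewrite -ar mulgK.
rewrite ra in rl; have [l' [Tl' sl' El']] := exchange Tl rl.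
by exists l'; split => //; exact: ltnW.
Qed.

End Deletion.

Lemma coxeter_involution (S : set W) (m : W -> W -> option nat) s :
  coxeter_system S m -> S s -> (s * s = 1)%g.
Proof.
move=> [[_ m1 _] _ rel _] Ss.
by have := rel s s 1%N Ss Ss ((m1 s s Ss Ss).2 erefl); rewrite expg1.
Qed.

(** Standard parabolic subgroups contain no new generator. By the cocycle the
reflections of a word for [s] are [s] itself and others that occur an even number
of times. In a shortest word over [T] no reflection is repeated, so such a word
would consist of the single letter [s]. *)
Lemma coxeter_parabolic (S T : set W) (m : W -> W -> option nat) s l :
  coxeter_system S m -> T `<=` S -> S s -> ~ T s -> word_in T l -> wprod l <> s.
Proof.
move=> WS TS Ss Ts; have Sinv t := @coxeter_involution S m t WS.
have [_ _ rel univ] := WS.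
have [phi phiE] : exists phi : {multiplicative W -> cocycle}, forall t, S t -> phi t = refl_lift t.
  apply: univ => x y k Sx Sy mxy.
  rewrite (refl_liftM_exp _ (Sinv x Sx) (Sinv y Sy)).
  have wk : ((x * y) ^+ k = 1)%g by exact: rel mxy.
  apply: cocycleP => [z|] //=.
  rewrite -addnn iotaD count_cat oddD add0n.
  have -> : iota k k = [seq (k + j)%N | j <- iota 0 k] by rewrite -iotaDl addn0.
  rewrite count_map; set a := count _ _; set b := count _ _.
  suff -> : b = a by rewrite addbb.
  by apply: eq_count => j /=; rewrite expgnDr wk mul1g.
have phi1 : phi 1%g = 1%g.
  by apply: (@mulgI _ (phi 1%g)); rewrite -gmulfM !mulg1.
have phi_word : forall l', word_in T l' ->
    cfun (phi (wprod l')) =1 (fun x => odd (count_mem x (reflections l'))).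
  elim=> [|a l' IH] /=; first by rewrite phi1.
  move=> /word_in_cons[Ta Tl'] x; rewrite gmulfM phiE /=; last exact: TS.
  rewrite IH// oddD; congr (_ (+) _); first by rewrite eq_sym; case: (a == x).
  congr odd; rewrite count_map; apply: eq_count => r /=.
  apply/eqP/eqP => [->|<-]; by rewrite ?mulgA ?mulgV ?mulVg ?mul1g -?mulgA ?mulgV ?mulVg ?mulg1.
move: {2}(size l) (leqnn (size l)) => N; elim: N l => [|N IH] l lN Tl ls.
  have := phi_word l Tl s; rewrite ls phiE//= eqxx.
  by move: lN; rewrite leqn0 => /nilP ->.
have [u|nu] := boolP (uniq (reflections l)); last first.
  have [l' [Tl' sl' El']] := deletion (fun t Tt => Sinv t (TS t Tt)) Tl nu.
  by apply: (IH l') => //; [rewrite -ltnS; exact: leq_trans sl' lN | rewrite El'].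
have mem x : (x \in reflections l) = (x == s).
  have := phi_word l Tl x; rewrite ls phiE//= count_uniq_mem// => ->.
  by case: (x \in _).
have : size (reflections l) = 1%N.
  have /perm_size -> : perm_eq (reflections l) [:: s].
    by apply: uniq_perm => // x; rewrite mem inE.
  by [].
rewrite size_reflections; case: l Tl {lN u} mem {ls} => [|t [|]]// /word_in_cons[Tt _] mem _.
by have := mem t; rewrite /= inE eqxx => /esym/eqP ts; apply: Ts; rewrite -ts.
Qed.

End ReflectionCocycle.

(** * Moments of products and common bounds *)

Section Exchange.
Variables (R : realType) (A : algType R) (D : tracial A).
Local Notation phi := (trc D).
Implicit Types (x y : A) (P : {poly R}).

Lemma ev_intertwine x y P : x * ev (y * x) P = ev (x * y) P * x.
Proof.
elim/poly_ind: P => [|P c IH]; first by rewrite /ev !raddf0 mulr0 mul0r.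
rewrite !evD !evM !evX !evC mulrDr mulrDl mulrA IH -!mulrA; congr (_ + _).
by rewrite -scalerAr -scalerAl mulr1 mul1r.
Qed.

Lemma trc_ev_mulC x y P : phi (ev (x * y) P) = phi (ev (y * x) P).
Proof.
elim/poly_ind: P => [|P c _]; first by rewrite /ev !raddf0.
rewrite !evD !linearD !evM !evC !evX; congr (_ + _).
by rewrite mulrA -ev_intertwine trcC [RHS]trcC mulrA.
Qed.

Lemma calc_mulC (m M : R) g x y : m < M -> tame m M g -> between D m M (x * y) ->
  between D m M (y * x) -> calc D m M (x * y) g 1 = calc D m M (y * x) g 1.
Proof.
move=> mM tg bxy byx; apply: (calc_eq mM (K := sqmean D 1)) => //; first exact: sqmean_ge0.
move=> e e0; have [P Pg] := approximable mM tg e0; exists P => //.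
by rewrite mulr1 trc_ev_mulC -[ev _ _]mulr1; exact: calcP.
Qed.

(** One interval for all choices of signs and all partial sums. *)
Lemma between_combinations (I : finType) (a : I -> A) :
  (forall i, selfadj D (a i)) -> (forall i, bounded D (a i)) ->
  exists2 K, 0 <= K & forall M, K <= M -> forall c : I -> R,
    (forall i, `|c i| <= 2) -> between D (- M) M (\sum_i c i *: a i).
Proof.
move=> sa ba.
have h i : exists K, 0 <= K /\ between D (- K) K (a i).
  by have [K K0 hK] := bounded_between (sa i) (ba i); exists K; split => //; exact: hK.
have [k hk] := boolp.choice h.
have scaled i t : `|t| <= 2 -> pos D ((2 * k i)%:A - t *: a i).
  have [k0 [_ am aM]] := hk i; have p1 := pos1 D; have [t0|t0] := leP 0 t.
    rewrite ger0_norm// => t2.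
    have -> : (2 * k i)%:A - t *: a i = ((2 - t) * k i)%:A + t *: ((k i)%:A - a i).
      rewrite scalerBr scalerA addrA -scalerDl; congr (_ *: _ - _); ring.
    by apply: posD; apply: posZ => //; rewrite mulr_ge0// subr_ge0.
  rewrite ltr0_norm// => t2.
  have -> : (2 * k i)%:A - t *: a i = ((2 + t) * k i)%:A + (- t) *: (a i - (- k i)%:A).
    rewrite scalerBr scalerA [RHS]addrCA -scalerBl (scaleNr t) [RHS]addrC; congr (_ *: _ - _); ring.
  by apply: posD; apply: posZ => //; [rewrite mulr_ge0//; lra | lra].
exists (\sum_i 2 * k i).
  by apply: sumr_ge0 => i _; rewrite mulr_ge0//; case: (hk i).
move=> M KM c c2.
have side (t : I -> R) : (forall i, `|t i| <= 2) -> pos D (M%:A - \sum_i t i *: a i).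
  move=> t2; have -> : M%:A - \sum_i t i *: a i =
      (M - \sum_i 2 * k i)%:A + \sum_i ((2 * k i)%:A - t i *: a i) :> A.
    by rewrite sumrB -scaler_suml addrA -scalerDl subrK.
  apply: posD; last by apply: pos_sum => i; exact: scaled.
  by apply: posZ (pos1 D); rewrite subr_ge0.
split; last exact: side.
  by rewrite /selfadj linear_sum/=; apply: eq_bigr => i _; rewrite linearZ/= (sa i).
have := side (fun i => - c i); rewrite (eq_bigr (fun i => - (c i *: a i))); last first.
  by move=> i _; rewrite scaleNr.
rewrite sumrN opprK scaleNr opprK addrC; apply => i; by rewrite normrN.
Qed.

End Exchange.

(** * Selfadjoint dilations *)

Section Blocks.
Variables (R : realType) (W : groupType) (n : nat).
Local Notation C := R[i].
Local Notation A := (galg R W n).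
Local Notation A2 := (galg R W (n + n.+1)).
Local Notation D := (galg_tracial R W n).
Local Notation D2 := (galg_tracial R W (n + n.+1)).
Implicit Types (x y z w : A) (P : {poly R}).

Lemma finsupp_block x y z w :
  finsupp (fun g => block_mx (x g) (y g) (z g) (w g) : 'M[C]_(n.+1 + n.+1)).
Proof.
have [X1 h1] := gvalP x; have [X2 h2] := gvalP y; have [X3 h3] := gvalP z.
have [X4 h4] := gvalP w; exists (X1 `|` X2 `|` (X3 `|` X4))%fset => g.
rewrite !inE !negb_or => /andP[/andP[g1 g2] /andP[g3 g4]].
by rewrite h1// h2// h3// h4// block_mx0.
Qed.

(** The index [n + n.+1] makes the coefficients square matrices of size
[n.+1 + n.+1], up to conversion. *)
Definition blk x y z w : A2 := Galg (finsupp_block x y z w).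

Lemma fsum_block (F1 F2 F3 F4 : W -> 'M[C]_n.+1) :
  finsupp F1 -> finsupp F2 -> finsupp F3 -> finsupp F4 ->
  \sum_(g \in [set: W]) block_mx (F1 g) (F2 g) (F3 g) (F4 g) =
  block_mx (\sum_(g \in [set: W]) F1 g) (\sum_(g \in [set: W]) F2 g)
    (\sum_(g \in [set: W]) F3 g) (\sum_(g \in [set: W]) F4 g).
Proof.
move=> [X1 h1] [X2 h2] [X3 h3] [X4 h4]; pose X := (X1 `|` X2 `|` (X3 `|` X4))%fset.
have hX g : g \notin X -> [/\ F1 g = 0, F2 g = 0, F3 g = 0 & F4 g = 0].
  rewrite !inE !negb_or => /andP[/andP[g1 g2] /andP[g3 g4]].
  by rewrite h1// h2// h3// h4.
rewrite (@fsumE _ _ X) ?(@fsumE _ _ X F1) ?(@fsumE _ _ X F2) ?(@fsumE _ _ X F3) ?(@fsumE _ _ X F4).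
- elim: (X : seq W) => [|g s IH]; first by rewrite !big_nil block_mx0.
  by rewrite !big_cons IH add_block_mx.
- by move=> g /hX[].
- by move=> g /hX[].
- by move=> g /hX[].
- by move=> g /hX[].
- by move=> g /hX[-> -> -> ->]; rewrite block_mx0.
Qed.

Lemma blkM x y z w x' y' z' w' : blk x y z w * blk x' y' z' w' =
  blk (x * x' + y * z') (x * y' + y * w') (z * x' + w * z') (z * y' + w * w').
Proof.
have fin (u v : A) h : finsupp (fun g => u g *m v (g^-1 * h)%g) by apply: finsupp_mull; exact: gvalP.
apply: galgP => h; rewrite gvalM /= /conv.
rewrite -!fsumD// -fsum_block; try exact: finsuppD.
apply: eq_fsbigr => g _; exact: (mulmx_block (x g) (y g) (z g) (w g) (x' _) (y' _) (z' _) (w' _)).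
Qed.

Lemma blkD x y z w x' y' z' w' :
  blk x y z w + blk x' y' z' w' = blk (x + x') (y + y') (z + z') (w + w').
Proof. apply: galgP => g; rewrite gvalD; exact: (add_block_mx (x g) (y g) (z g) (w g) (x' g)). Qed.

Lemma blkZ (r : R) x y z w : r *: blk x y z w = blk (r *: x) (r *: y) (r *: z) (r *: w).
Proof. apply: galgP => g; rewrite gvalZ; exact: (scale_block_mx _ (x g) (y g) (z g) (w g)). Qed.

Lemma blk1 : blk 1 0 0 1 = 1.
Proof.
apply: galgP => g; rewrite gval1 /= /tens_mx; case: ifP => _; last exact: (block_mx0 _ n.+1 n.+1 n.+1 n.+1).
exact: (esym (@scalar_mx_block _ n.+1 n.+1 1)).
Qed.

Lemma blk_star x y z w : galg_star (blk x y z w) =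
  blk (galg_star x) (galg_star z) (galg_star y) (galg_star w).
Proof.
apply: galgP => g; rewrite /= /star_mx /adj_mx /=.
rewrite (tr_block_mx (x g^-1%g)); exact: (@map_block_mx _ _ _ n.+1 n.+1 n.+1 n.+1).
Qed.

Lemma blk_tr x y z w : galg_tr (blk x y z w) = galg_tr x + galg_tr w.
Proof. by rewrite /galg_tr -ReD -(mxtrace_block _ (y 1%g) (z 1%g)). Qed.

Lemma ev_blk_diag x y P : ev (blk x 0 0 y) P = blk (ev x P) 0 0 (ev y P).
Proof.
elim/poly_ind: P => [|P c IH].
  rewrite /ev !raddf0; apply: galgP => g /=; exact: esym (block_mx0 _ n.+1 n.+1 n.+1 n.+1).
rewrite !evD !evM IH !evX !evC -blk1 blkM blkZ blkD.
by rewrite !mulr0 !mul0r !addr0 !add0r !scaler0 ?addr0.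
Qed.

(** The selfadjoint dilation of [x], which reduces the [p]-norm of an arbitrary
element to the trace of a power of a selfadjoint one. *)
Definition dilation x : A2 := blk 0 x (galg_star x) 0.

Lemma dilation_selfadj x : selfadj D2 (dilation x).
Proof. by rewrite /selfadj /= blk_star galg_starK linear0. Qed.

Lemma dilationD x y : dilation (x + y) = dilation x + dilation y.
Proof. by rewrite /dilation blkD linearD/= !addr0. Qed.

Lemma dilationZ (r : R) x : dilation (r *: x) = r *: dilation x.
Proof. by rewrite /dilation blkZ linearZ/= scaler0. Qed.

Lemma dilation_sum I (r : seq I) (F : I -> A) :
  dilation (\sum_(i <- r) F i) = \sum_(i <- r) dilation (F i).
Proof.
elim/big_rec2: _ => [|i y x _ <-]; last exact: dilationD.
by rewrite -[0 in LHS](scale0r (0 : A)) dilationZ scale0r.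
Qed.

Lemma dilation_sqr x : dilation x * dilation x = blk (x * galg_star x) 0 0 (galg_star x * x).
Proof. by rewrite /dilation blkM !mulr0 !mul0r !addr0 !add0r. Qed.

(** The square of the dilation is the diagonal of [x * galg_star x] and
[galg_star x * x], and by traciality these two have equal moments. *)
Lemma trpow_dilation (p M : R) x : 2 <= p -> 0 < M ->
  between D2 (- M) M (dilation x) -> between D (- M) M (galg_star x * x) ->
  trpow D2 p M (dilation x) = 2 * calc D (- M) M (galg_star x * x) (powabs (p / 2)) 1.
Proof.
move=> p2 M0 bd bx; have mM : - M < M by rewrite gtrN.
have q0 : 0 <= p / 2 by lra.
set a := galg_star x * x in bx *.
apply: (calc_eq mM (K := 2 * sqmean D 1)) => //.
- exact: tame_powabs.
- by rewrite mulr_ge0// sqmean_ge0.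
move=> e e0; pose L := M + M ^+ 2.
have L0 : - L < L by rewrite gtrN// addr_gt0// exprn_gt0.
have [P PL] := approximable L0 (tame_powR _ _ q0) e0.
have sqM : 0 <= M ^+ 2 by exact: sqr_ge0.
exists (P \Po 'X^2).
  move=> t /andP[t1 t2]; have tt : t ^+ 2 <= M ^+ 2.
    rewrite -(real_normK (num_real t)) lerXn2r ?nnegrE ?(ltW M0)//.
    by rewrite ler_norml t1.
  have := PL (t ^+ 2); rewrite horner_comp hornerXn /powabs.
  have -> : `|t ^+ 2| `^ (p / 2) = `|t| `^ p.
    by rewrite normrX -powR_mulrn// -powRrM; congr (_ `^ _); field.
  apply; have := sqr_ge0 t; rewrite /L => ?; apply/andP; split; lra.
rewrite ev_comp expr2 evM evX dilation_sqr ev_blk_diag mulr1.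
have -> : trc D2 (blk (ev (x * galg_star x) P) 0 0 (ev a P)) = 2 * trc D (ev a P).
  rewrite [LHS]blk_tr mulr_natl mulr2n; congr (_ + _); exact: (trc_ev_mulC D).
have h : `|trc D (ev a P * 1) - calc D (- M) M a (powabs (p / 2)) 1| <= e * sqmean D 1.
  apply: calcP => //; first exact: tame_powR.
  by move=> t /andP[t1 t2]; apply: PL; rewrite /L; apply/andP; split; lra.
rewrite mulr1 in h; move: h; rewrite !ler_norml => /andP[h1 h2].
by apply/andP; split; lra.
Qed.

End Blocks.

(** * Supports of elements of the group algebra *)

Section Support.
Variables (R : realType) (W : groupType) (n : nat).
Local Notation C := R[i].
Local Notation A := (galg R W n).
Implicit Types (x y z : A) (G : W -> Prop).

Definition supported G x := forall g, ~ G g -> x g = 0.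

Lemma supportedD G x y : supported G x -> supported G y -> supported G (x + y).
Proof. by move=> hx hy g hg; rewrite gvalD hx// hy// addr0. Qed.

Lemma supportedZ G r x : supported G x -> supported G (r *: x).
Proof. by move=> hx g hg; rewrite gvalZ hx// scaler0. Qed.

Lemma supported_sum G I (r : seq I) (F : I -> A) : (forall i, supported G (F i)) ->
  supported G (\sum_(i <- r) F i).
Proof.
move=> hF; elim/big_rec: _ => [g _ //|i x _ hx]; exact: supportedD.
Qed.

Lemma supportedM G x y : (forall g h, G g -> G h -> G (g * h)%g) ->
  supported G x -> supported G y -> supported G (x * y).
Proof.
move=> GM hx hy g hg; rewrite gvalM /conv fsbig1// => h _.
have [Gh|/hx ->] := pselect (G h); last by rewrite mul0mx.
rewrite hy ?mulmx0// => Gh'; apply: hg.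
by have := GM _ _ Gh Gh'; rewrite mulgA mulgV mul1g.
Qed.

Lemma supported_ev G x P : G 1%g -> (forall g h, G g -> G h -> G (g * h)%g) ->
  supported G x -> supported G (ev x P).
Proof.
move=> G1 GM hx; elim/poly_ind: P => [|P c IH]; first by rewrite /ev raddf0.
rewrite evD evM evX evC; apply: supportedD; first exact: supportedM.
apply: supportedZ => g hg; rewrite gval1 /tens_mx ifN//.
by apply/eqP => g1; apply: hg; rewrite g1.
Qed.

Lemma galg_tr_supported G x y s : supported G x -> supported (eq s) y -> ~ G s^-1%g ->
  galg_tr (x * y) = 0.
Proof.
move=> hx hy Gs; rewrite /galg_tr gvalM /conv fsbig1 ?linear0// => g _.
have [gs|gs] := eqVneq s (g^-1 * 1)%g.
  by rewrite hx ?mul0mx//; move: gs Gs; rewrite mulg1 => ->; rewrite invgK.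
by rewrite hy ?mulmx0//; exact/eqP.
Qed.

Lemma galg_tensM (B B' : 'M[C]_n.+1) (s t : W) :
  galg_tens B s * galg_tens B' t = galg_tens (B *m B') (s * t)%g :> A.
Proof.
apply: galgP => h; rewrite gvalM conv_tensl /= /tens_mx.
have -> : (s^-1 * h == t)%g = (h == s * t)%g.
  by apply/eqP/eqP => [<-|->]; rewrite mulgA ?mulgV ?mulVg mul1g.
by case: ifP => _; rewrite ?mulmx0.
Qed.

Lemma galg_star_tens (B : 'M[C]_n.+1) (s : W) :
  galg_star (galg_tens B s) = galg_tens (adj_mx B) s^-1%g :> A.
Proof.
apply: galgP => h; rewrite /= /star_mx /tens_mx -(inj_eq invg_inj) invgK.
by case: ifP => _ //; exact: adj_mx0.
Qed.

Lemma galg_tens_sum I (r : seq I) (B : I -> 'M[C]_n.+1) (s : W) :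
  galg_tens (\sum_(i <- r) B i) s = \sum_(i <- r) galg_tens (B i) s :> A.
Proof.
apply: galgP => h; rewrite gval_sum /= /tens_mx.
by case: ifP => // _; rewrite big1.
Qed.

Lemma galg_tensZ (r : R) (B : 'M[C]_n.+1) (s : W) :
  galg_tens ((r%:C)%C *: B) s = r *: galg_tens B s :> A.
Proof.
apply: galgP => h; rewrite gvalZ /= /tens_mx.
by case: ifP => // _; rewrite scaler0.
Qed.

Lemma blk_diag_sum I (r : seq I) (F F' : I -> A) :
  \sum_(i <- r) blk (F i) 0 0 (F' i) = blk (\sum_(i <- r) F i) 0 0 (\sum_(i <- r) F' i).
Proof.
elim: r => [|i r IH]; last by rewrite !big_cons IH blkD !addr0.
rewrite !big_nil; apply: galgP => g; exact: esym (block_mx0 _ n.+1 n.+1 n.+1 n.+1).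
Qed.

Lemma psd_gram_sum (I : Type) (r : seq I) (b : I -> 'M[C]_n.+1) :
  psd (\sum_(i <- r) adj_mx (b i) *m b i).
Proof.
split; first by rewrite raddf_sum; apply: eq_bigr => i _ /=; rewrite adj_mxM adj_mxK.
move=> B; rewrite mulmx_sumr mulmx_suml (raddf_sum mxtrace) /= Re_sum; apply: sumr_ge0 => i _.
by rewrite !mulmxA -adj_mxM -mulmxA Re_tr_gram fro_ge0.
Qed.

End Support.

(** * The upper bound *)

Lemma le_of_average (R : realType) (I : finType) (F : {ffun I -> bool} -> R) (x c y : R) :
  0 <= c -> (forall e, x <= c * F e) -> \sum_e F e <= 2 ^+ #|I| * y -> x <= c * y.
Proof.
move=> c0 xF sF; have c2 : 0 < 2 ^+ #|I| :> R by rewrite exprn_gt0.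
rewrite -(ler_pM2l c2) mulrCA; apply: le_trans (ler_wpM2l c0 sF).
have -> : 2 ^+ #|I| * x = \sum_(e : {ffun I -> bool}) x.
  by rewrite sumr_const card_ffun card_bool -[RHS]mulr_natl natrX.
by rewrite mulr_sumr; apply: ler_sum => e _; exact: xF.
Qed.

Section UpperBound.
Variables (R : realType) (W : groupType) (S : set W) (m : W -> W -> option nat).
Hypothesis WS : coxeter_system S m.
Variables (p : R) (n : nat) (I : finType) (gen : I -> W) (a : I -> 'M[R[i]]_n.+1).
Hypothesis p2 : 2 <= p.
Hypothesis gen_inj : injective gen.
Hypothesis gen_S : forall i, S (gen i).
Local Notation A := (galg R W n).
Local Notation A2 := (galg R W (n + n.+1)).
Local Notation D := (galg_tracial R W n).
Local Notation D2 := (galg_tracial R W (n + n.+1)).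

Let gen_inv s : S s -> (s^-1 = s)%g.
Proof. by move=> Ss; apply: (@mulgI _ s); rewrite mulgV (coxeter_involution WS Ss). Qed.

Let term i : A := galg_tens (a i) (gen i).
Let hterm i : A2 := dilation (term i).

Definition parabolic (T : set W) : set W := [set w | exists l, word_in T l /\ wprod l = w].

Lemma parabolicM T g h : parabolic T g -> parabolic T h -> parabolic T (g * h)%g.
Proof.
move=> [l [Tl <-]] [l' [Tl' <-]]; exists (l ++ l'); split.
  by move=> t; rewrite mem_cat => /orP[/Tl|/Tl'].
by elim: l {Tl} => [|s l IH] /=; rewrite ?mul1g// IH mulgA.
Qed.

Lemma hterm_supported i : supported (eq (gen i)) (hterm i).
Proof.
move=> g hg; rewrite /hterm /dilation /= /star_mx /tens_mx.
have -> : (g == gen i) = false by apply/eqP => gg; apply: hg.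
have -> : (g^-1 == gen i)%g = false.
  by apply/eqP => gg; apply: hg; rewrite -(gen_inv (gen_S i)) -gg invgK.
rewrite adj_mx0; exact: (block_mx0 _ n.+1 n.+1 n.+1 n.+1).
Qed.

(** Polynomials in the first sum are supported by the standard parabolic subgroup of
the generators selected by [X], which contains none of the other generators. *)
Lemma hterm_orthogonal (X : pred I) (c c' : I -> R) P :
  trc D2 (ev (\sum_(i | X i) c i *: hterm i) P * (\sum_(i | ~~ X i) c' i *: hterm i)) = 0.
Proof.
rewrite mulr_sumr linear_sum/=; apply: big1 => j Xj.
rewrite -scalerAr linearZ/=; set T : set W := [set s | exists2 i, X i & s = gen i].
rewrite [X in _ * X](@galg_tr_supported _ _ _ (parabolic T) _ _ (gen j)) ?mulr0//.
- apply: supported_ev; first by exists [::].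
    exact: parabolicM.
  rewrite big_mkcond; apply: supported_sum => i; case: ifP => Xi; last by move=> g _.
  apply: supportedZ => g hg; apply: hterm_supported => gg; apply: hg; exists [:: gen i].
  split; last by rewrite /= mulg1.
  by move=> t; rewrite inE => /eqP ->; exists i.
- exact: hterm_supported.
- rewrite (gen_inv (gen_S j)) => -[l [Tl]].
  apply: (coxeter_parabolic WS _ (gen_S j) _ Tl).
    by move=> _ [i _ ->]; exact: gen_S.
  by move=> [i Xi /gen_inj ji]; move: Xj; rewrite ji Xi.
Qed.

Let H1 := \sum_i a i *m adj_mx (a i).
Let H2 := \sum_i adj_mx (a i) *m a i.
Let x := \sum_i term i.

Lemma sum_hterm_sqr : \sum_i hterm i * hterm i = blk (galg_tens H1 1%g) 0 0 (galg_tens H2 1%g).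
Proof.
rewrite !galg_tens_sum -blk_diag_sum; apply: eq_bigr => i _.
by rewrite dilation_sqr galg_star_tens !galg_tensM mulgV mulVg.
Qed.

(** The signs [e] split the generators into two complementary sets; the two parts of
the sum are orthogonal by [hterm_orthogonal]. *)
Lemma trpow_le_signed M (e : {ffun I -> bool}) : 0 < M ->
  (forall c : I -> R, (forall i, `|c i| <= 2) -> between D2 (- M) M (\sum_i c i *: hterm i)) ->
  trpow D2 p M (dilation x) <= 2 `^ p * trpow D2 p M (signed_sum hterm e).
Proof.
move=> M0 b.
pose u := \sum_(i | ~~ e i) 1 *: hterm i; pose v := \sum_(i | e i) 1 *: hterm i.
have bE (c d : R) : `|c| <= 2 -> `|d| <= 2 -> between D2 (- M) M (c *: u + d *: v).
  move=> c2 d2; have -> : c *: u + d *: v = \sum_i (if e i then d else c) *: hterm i.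
    rewrite (bigID e)/= addrC !scaler_sumr; congr (_ + _); apply: eq_bigr => i ei.
      by rewrite (negbTE ei) scale1r.
    by rewrite ei scale1r.
  by apply: b => i; case: ifP.
have n0 : `|0 : R| <= 2 by rewrite normr0.
have n1 : `|1 : R| <= 2 by rewrite normr1; lra.
have n2 : `|2 : R| <= 2 by rewrite ger0_norm.
have nN : `|-1 : R| <= 2 by rewrite normrN1; lra.
have -> : dilation x = u + v.
  rewrite dilation_sum (bigID e)/= addrC /u /v.
  by congr (_ + _); apply: eq_bigr => i _; rewrite scale1r.
have -> : signed_sum hterm e = u - v.
  rewrite /signed_sum (bigID e)/= addrC /u /v -sumrN; congr (_ + _); apply: eq_bigr => i ei.
    by rewrite (negbTE ei).
  by rewrite ei expr1 scaleN1r scale1r.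
have b1 : between D2 (- M) M u by have := bE 1 0 n1 n0; rewrite scale1r scale0r addr0.
have b2 : between D2 (- M) M v by have := bE 0 1 n0 n1; rewrite scale1r scale0r add0r.
have b3 : between D2 (- M) M (2 *: u) by have := bE 2 0 n2 n0; rewrite scale0r addr0.
have b4 : between D2 (- M) M (2 *: v) by have := bE 0 2 n0 n2; rewrite scale0r add0r.
have b5 : between D2 (- M) M (u + v) by have := bE 1 1 n1 n1; rewrite !scale1r.
have b6 : between D2 (- M) M (u - v) by have := bE 1 (-1) n1 nN; rewrite scale1r scaleN1r.
have b7 : between D2 (- M) M (v - u).
  by have := bE (-1) 1 nN n1; rewrite scale1r scaleN1r addrC.
apply: (trpow_add_le_sub M0 p2 b1 b2 b3 b4 b5 b6 b7) => P; last exact: hterm_orthogonal.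
rewrite /v (eq_bigl (fun i => ~~ ~~ e i)); last by move=> i; rewrite negbK.
exact: hterm_orthogonal.
Qed.

(** The square function of the dilated terms is the diagonal of [H1] and [H2], hence
[khintchine] applies to it with the spectral projections of these two matrices,
placed in the two diagonal blocks. *)
Lemma trace_power_upper : exists2 K, 0 <= K & forall M, 0 < M -> K <= M ->
  2 * calc D (- M) M (galg_star x * x) (powabs (p / 2)) 1 <=
  2 `^ p * ((2 * (p - 1)) `^ (p / 2) *
    (schatten p (mx_rpow 2^-1 H1) `^ p + schatten p (mx_rpow 2^-1 H2) `^ p)).
Proof.
have [K1 K10 hK1] := between_combinations (fun i => dilation_selfadj (term i))
  (fun i => galg_bounded (hterm i)).
have sx : selfadj D (galg_star x * x).
  by rewrite /selfadj /= galg_starM galg_starK.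
have [K2 K20 hK2] := bounded_between sx (galg_bounded _).
exists (K1 + K2); first exact: addr_ge0.
move=> M M0 KM.
have b (c : I -> R) : (forall i, `|c i| <= 2) -> between D2 (- M) M (\sum_i c i *: hterm i).
  by apply: hK1; lra.
have bx : between D (- M) M (galg_star x * x) by apply: hK2; lra.
have bd : between D2 (- M) M (dilation x).
  rewrite dilation_sum (eq_bigr (fun i => 1 *: hterm i)); last by move=> i _; rewrite scale1r.
  by apply: b => i; rewrite normr1; lra.
rewrite -(trpow_dilation p2 M0 bd bx).
have psd1 : psd H1.
  rewrite /H1 (eq_bigr (fun i => adj_mx (adj_mx (a i)) *m adj_mx (a i))); first exact: psd_gram_sum.
  by move=> i _; rewrite adj_mxK.
have [h [E [[h0 hS] EE HE E1 H1E]]] := psd_spectral psd1.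
have [h' [E' [[h'0 hS'] EE' HE' E1' H2E]]] := psd_spectral (psd_gram_sum (index_enum I) a).
have p0 : p != 0 by rewrite gt_eqF// (lt_le_trans _ p2).
have sumK (k : 'I_n.+1 -> R) : ((\sum_i k i `^ (p / 2)) `^ p^-1) `^ p = \sum_i k i `^ (p / 2).
  by rewrite -powRrM mulVf// powRr1// sumr_ge0// => i _; exact: powR_ge0.
have S1 : schatten p (mx_rpow 2^-1 H1) `^ p = \sum_i h i `^ (p / 2).
  by rewrite -(sumK h); congr (_ `^ p); exact: hS.
have S2 : schatten p (mx_rpow 2^-1 H2) `^ p = \sum_i h' i `^ (p / 2).
  by rewrite -(sumK h'); congr (_ `^ p); exact: hS'.
rewrite (congr2 +%R S1 S2).
pose J := ('I_n.+1 + 'I_n.+1)%type.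
pose d (j : J) := match j with inl i => h i | inr i => h' i end.
pose F (j : J) : A2 := match j with
  | inl i => blk (galg_tens (E i) 1%g) 0 0 0 | inr i => blk 0 0 0 (galg_tens (E' i) 1%g) end.
have FF j : F j = F j * adj D2 (F j).
  case: j => i; rewrite /F [adj D2 _]blk_star galg_star_tens invg1.
    by rewrite (EE i).1 !linear0 blkM galg_tensM (EE i).2 mulg1 !mulr0 !addr0 mul0r.
  by rewrite (EE' i).1 !linear0 blkM galg_tensM (EE' i).2 mulg1 !mulr0 !mul0r !add0r.
have F1 : \sum_j F j = 1.
  rewrite big_sumType /= !blk_diag_sum blkD -!galg_tens_sum E1 E1' !sumr_const !mul0rn !addr0 add0r.
  exact: blk1.
have trF j : trc D2 (F j) = 1.
  case: j => i; rewrite /F [LHS]blk_tr linear0 ?addr0 ?add0r /galg_tr /= /tens_mx eqxx.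
    exact: (HE i).1.
  exact: (HE' i).1.
have sq : \sum_i hterm i * hterm i = \sum_j d j *: F j.
  rewrite sum_hterm_sqr big_sumType /=.
  rewrite (eq_bigr (fun i => blk (galg_tens ((h i)%:C%C *: E i) 1%g) 0 0 0)); last first.
    by move=> i _; rewrite blkZ !scaler0 galg_tensZ.
  rewrite [X in _ = _ + X](eq_bigr (fun i => blk 0 0 0 (galg_tens ((h' i)%:C%C *: E' i) 1%g))); last first.
    by move=> i _; rewrite blkZ !scaler0 galg_tensZ.
  by rewrite !blk_diag_sum blkD -!galg_tens_sum -H1E -H2E !sumr_const !mul0rn !addr0 add0r.
have bs e : between D2 (- M) M (signed_sum hterm e).
  by apply: b => i; rewrite normrX normrN1 expr1n ler1n.
have d0 j : 0 <= d j by case: j => i; [exact: h0 | exact: h'0].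
have RHSE : \sum_j d j `^ (p / 2) * trc D2 (F j) =
    \sum_i h i `^ (p / 2) + \sum_i h' i `^ (p / 2).
  rewrite big_sumType /=; congr (_ + _); apply: eq_bigr => i _.
    by rewrite (trF (inl i)) mulr1.
  by rewrite (trF (inr i)) mulr1.
rewrite -RHSE; apply: (le_of_average (powR_ge0 _ _) _ (khintchine M0 p2 bs d0 FF F1 sq)) => e.
exact: trpow_le_signed.
Qed.

End UpperBound.

(** * The lower bound *)

Section LowerBound.
Variables (R : realType) (W : groupType) (n : nat).
Local Notation A := (galg R W n).
Local Notation D := (galg_tracial R W n).

(** Spectral projections [E i] of the coefficient at 1, placed at 1, see [b] with
barycentre the corresponding eigenvalue, and [calc_jensen] applies. *)
Lemma schatten_coef1_le (p M : R) (b : A) : 2 <= p -> 0 < M -> between D (- M) M b ->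
  psd (b 1%g) ->
  schatten p (mx_rpow 2^-1 (b 1%g)) `^ p <= calc D (- M) M b (powabs (p / 2)) 1.
Proof.
move=> p2 M0 bb psdb; have p0 : p != 0 by rewrite gt_eqF//; lra.
have r1 : 1 <= p / 2 by lra.
have [h [E [[h0 hS] EE HE E1 bE]]] := psd_spectral psdb.
have -> : schatten p (mx_rpow 2^-1 (b 1%g)) `^ p = \sum_i h i `^ (p / 2).
  rewrite (hS p) -powRrM mulVf// powRr1// sumr_ge0// => i _; exact: powR_ge0.
pose F i : A := galg_tens (E i) 1%g.
have trF i : trc D (F i) = 1 by rewrite /F /= /galg_tr /= /tens_mx eqxx (HE i).1.
have -> : \sum_i h i `^ (p / 2) = \sum_i h i `^ (p / 2) * trc D (F i).
  by apply: eq_bigr => i _; rewrite trF mulr1.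
apply: calc_jensen => //.
- by move=> i; rewrite /F [adj D _]galg_star_tens galg_tensM invg1 mulg1 (EE i).1 (EE i).2.
- by rewrite /F -galg_tens_sum E1.
- move=> i; rewrite trF mulr1 /= /galg_tr gvalM conv_tensr invg1 mulg1 (HE i).2.
  by rewrite linearZ/= Re_realM (HE i).1 mulr1.
Qed.

Lemma galg_star_sum_tens (I : finType) (g : I -> W) (a : I -> 'M[R[i]]_n.+1) :
  galg_star (\sum_i galg_tens (a i) (g i)) = \sum_i galg_tens (adj_mx (a i)) (g i)^-1%g.
Proof. by rewrite linear_sum; apply: eq_bigr => i _; exact: galg_star_tens. Qed.

(** Distinct group elements do not interact in the coefficient at 1. *)
Lemma coef1_gram (I : finType) (g : I -> W) (a : I -> 'M[R[i]]_n.+1) : injective g ->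
  gval (galg_star (\sum_i galg_tens (a i) (g i)) * \sum_i galg_tens (a i) (g i)) 1%g =
  \sum_i adj_mx (a i) *m a i.
Proof.
move=> gI; rewrite galg_star_sum_tens mulr_suml gval_sum; apply: eq_bigr => i _.
rewrite mulr_sumr gval_sum (bigD1 i) // big1 => [|j ji].
  rewrite [LHS]addr0 galg_tensM mulVg /=; exact: (ifT _ _ (eqxx _)).
rewrite galg_tensM /= /tens_mx ifN//.
by apply: contra ji => /eqP gg; apply/eqP/gI/(mulgI (g i)^-1%g); rewrite -gg mulVg.
Qed.

(** The coefficients at 1 of [galg_star x * x] and [x * galg_star x] are the two
square functions, and these two elements have equal moments. *)
Lemma trace_power_lower (p : R) (I : finType) (g : I -> W) (a : I -> 'M[R[i]]_n.+1) :
  2 <= p -> injective g ->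
  let x := \sum_i galg_tens (a i) (g i) in
  exists2 K, 0 <= K & forall M, 0 < M -> K <= M ->
  schatten p (mx_rpow 2^-1 (\sum_i a i *m adj_mx (a i))) `^ p <=
    calc D (- M) M (galg_star x * x) (powabs (p / 2)) 1 /\
  schatten p (mx_rpow 2^-1 (\sum_i adj_mx (a i) *m a i)) `^ p <=
    calc D (- M) M (galg_star x * x) (powabs (p / 2)) 1.
Proof.
move=> p2 gI x.
have sx y : selfadj D (galg_star y * y).
  by rewrite /selfadj /= galg_starM galg_starK.
have [K1 K10 hK1] := bounded_between (sx x) (galg_bounded _).
have [K2 K20 hK2] := bounded_between (sx (galg_star x)) (galg_bounded _).
exists (K1 + K2); first exact: addr_ge0.
move=> M M0 KM.
have b1 : between D (- M) M (galg_star x * x) by apply: hK1; lra.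
have b2 : between D (- M) M (galg_star (galg_star x) * galg_star x) by apply: hK2; lra.
split; last first.
  rewrite -(coef1_gram a gI); apply: (schatten_coef1_le p2 M0 b1).
  rewrite (coef1_gram a gI); exact: psd_gram_sum.
have gIV : injective (fun i => (g i)^-1%g) by move=> i j /invg_inj/gI.
have sxE := galg_star_sum_tens g a; rewrite -/x in sxE.
have EH : gval (galg_star (galg_star x) * galg_star x) 1%g = \sum_i a i *m adj_mx (a i).
  rewrite sxE (coef1_gram (fun i => adj_mx (a i)) gIV).
  by apply: eq_bigr => i _; rewrite adj_mxK.
have -> : calc D (- M) M (galg_star x * x) (powabs (p / 2)) 1 =
    calc D (- M) M (galg_star (galg_star x) * galg_star x) (powabs (p / 2)) 1.
  have r0 : 0 <= p / 2 by lra.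
  have mM : - M < M by rewrite gtrN.
  rewrite galg_starK in b2 *; exact: (calc_mulC mM (tame_powR _ _ r0) b1 b2).
rewrite -EH; apply: (schatten_coef1_le p2 M0 b2).
rewrite sxE (coef1_gram (fun i => adj_mx (a i)) gIV); exact: psd_gram_sum.
Qed.

End LowerBound.

(** * Comparison of the two norms *)

Section Scalars.
Variable R : realType.
Implicit Types p c s t : R.

(** Extraction of [p]-th roots; the constant comes from [2 * (p - 1) <= 2 * p]. *)
Lemma max_schatten_bounds p c s t : 2 <= p -> 0 <= c -> 0 <= s -> 0 <= t ->
  s `^ p <= c -> t `^ p <= c ->
  2 * c <= 2 `^ p * ((2 * (p - 1)) `^ (p / 2) * (s `^ p + t `^ p)) ->
  Num.max s t <= c `^ p^-1 /\
  c `^ p^-1 <= 2 * Num.sqrt 2 * Num.sqrt p * Num.max s t.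
Proof.
move=> p2 c0 s0 t0 sc tc h; have p0 : 0 < p by lra.
have pI0 : 0 <= p^-1 by rewrite invr_ge0 ltW.
have pK (u : R) : 0 <= u -> (u `^ p) `^ p^-1 = u.
  by move=> u0; rewrite -powRrM mulfV ?gt_eqF// powRr1.
have mono (u v : R) : 0 <= u -> u <= v -> u `^ p^-1 <= v `^ p^-1.
  by move=> u0 uv; apply: ge0_ler_powR; rewrite ?nnegrE//; apply: le_trans uv.
split.
  rewrite ge_max -{1}(pK s)// -{1}(pK t)//.
  by apply/andP; split; apply: mono => //; exact: powR_ge0.
set r := Num.max s t; have r0 : 0 <= r by rewrite le_max s0.
have rs : s `^ p <= r `^ p by apply: ge0_ler_powR; rewrite ?nnegrE ?(ltW p0)// le_max lexx.
have rt : t `^ p <= r `^ p by apply: ge0_ler_powR; rewrite ?nnegrE ?(ltW p0)// le_max lexx orbT.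
have q0 : 0 <= 2 * (p - 1) by lra.
set q := 2 * (p - 1) in q0 h *.
have sq : q `^ (p / 2) = Num.sqrt q `^ p.
  by rewrite -powR12_sqrt// -powRrM; congr (_ `^ _); rewrite mulrC.
have cr : c <= (2 * Num.sqrt q * r) `^ p.
  rewrite !powRM ?sqrtr_ge0// ?mulr_ge0 ?sqrtr_ge0//.
  rewrite -(ler_pM2l (ltr0n R 2)); apply: (le_trans h); rewrite sq.
  have -> : 2 * (2 `^ p * Num.sqrt q `^ p * r `^ p) =
      2 `^ p * (Num.sqrt q `^ p * (r `^ p + r `^ p)) by ring.
  by rewrite ler_wpM2l ?powR_ge0// ler_wpM2l ?powR_ge0// lerD.
apply: (le_trans (mono _ _ c0 cr)); rewrite pK ?mulr_ge0 ?sqrtr_ge0//.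
rewrite ler_wpM2r// -mulrA ler_wpM2l// -sqrtrM// ler_wsqrtr//.
by rewrite /q ler_wpM2l//; lra.
Qed.

End Scalars.

Lemma fsum_seq_sub (T : choiceType) (V W : zmodType) (S : set T) (a : T -> W) (F : T -> V) :
  finite_set [set s | S s /\ a s <> 0] -> (forall s, a s = 0 -> F s = 0) ->
  \sum_(s \in S) F s = \sum_(s : fset_set [set s | S s /\ a s <> 0]) F (val s).
Proof.
move=> fin aF; rewrite (@fsbigE _ _ _ _ S (fset_set [set s | S s /\ a s <> 0])).
- rewrite big_seq_fsetE; apply: eq_bigl => i; have := valP i.
  by rewrite in_fset_set// !inE /= => -[Si _]; rewrite mem_set.
- exact: fset_uniq.
- by move=> s /=; rewrite in_fset_set// inE => -[].
- move=> s Ss; rewrite in_fset_set// => hs; apply: aF; apply: contrapT => as0.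
  by move: hs; rewrite notin_setE; apply.
Qed.

Section Empty.
Variables (R : realType) (W : groupType).

Lemma schatten_dim0 (p : R) (A : 'M[R[i]]_0) : p != 0 -> schatten p A = 0.
Proof. by move=> p0; rewrite /schatten /mxtrace big_ord0 powR0// invr_neq0. Qed.

Lemma Lp_norm_dim0 (p : R) (x : W -> 'M[R[i]]_0) : p != 0 -> Lp_norm p x = 0.
Proof. by move=> p0; rewrite /Lp_norm /op_trace big_ord0 powR0// invr_neq0. Qed.

End Empty.

Lemma Lp_norm_galg (R : realType) (W : groupType) n (p M : R) (x : galg R W n) :
  2 <= p -> 0 < M -> between (galg_tracial R W n) (- M) M (galg_star x * x) ->
  Lp_norm p (gval x) =
  calc (galg_tracial R W n) (- M) M (galg_star x * x) (powabs (p / 2)) 1 `^ p^-1.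
Proof.
move=> p2 M0 bx; have r0 : 0 <= p / 2 by lra.
have sx : selfadj (galg_tracial R W n) (galg_star x * x).
  by rewrite /selfadj /= galg_starM galg_starK.
have xE : lreg (star (gval x)) \o lreg (gval x) = conv (gval (galg_star x * x)) :> (_ -> _ -> 'cV_n.+1).
  apply/funext => f; rewrite gvalM -convA; [exact: erefl | exact: finsupp_star (gvalP x) | exact: gvalP].
by rewrite -(op_trace_rpow sx (pos_gram _ x) r0 M0 bx) /Lp_norm xE.
Qed.

Theorem theorem8p2 (R : realType) :
  exists A' : R, 0 < A' /\
    forall (W : groupType) (S : set W) (m : W -> W -> option nat)
      (p : R) (n : nat) (a : W -> 'M[R[i]]_n),
      coxeter_system S m -> 2 <= p ->
      finite_set [set s | S s /\ a s <> 0] ->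
      let x := \sum_(s \in S) tens (a s) s in
      RC_norm S p a <= Lp_norm p x
      /\ Lp_norm p x <= 2 * A' * Num.sqrt p * RC_norm S p a.
Proof.
exists (Num.sqrt 2); split; first by rewrite sqrtr_gt0.
move=> W S m p n a WS p2 fin.
have p0 : p != 0 by rewrite gt_eqF//; lra.
case: n a fin => [|n] a fin x.
  have -> : RC_norm S p a = 0 by rewrite /RC_norm !(schatten_dim0 _ p0) maxxx.
  by rewrite (Lp_norm_dim0 _ p0) mulr0.
pose X := fset_set [set s | S s /\ a s <> 0].
pose y : galg R W n := \sum_(i : X) galg_tens (a (val i)) (val i).
have xy : x = gval y.
  rewrite /x (fsum_seq_sub (a := a))//; last first.
    by move=> s as0; apply/funext => g; rewrite /tens as0; case: ifP.
  apply/funext => g; rewrite fct_sumE /y gval_sum; exact: erefl.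
have valS (i : X) : S (val i) by have := valP i; rewrite in_fset_set// inE => -[].
have [K1 K10 h1] := trace_power_upper WS (fun i : X => a (val i)) p2 val_inj valS.
have [K2 K20 h2] := trace_power_lower (fun i : X => a (val i)) p2 val_inj.
have sy : selfadj (galg_tracial R W n) (galg_star y * y).
  by rewrite /selfadj /= galg_starM galg_starK.
have [K3 K30 h3] := bounded_between sy (galg_bounded _).
pose M := K1 + K2 + K3 + 1.
have M0 : 0 < M by rewrite /M; lra.
have M1 : K1 <= M by rewrite /M; lra.
have M2 : K2 <= M by rewrite /M; lra.
have M3 : K3 <= M by rewrite /M; lra.
rewrite xy (Lp_norm_galg p2 M0 (h3 M M3)).
have rowE : \sum_(s \in S) a s *m adjmx (a s) = \sum_(i : X) a (val i) *m adj_mx (a (val i)).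
  by apply: (fsum_seq_sub (F := fun s => a s *m adjmx (a s))) => // s ->; rewrite mul0mx.
have colE : \sum_(s \in S) adjmx (a s) *m a s = \sum_(i : X) adj_mx (a (val i)) *m a (val i).
  by apply: (fsum_seq_sub (F := fun s => adjmx (a s) *m a s)) => // s ->; rewrite mulmx0.
have u := h1 M M0 M1; have [l1 l2] := h2 M M0 M2.
have c0 := le_trans (powR_ge0 _ _) l1; rewrite /RC_norm rowE colE.
exact: (max_schatten_bounds p2 c0 (powR_ge0 _ _) (powR_ge0 _ _) l1 l2 u).
Qed.
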